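(* Let $E$ be a Hermite–Biehler entire function with no real zeros whose phase function satisfies $\varphi'\in L^\infty(\mathbb{R})$, let $p\geq 1$ and $\xi\in\mathbb{R}$, and let $f\in\mathcal{H}^p(E)$ be a nonzero function satisfying $$\lvert f(\xi)/E(\xi)\rvert = C(p,E,\xi)\,\lVert f/E\rVert_p.$$ Then the zeros of $f$ are uniformly separated, i.e. there exists $\delta>0$ such that $\lvert\lambda_1-\lambda_2\rvert>\delta$ for all distinct zeros $\lambda_1,\lambda_2$ of $f$.
   Context: An entire function $E$ is Hermite–Biehler if $\lvert E(\overline{z})\rvert < \lvert E(z)\rvert$ for $z$ in the upper half-plane $\mathbb{C}_+$. Let $E^{\#}(z)=\overline{E(\overline z)}$; the phase function $\varphi$ is a smooth real function on $\mathbb{R}$ with $E^{\#}(x)/E(x) = e^{i\varphi(x)}$ (equivalently $\varphi=-2\arg E$ on $\mathbb{R}$). For $0<p<\infty$, $\mathcal{H}^p(E)$ is the space of entire $f$ such that $f/E$ and $f^{\#}/E$ belong to the Hardy space $H^p(\mathbb{C}_+)$, with $\lVert f/E\rVert_p = (\int_{\mathbb{R}}\lvert f(x)/E(x)\rvert^p dx)^{1/p}$. For $\xi\in\mathbb{R}$, $C(p,E,\xi)$ is the smallest constant such that $\lvert f(\xi)/E(\xi)\rvert\le C(p,E,\xi)\lVert f/E\rVert_p$ for all $f\in\mathcal{H}^p(E)$. *)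

(* Defs.v *)
(* mathcomp-analysis over an abstract R : realType,
   complex numbers R[i] from mathcomp-real-closed. *)
From mathcomp Require Import all_boot all_order all_algebra.
From mathcomp Require Import all_classical all_reals all_analysis.
From mathcomp Require Export complex.
Set Implicit Arguments. Unset Strict Implicit. Unset Printing Implicit Defensive.
Import Order.TTheory GRing.Theory Num.Theory.
Import numFieldNormedType.Exports.
Local Open Scope ring_scope.
Local Open Scope complex_scope.

Section Defs.
Variable R : realType.

(* The complex plane, with its structure of normed module over itself,
   so that [derivable F z 1] is complex differentiability at z. *)
Definition CC := (R[i])^o.

(* modulus |z| as a real number *)
Definition cabs (z : R[i]) : R := Normc.normc z.

(* F is entire (holomorphic on all of C). *)
Definition entire (F : CC -> CC) : Prop := forall z : CC, derivable F z 1.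

(* F is holomorphic on the open upper half plane C_+. *)
Definition holo_upper (F : CC -> CC) : Prop :=
  forall z : CC, 0 < Im (z : R[i]) -> derivable F z 1.

(* E^#(z) = conj (E (conj z)) *)
Definition sharp (F : CC -> CC) : CC -> CC :=
  fun z => ((F ((z : R[i])^*)) : R[i])^*.

(* Hermite–Biehler entire function: |E(conj z)| < |E(z)| for z in C_+. *)
Definition hermite_biehler (E : CC -> CC) : Prop :=
  entire E /\
  forall z : CC, 0 < Im (z : R[i]) -> cabs (E ((z : R[i])^*)) < cabs (E z).

(* Hardy space H^p(C_+):  F holomorphic on C_+ and
   sup_{y>0} \int_R |F(x+iy)|^p dx < +oo. *)
Definition hardy (p : R) (F : CC -> CC) : Prop :=
  holo_upper F /\
  exists M : R, forall y : R, 0 < y ->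
    (\int[lebesgue_measure]_(x in [set: R])
        ((cabs (F ((x%:C + 'i * y%:C) : R[i])) `^ p)%:E) <= M%:E)%E.

(* The de Branges-type space H^p(E). *)
Definition HpE (p : R) (E : CC -> CC) (f : CC -> CC) : Prop :=
  entire f /\ hardy p (fun z => f z / E z) /\ hardy p (fun z => sharp f z / E z).

(* ||f/E||_p = (\int_R |f(x)/E(x)|^p dx)^(1/p), as an extended real
   (library L^p norm w.r.t. Lebesgue measure on R). *)
Definition normpE (p : R) (E f : CC -> CC) : \bar R :=
  Lnorm lebesgue_measure p%:E
    (fun x : R => (cabs (f (x%:C : R[i]) / E (x%:C : R[i])))%:E).

(* C(p,E,xi): the smallest constant C >= 0 with
   |f(xi)/E(xi)| <= C ||f/E||_p for all f in H^p(E)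
   (+oo if there is no such constant). *)
Definition Cbest (p : R) (E : CC -> CC) (xi : R) : \bar R :=
  ereal_inf [set c%:E | c in [set c : R | 0 <= c /\
     forall g : CC -> CC, HpE p E g ->
       ((cabs (g (xi%:C : R[i]) / E (xi%:C : R[i])))%:E
          <= c%:E * normpE p E g)%E]].

(* E has a phase function phi (smooth real function with
   E^#(x)/E(x) = e^{i phi(x)}) whose derivative lies in L^oo(R). *)
Definition phase_deriv_Linf (E : CC -> CC) : Prop :=
  exists phi : R -> R,
    (forall (n : nat) (x : R), derivable (derive1n n phi) x 1) /\
    (forall x : R, (sharp E (x%:C : R[i]) / E (x%:C : R[i]) : R[i])
                   = cos (phi x) +i* sin (phi x)) /\
    (Lnorm lebesgue_measure +oo%E (EFin \o derive1 phi) < +oo)%E.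

End Defs.

(* Main.v *)
(** If g in H^p(E) agrees with f at xi, extremality of f gives
    ||g / E||_p >= ||f / E||_p; well-chosen competitors g contradict this.

    At a non-real zero l, replace the factor 1 - (z - xi) / (l - xi) of f by
    1 - Re(1 / (l - xi)) (z - xi), which is smaller on the real line.  So the zeros
    of f are real.  If a, b are close real zeros, multiply f by
    1 - s (z - xi)^2 / ((z - a)(z - b)) with a small s > 0: this decreases |f| away
    from a, and the loss near a is small because evaluation at real points is
    bounded, |g(x) / E(x)| <= K ||g / E||_p uniformly in x.

    That bound is where phi' in L^oo enters.  Theta = E^# / E is bounded by 1 in
    the upper half-plane and Lipschitz on the real line, hence Lipschitz in the
    closed half-plane by Phragmen-Lindelof.  So |Theta| >= 1/2 in a strip, which
    means that |E(z)| and |E(conj z)| are comparable near the real line; there g / E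
    is holomorphic and O(||g / E||_p / |Im z|), and the maximum principle on squares
    centered at real points bounds it on the real line.

    Goursat's theorem gives primitives, and these give the maximum principle
    without power series; the maximum principle applied to difference quotients
    yields removability of singularities. *)
Require Import Defs.
From mathcomp Require Import all_boot all_order all_algebra.
From mathcomp Require Import all_classical all_reals all_analysis.
From mathcomp Require Import measurable_realfun ess_sup_inf complex ring lra.
Set Implicit Arguments. Unset Strict Implicit. Unset Printing Implicit Defensive.
Import Order.TTheory GRing.Theory Num.Theory.
Import numFieldNormedType.Exports.
Local Open Scope ring_scope.
Local Open Scope classical_set_scope.
Local Open Scope complex_scope.
Local Notation Re := complex.Re.
Local Notation Im := complex.Im.
Local Notation i_ := ('i%C).

(** The separation must not depend on where the pair a, b lies, although nothing is known about the
    size of f there. Hence both the gain and the loss are measured against one function, G = s w f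
    with w = (z - xi)^2 / ((z - a)(z - b)). It belongs to H^p(E) because both poles are zeros of f.
    Off a short interval around a, G = u f with 0 <= u <= 1, and (1 - u)^p + u^p <= 1 makes the gain
    at least |G|^p. On that interval s is large enough that |f| <= 11 |G|, so the loss is at most a
    multiple of the supremum of |G / E|^p, that is, of ||G / E||_p^p times the length of the
    interval. The norm of G cancels and only a condition on the length survives. The square in w
    makes w nonnegative on the real line outside the interval between a and b, and bounded at
    infinity. Extremality is an equation in [0, +oo] and says nothing by itself if the best constant
    is infinite or zero. Infinity is excluded by the positive norm of f; zero is excluded because f
    could then be divided by z - xi forever inside H^p(E). *)

Section Cabs.
Variable R : realType.
Implicit Types z w : R[i].

Lemma cabs_norm z : (cabs z)%:C = `|z|.
Proof. by []. Qed.

Lemma cabs_ge0 z : 0 <= cabs z.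
Proof. by rewrite -ler0c cabs_norm normr_ge0. Qed.

Lemma cabsM z w : cabs (z * w) = cabs z * cabs w.
Proof. by apply: complexI; rewrite rmorphM /= !cabs_norm normrM. Qed.

Lemma cabsV z : cabs z^-1 = (cabs z)^-1.
Proof. exact: Normc.normcV. Qed.

Lemma cabsN z : cabs (- z) = cabs z.
Proof. by apply: complexI; rewrite !cabs_norm normrN. Qed.

Lemma cabs_distC z w : cabs (z - w) = cabs (w - z).
Proof. by rewrite -cabsN opprB. Qed.

Lemma cabsD z w : cabs (z + w) <= cabs z + cabs w.
Proof. by rewrite -lecR rmorphD /= !cabs_norm ler_normD. Qed.

Lemma cabsB z w : cabs (z - w) <= cabs z + cabs w.
Proof. by rewrite -(cabsN w) cabsD. Qed.

Lemma cabs0 : cabs (0 : R[i]) = 0.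
Proof. by apply: complexI; rewrite cabs_norm normr0. Qed.

Lemma cabs1 : cabs (1 : R[i]) = 1.
Proof. by apply: complexI; rewrite cabs_norm normr1. Qed.

Lemma cabs_eq0 z : (cabs z == 0) = (z == 0).
Proof. by apply/eqP/eqP => [/Normc.eq0_normc|->]; rewrite ?cabs0. Qed.

Lemma cabs_gt0 z : (0 < cabs z) = (z != 0).
Proof. by rewrite lt_neqAle cabs_ge0 andbT eq_sym cabs_eq0. Qed.

Lemma cabsX z n : cabs (z ^+ n) = cabs z ^+ n.
Proof. by elim: n => [|n ih]; rewrite ?expr0 ?cabs1// !exprS cabsM ih. Qed.

Lemma cabsJ z : cabs (z^*) = cabs z.
Proof. by apply: complexI; rewrite !cabs_norm normcJ. Qed.

Lemma cabsR (x : R) : cabs (x%:C) = `|x|.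
Proof. by rewrite /cabs /= expr0n /= addr0 sqrtr_sqr. Qed.

Lemma cabs_i : cabs (i_ : R[i]) = 1.
Proof. by rewrite /cabs /= expr0n /= add0r expr1n sqrtr1. Qed.

Lemma Re_le_cabs z : `|Re z| <= cabs z.
Proof. by rewrite -lecR; exact: normc_ge_Re. Qed.

Lemma Im_le_cabs z : `|Im z| <= cabs z.
Proof.
have := Re_le_cabs (z * i_); rewrite ReiNIm normrN cabsM cabs_i mulr1; exact.
Qed.

Lemma cabs_le_ReIm z : cabs z <= `|Re z| + `|Im z|.
Proof.
rewrite {1}(complexE z) (le_trans (cabsD _ _))// cabsM cabs_i mul1r !cabsR//.
Qed.

Lemma cabs_sq z : cabs z ^+ 2 = Re z ^+ 2 + Im z ^+ 2.
Proof. by case: z => a b; rewrite /cabs /= sqr_sqrtr ?addr_ge0 ?sqr_ge0. Qed.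

Lemma cabs_lbD z w : cabs z - cabs w <= cabs (z + w).
Proof. by rewrite lerBlDr -{1}(addrK w z) -(cabsN w) cabsD. Qed.

Lemma cabs_lbB z w : cabs z - cabs w <= cabs (z - w).
Proof. by rewrite -(cabsN w) cabs_lbD. Qed.

Lemma ReD z w : Re (z + w) = Re z + Re w. Proof. by case: z w => ? ? []. Qed.
Lemma ImD z w : Im (z + w) = Im z + Im w. Proof. by case: z w => ? ? []. Qed.
Lemma ReB z w : Re (z - w) = Re z - Re w. Proof. by case: z w => ? ? []. Qed.
Lemma ImB z w : Im (z - w) = Im z - Im w. Proof. by case: z w => ? ? []. Qed.

(** Turns a modulus into the real part of a rotated number. The mean value inequality for curves and
    the equality case of the maximum principle are thereby reduced to real functions. *)
Lemma cabs_dir z : exists2 u : R[i], cabs u = 1 & u * z = (cabs z)%:C.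
Proof.
have [->|z0] := eqVneq z 0; first by exists 1; rewrite ?cabs1// mulr0 cabs0.
exists ((cabs z)%:C / z); last by rewrite divfK.
by rewrite cabsM cabsV cabsR ger0_norm ?cabs_ge0// divff// cabs_eq0.
Qed.

End Cabs.

(** * Complex differentiability *)

Section Diff.
Variable R : realType.
Local Notation C := R[i].
Implicit Types (F G : C -> C) (z w : C).

(* Inductive wrappers: as plain definitions these unfold to products and make
   unification by [apply] very slow. *)
Variant ccont F z : Prop := CCont of {for z, continuous (F : CC R -> CC R)}.

Variant cdiff F z : Prop :=
  CDiff of derivable (F : CC R -> CC R) z (1 : CC R).

(** Balls of [CC R] have radii in R[i]; positivity in R[i] includes being real, so real radii
    suffice. *)
Lemma nbhs_cabs z (A : set C) : nbhs (z : CC R) A <->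
  exists2 d : R, 0 < d & forall w, cabs (w - z) < d -> A w.
Proof.
split.
  move=> /(@nbhs_ballP _ (CC R))[e /= e0 sub]; exists (Re e).
    by move: e0; rewrite ltcE /= => /andP[].
  move=> w wz; apply: sub => /=; rewrite -ball_normE /=.
  have -> : `|z - w : CC R| = (cabs (w - z))%:C by rewrite cabs_distC.
  by move: e0; rewrite !ltcE /= => /andP[/eqP -> _]; rewrite eqxx.
case=> d d0 sub; apply/(@nbhs_ballP _ (CC R)); exists d%:C => /=.
  by rewrite ltcR.
move=> w /=; rewrite -ball_normE /=.
have -> : `|z - w : CC R| = (cabs (w - z))%:C by rewrite cabs_distC.
by rewrite ltcR => /sub.
Qed.

Lemma ccontP F z : ccont F z <->
  forall e : R, 0 < e -> exists2 d : R, 0 < d &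
    forall w, cabs (w - z) < d -> cabs (F w - F z) < e.
Proof.
split=> [[cF] e e0|H].
  have : nbhs (F z : CC R) [set y | cabs (y - F z) < e].
    by apply/nbhs_cabs; exists e.
  by move=> /cF /nbhs_cabs.
split=> A /nbhs_cabs[e e0 sub]; apply/nbhs_cabs.
have [d d0 h] := H e e0; exists d => // w /h; exact: sub.
Qed.

Lemma ccont_cst (c : C) z : ccont (fun=> c) z.
Proof. by split; exact: cst_continuous. Qed.

Lemma ccont_id z : ccont id z.
Proof. by split=> A. Qed.

Lemma ccontD F G z : ccont F z -> ccont G z -> ccont (fun w => F w + G w) z.
Proof.
move=> /ccontP cF /ccontP cG; apply/ccontP => e e0.
have e20 : 0 < e / 2 by lra.
have [d1 d10 h1] := cF _ e20; have [d2 d20 h2] := cG _ e20.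
exists (Num.min d1 d2); first by rewrite lt_min d10.
move=> w; rewrite lt_min => /andP[/h1 w1 /h2 w2].
have -> : F w + G w - (F z + G z) = (F w - F z) + (G w - G z) by ring.
have := cabsD (F w - F z) (G w - G z); lra.
Qed.

Lemma ccontN F z : ccont F z -> ccont (fun w => - F w) z.
Proof. by case=> cF; split; exact: (@continuousN _ (CC R) (CC R)). Qed.

Lemma ccontB F G z : ccont F z -> ccont G z -> ccont (fun w => F w - G w) z.
Proof. by move=> cF cG; apply: ccontD => //; exact: ccontN. Qed.

Lemma ccontM F G z : ccont F z -> ccont G z -> ccont (fun w => F w * G w) z.
Proof.
move=> /ccontP cF /ccontP cG; apply/ccontP => e e0.
have Fz0 := cabs_ge0 (F z); have Gz0 := cabs_ge0 (G z).
have e1 : 0 < e / 2 / (cabs (G z) + 1) by rewrite !divr_gt0// ltr_wpDl.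
have e2 : 0 < Num.min 1 (e / 2 / (cabs (F z) + 1)).
  by rewrite lt_min ltr01 /= !divr_gt0// ltr_wpDl.
have [d1 d10 h1] := cF _ e1; have [d2 d20 h2] := cG _ e2.
exists (Num.min d1 d2); first by rewrite lt_min d10.
move=> w; rewrite lt_min => /andP[/h1 w1 /h2]; rewrite lt_min => /andP[w2 w3].
have -> : F w * G w - F z * G z = (F w - F z) * G w + F z * (G w - G z).
  by ring.
have Gw : cabs (G w) <= cabs (G z) + 1.
  have := cabsD (G z) (G w - G z); rewrite addrC subrK; lra.
have := cabsD ((F w - F z) * G w) (F z * (G w - G z)); rewrite !cabsM => /le_lt_trans.
apply; rewrite (splitr e); apply: ler_ltD.
  rewrite (le_trans (ler_wpM2l (cabs_ge0 _) Gw))//.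
  by rewrite -ler_pdivlMr ?ltr_wpDl// ltW.
have : (cabs (F z) + 1) * cabs (G w - G z) < e / 2.
  by rewrite mulrC -ltr_pdivlMr ?ltr_wpDl.
have := cabs_ge0 (G w - G z); nra.
Qed.

Lemma ccontV F z : ccont F z -> F z != 0 -> ccont (fun w => (F w)^-1) z.
Proof. by case=> cF Fz; split; exact: (@continuousV R[i] (CC R)). Qed.

Lemma ccont_comp F G z : ccont F z -> ccont G (F z) -> ccont (G \o F) z.
Proof. by case=> cF [cG]; split=> A /cG /cF. Qed.

Lemma ccont_near F G z (d : R) : 0 < d ->
  (forall w, cabs (w - z) < d -> F w = G w) -> ccont F z -> ccont G z.
Proof.
move=> d0 FG /ccontP cF; apply/ccontP => e /cF[d' d'0 h].
exists (Num.min d d'); first by rewrite lt_min d0.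
move=> w; rewrite lt_min => /andP[w1 w2].
by rewrite -!FG ?subrr ?cabs0// h.
Qed.

Lemma ccont_conj z : ccont (@conjc R) z.
Proof.
by apply/ccontP => e e0; exists e => // w; rewrite -rmorphB cabsJ.
Qed.

(** Caratheodory's form of the derivative: l is the derivative at z exactly when this completed
    difference quotient is continuous at z. Product and chain rules become algebraic identities, and
    the quotient itself is later fed to the maximum principle. *)
Definition dq F z (l : C) w := if w == z then l else (F w - F z) / (w - z).

Definition is_cd F z l := ccont (dq F z l) z.

Lemma dqE F z l w : F w = F z + dq F z l w * (w - z).
Proof.
rewrite /dq; case: eqVneq => [->|wz]; first by rewrite subrr mulr0 addr0.
by rewrite divfK ?subr_eq0// addrC subrK.
Qed.

Lemma dq_id F z l : dq F z l z = l.
Proof. by rewrite /dq eqxx. Qed.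

Lemma is_cd_phi F z phi : ccont phi z ->
  (forall w, F w = F z + phi w * (w - z)) -> is_cd F z (phi z).
Proof.
move=> cphi Fphi; apply: (@ccont_near phi _ _ 1) => // w _.
rewrite /dq; case: eqVneq => [->//|wz].
by rewrite Fphi (addrC (F z)) addrK mulfK// subr_eq0.
Qed.

Lemma cdiffP F z : cdiff F z <-> exists l, is_cd F z l.
Proof.
split.
  case; rewrite /derivable => /cvg_ex[l /= Hl]; exists l.
  split=> A /= /nbhs_cabs[e e0]; rewrite dq_id => sub.
  have : nbhs (l : CC R) A by apply/nbhs_cabs; exists e.
  move=> /Hl /= /nbhs_cabs[d d0 h]; apply/nbhs_cabs; exists d => // w wd.
  rewrite /= /dq; case: eqVneq => [_|wz]; first by apply: sub; rewrite subrr cabs0.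
  have := h (w - z); rewrite subr0 subr_eq0 => /(_ wd wz).
  by rewrite /= scaler1 subrK mulrC.
case=> l [cphi]; split; rewrite /derivable; apply/cvg_ex; exists l.
move=> A /=; rewrite -{1}(dq_id F z l) => /cphi /nbhs_cabs[d d0 h].
apply/nbhs_cabs; exists d => // w wd w0.
have /= := h (w + z); rewrite addrK; rewrite subr0 in wd => /(_ wd).
suff -> : w^-1 *: (F (w *: 1 + z) - F z) = dq F z l (w + z) by [].
rewrite scaler1 /dq -subr_eq0 addrK ifN//.
by rewrite [_ *: _]mulrC.
Qed.

Lemma is_cd_cdiff F z l : is_cd F z l -> cdiff F z.
Proof. by move=> h; apply/cdiffP; exists l. Qed.

Lemma is_cd_cont F z l : is_cd F z l -> ccont F z.
Proof.
move=> h; apply: (@ccont_near (fun w => F z + dq F z l w * (w - z)) _ _ 1) => //.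
  by move=> w _; rewrite -dqE.
apply: ccontD; first exact: ccont_cst.
by apply: ccontM => //; apply: ccontB; [exact: ccont_id|exact: ccont_cst].
Qed.

Lemma cdiff_cont F z : cdiff F z -> ccont F z.
Proof. by move=> /cdiffP[l]; exact: is_cd_cont. Qed.

Lemma is_cd_near F G z l (d : R) : 0 < d ->
  (forall w, cabs (w - z) < d -> F w = G w) -> is_cd F z l -> is_cd G z l.
Proof.
move=> d0 FG; apply: (ccont_near d0) => w wd.
by rewrite /dq FG// (FG z) ?subrr ?cabs0.
Qed.

Lemma cdiff_near F G z (d : R) : 0 < d ->
  (forall w, cabs (w - z) < d -> F w = G w) -> cdiff F z -> cdiff G z.
Proof.
move=> d0 FG /cdiffP[l Fl]; apply/cdiffP; exists l; exact: (is_cd_near d0 FG Fl).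
Qed.

Lemma is_cd_eps F z l : is_cd F z l <->
  forall e : R, 0 < e -> exists2 d : R, 0 < d &
    forall w, cabs (w - z) < d ->
      cabs (F w - F z - l * (w - z)) <= e * cabs (w - z).
Proof.
split=> [/ccontP cF e /cF[d d0 h]|h].
  exists d => // w /h wd.
  rewrite {1}(dqE F z l w) (addrC (F z)) addrK -mulrBl cabsM.
  by rewrite ler_wpM2r ?cabs_ge0// ltW// -{2}(dq_id F z l).
apply/ccontP => e e0; have e20 : 0 < e / 2 by lra.
have [d d0 {}h] := h _ e20; exists d => // w /h.
rewrite dq_id {1}(dqE F z l w) (addrC (F z)) addrK -mulrBl cabsM.
have [->|wz] := eqVneq w z; first by rewrite dq_id subrr cabs0.
by rewrite ler_pM2r ?cabs_gt0 ?subr_eq0// => /le_lt_trans; apply; lra.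
Qed.

Lemma is_cd_cst c z : is_cd (fun=> c) z 0.
Proof.
apply: (@is_cd_phi _ _ (fun=> 0)); first exact: ccont_cst.
by move=> w; rewrite mul0r addr0.
Qed.

Lemma is_cd_id z : is_cd id z 1.
Proof.
apply: (@is_cd_phi _ _ (fun=> 1)); first exact: ccont_cst.
by move=> w; rewrite mul1r addrC subrK.
Qed.

Lemma is_cdD F G z l m : is_cd F z l -> is_cd G z m ->
  is_cd (fun w => F w + G w) z (l + m).
Proof.
move=> Fl Gm; rewrite -(dq_id F z l) -(dq_id G z m).
apply: (@is_cd_phi _ _ (fun w => dq F z l w + dq G z m w)).
  exact: ccontD.
by move=> w; rewrite {1}(dqE F z l w) {1}(dqE G z m w); ring.
Qed.

Lemma is_cdM F G z l m : is_cd F z l -> is_cd G z m ->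
  is_cd (fun w => F w * G w) z (l * G z + F z * m).
Proof.
move=> Fl Gm; rewrite -(dq_id F z l) -(dq_id G z m).
apply: (@is_cd_phi _ _ (fun w => dq F z l w * G w + F z * dq G z m w)).
  apply: ccontD; apply: ccontM => //; first exact: is_cd_cont Gm.
  exact: ccont_cst.
by move=> w; rewrite {1}(dqE F z l w) {1 2}(dqE G z m w); ring.
Qed.

Lemma is_cdN F z l : is_cd F z l -> is_cd (fun w => - F w) z (- l).
Proof.
move=> Fl; rewrite -(dq_id F z l).
apply: (@is_cd_phi _ _ (fun w => - dq F z l w)); first exact: ccontN.
by move=> w; rewrite {1}(dqE F z l w); ring.
Qed.

Lemma is_cdB F G z l m : is_cd F z l -> is_cd G z m ->
  is_cd (fun w => F w - G w) z (l - m).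
Proof. by move=> Fl /is_cdN; exact: is_cdD. Qed.

Lemma is_cd_comp F G z l m : is_cd F z l -> is_cd G (F z) m ->
  is_cd (fun w => G (F w)) z (m * l).
Proof.
move=> Fl Gm; rewrite -(dq_id F z l) -(dq_id G (F z) m).
apply: (@is_cd_phi _ _ (fun w => dq G (F z) m (F w) * dq F z l w)).
  by apply: ccontM => //; apply: ccont_comp Gm; exact: is_cd_cont Fl.
move=> w; rewrite {1}(dqE G (F z) m (F w)) {2}(dqE F z l w); ring.
Qed.

Lemma cdiff_cst c z : cdiff (fun=> c) z.
Proof. exact: is_cd_cdiff (is_cd_cst c z). Qed.

Lemma cdiff_id z : cdiff id z.
Proof. exact: is_cd_cdiff (is_cd_id z). Qed.

Lemma cdiffD F G z : cdiff F z -> cdiff G z -> cdiff (fun w => F w + G w) z.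
Proof.
by move=> /cdiffP[l Fl] /cdiffP[m Gm]; exact: is_cd_cdiff (is_cdD Fl Gm).
Qed.

Lemma cdiffN F z : cdiff F z -> cdiff (fun w => - F w) z.
Proof. by move=> /cdiffP[l Fl]; exact: is_cd_cdiff (is_cdN Fl). Qed.

Lemma cdiffB F G z : cdiff F z -> cdiff G z -> cdiff (fun w => F w - G w) z.
Proof. by move=> cF /cdiffN; exact: cdiffD. Qed.

Lemma cdiffM F G z : cdiff F z -> cdiff G z -> cdiff (fun w => F w * G w) z.
Proof.
by move=> /cdiffP[l Fl] /cdiffP[m Gm]; exact: is_cd_cdiff (is_cdM Fl Gm).
Qed.

Lemma cdiff_comp F G z : cdiff F z -> cdiff G (F z) ->
  cdiff (fun w => G (F w)) z.
Proof.
by move=> /cdiffP[l Fl] /cdiffP[m Gm]; exact: is_cd_cdiff (is_cd_comp Fl Gm).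
Qed.

Lemma cdiff_inv z : z != 0 -> cdiff (fun w => w^-1) z.
Proof.
move=> z0; apply/cdiffP; exists (- (z^-1 * z^-1)).
have cz : 0 < cabs z by rewrite cabs_gt0.
apply: (@ccont_near (fun w => - (w^-1 * z^-1)) _ _ _ cz) => [w wz|].
  rewrite /dq; case: eqVneq => [->//|wnz].
  have w0 : w != 0.
    by apply: contraTneq wz => ->; rewrite sub0r cabsN ltxx.
  have wz0 : w - z != 0 by rewrite subr_eq0.
  by field; rewrite wz0 z0 w0.
apply: ccontN; apply: ccontM; last exact: ccont_cst.
by apply: ccontV => //; exact: ccont_id.
Qed.

Lemma cdiffV F z : cdiff F z -> F z != 0 -> cdiff (fun w => (F w)^-1) z.
Proof. by move=> cF Fz; apply: cdiff_comp => //; exact: cdiff_inv. Qed.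

Lemma cdiff_div F G z : cdiff F z -> cdiff G z -> G z != 0 ->
  cdiff (fun w => F w / G w) z.
Proof. by move=> cF cG Gz; apply: cdiffM => //; exact: cdiffV. Qed.

Lemma cdiffX F z n : cdiff F z -> cdiff (fun w => F w ^+ n) z.
Proof.
move=> cF; elim: n => [|n ih].
  by apply: (@cdiff_near (fun=> 1) _ _ 1) => //; exact: cdiff_cst.
apply: (@cdiff_near (fun w => F w * F w ^+ n) _ _ 1) => //.
  by move=> w _; rewrite exprS.
exact: cdiffM.
Qed.

Lemma cdiff_sharp F z : cdiff F (z^*) -> cdiff (sharp F) z.
Proof.
move=> /cdiffP[l Fl]; apply/cdiffP; exists (l^*).
apply: (@ccont_near (fun w => (dq F (z^*) l (w^*))^*) _ _ 1) => //.
  move=> w _; rewrite /dq /sharp (can_eq (@conjcK R)).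
  by case: eqVneq => // _; rewrite rmorphM fmorphV !rmorphB /= !conjcK.
apply: (ccont_comp (F := fun w => dq F (z^*) l (w^*)) (G := @conjc R)); last first.
  exact: ccont_conj.
apply: (ccont_comp (F := @conjc R)) => //; exact: ccont_conj.
Qed.

End Diff.

(** * Curves in the complex plane *)

Section RealCurves.
Variable R : realType.
Local Notation C := R[i].

Lemma real_contP (f : R -> R) x : {for x, continuous f} <->
  forall e : R, 0 < e -> exists2 d : R, 0 < d &
    forall y, `|y - x| < d -> `|f y - f x| < e.
Proof.
split=> [cf e e0|H].
  have : nbhs (f x) (ball (f x) e) by exact: nbhsx_ballx.
  move=> /cf /nbhs_ballP[d /= d0 h]; exists d => // y yx.
  by have := h y; rewrite -!ball_normE /= distrC [`|f x - _|]distrC; exact.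
move=> A /nbhs_ballP[e /= e0 sub]; apply/nbhs_ballP.
have [d d0 h] := H e e0; exists d => //= y.
rewrite -ball_normE /= distrC => /h; rewrite distrC => hy; apply: sub.
by rewrite -ball_normE.
Qed.

Lemma is_derive_eps (f : R -> R) (x l : R) : is_derive x 1 f l <->
  forall e : R, 0 < e -> exists2 d : R, 0 < d &
    forall y, `|y - x| < d -> `|f y - f x - l * (y - x)| <= e * `|y - x|.
Proof.
split=> [[df fl] e e0|H].
  have : h^-1 *: ((f \o shift x) (h *: 1) - f x) @[h --> 0^'] --> l.
    by rewrite -fl; exact: df.
  move=> /cvgrPdist_le /(_ e e0) /nbhs_ballP[d /= d0 h]; exists d => // y yx.
  have [->|ynx] := eqVneq y x; first by rewrite !subrr mulr0 subrr normr0 mulr0.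
  have yx0 : y - x != 0 by rewrite subr_eq0.
  have := h (y - x); rewrite -ball_normE /= sub0r normrN => /(_ yx yx0).
  rewrite /shift /= [_ *: 1]mulr1 subrK [_ *: _]mulrC distrC => hy.
  have -> : f y - f x - l * (y - x) = ((f y - f x) / (y - x) - l) * (y - x).
    by rewrite mulrBl divfK.
  by rewrite normrM ler_wpM2r.
have cl : h^-1 *: ((f \o shift x) (h *: 1) - f x) @[h --> 0^'] --> l.
  apply/cvgrPdist_le => e e0; have [d d0 h] := H e e0.
  apply/nbhs_ballP; exists d => //= y; rewrite -ball_normE /= sub0r normrN => yd y0.
  have := h (y + x); rewrite addrK => /(_ yd).
  rewrite /shift /= [_ *: 1]mulr1 [_ *: _]mulrC distrC => hy.
  rewrite -(ler_pM2r (x := `|y|)) ?normr_gt0// -normrM mulrBl divfK//.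
by apply: DeriveDef; [exact: cvgP cl|exact: cvg_lim cl].
Qed.

Variant is_rd (k : R -> C) (t : R) (l : C) : Prop := IsRd of
  forall e : R, 0 < e -> exists2 d : R, 0 < d &
    forall s, `|s - t| < d ->
      cabs (k s - k t - l * (s - t)%:C) <= e * `|s - t|.

Variant rcont (k : R -> C) (t : R) : Prop := RCont of
  forall e : R, 0 < e -> exists2 d : R, 0 < d &
    forall s, `|s - t| < d -> cabs (k s - k t) < e.

Lemma is_rd_parts k t l : is_rd k t l <->
  is_derive t 1 (fun s => Re (k s)) (Re l) /\
  is_derive t 1 (fun s => Im (k s)) (Im l).
Proof.
have ReE s : Re (k s - k t - l * (s - t)%:C) = Re (k s) - Re (k t) - Re l * (s - t).
  by rewrite !ReB; case: (l) => a b /=; rewrite mulr0 subr0.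
have ImE s : Im (k s - k t - l * (s - t)%:C) = Im (k s) - Im (k t) - Im l * (s - t).
  by rewrite !ImB; case: (l) => a b /=; rewrite mulr0 add0r.
split=> [[H]|[/is_derive_eps H1 /is_derive_eps H2]].
  split; apply/is_derive_eps => e /H[d d0 h]; exists d => // s /h.
    by apply: le_trans; rewrite -ReE Re_le_cabs.
  by apply: le_trans; rewrite -ImE Im_le_cabs.
split=> e e0; have e20 : 0 < e / 2 by lra.
have [d1 d10 h1] := H1 _ e20; have [d2 d20 h2] := H2 _ e20.
exists (Num.min d1 d2); first by rewrite lt_min d10.
move=> s; rewrite lt_min => /andP[/h1 s1 /h2 s2].
apply: le_trans (cabs_le_ReIm _) _; rewrite ReE ImE; lra.
Qed.

Lemma is_rd_ext (k k' : R -> C) t l : k =1 k' -> is_rd k t l -> is_rd k' t l.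
Proof. by move=> /funext ->. Qed.

Lemma is_rd_cont k t l : is_rd k t l -> rcont k t.
Proof.
case=> H; split=> e e0; have [d d0 h] := H 1 ltr01.
have l0 : 0 <= cabs l := cabs_ge0 l.
have q0 : 0 < e / (cabs l + 2) by rewrite divr_gt0// ltr_wpDl.
exists (Num.min d (e / (cabs l + 2))); first by rewrite lt_min d0.
move=> s; rewrite lt_min => /andP[/h + s2].
rewrite ltr_pdivlMr ?ltr_wpDl// in s2.
have := cabsD (k s - k t - l * (s - t)%:C) (l * (s - t)%:C).
rewrite subrK cabsM cabsR mul1r => h1 h2.
have := normr_ge0 (s - t); nra.
Qed.

Lemma is_rdD k1 k2 t l1 l2 : is_rd k1 t l1 -> is_rd k2 t l2 ->
  is_rd (fun s => k1 s + k2 s) t (l1 + l2).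
Proof.
case=> H1 [H2]; split=> e e0; have e20 : 0 < e / 2 by lra.
have [d1 d10 h1] := H1 _ e20; have [d2 d20 h2] := H2 _ e20.
exists (Num.min d1 d2); first by rewrite lt_min d10.
move=> s; rewrite lt_min => /andP[/h1 s1 /h2 s2].
have -> : k1 s + k2 s - (k1 t + k2 t) - (l1 + l2) * (s - t)%:C =
  (k1 s - k1 t - l1 * (s - t)%:C) + (k2 s - k2 t - l2 * (s - t)%:C) by ring.
by apply: le_trans (cabsD _ _) _; lra.
Qed.

Lemma is_rdZ c k t l : is_rd k t l -> is_rd (fun s => c * k s) t (c * l).
Proof.
case=> H; split=> e e0.
have q0 : 0 < e / (cabs c + 1) by rewrite divr_gt0// ltr_wpDl ?cabs_ge0.
have [d d0 h] := H _ q0; exists d => // s /h hs.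
have -> : c * k s - c * k t - c * l * (s - t)%:C = c * (k s - k t - l * (s - t)%:C).
  by ring.
rewrite cabsM; apply: le_trans (ler_wpM2l (cabs_ge0 _) hs) _.
rewrite mulrA ler_wpM2r// mulrCA ler_piMr ?(ltW e0)//.
by rewrite ler_pdivrMr ?mul1r ?lerDl// ltr_wpDl ?cabs_ge0.
Qed.

Lemma is_rd_cst c t : is_rd (fun=> c) t 0.
Proof.
split=> e e0; exists 1 => // s _.
by rewrite subrr mul0r subrr cabs0 mulr_ge0// ltW.
Qed.

Lemma is_rd_id t : is_rd (fun s => s%:C) t 1.
Proof.
split=> e e0; exists 1 => // s _.
have -> : s%:C - t%:C - 1 * (s - t)%:C = 0 :> C.
  by rewrite mul1r [(s - t)%:C]rmorphB subrr.
by rewrite cabs0 mulr_ge0// ltW.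
Qed.

Lemma is_rdN k t l : is_rd k t l -> is_rd (fun s => - k s) t (- l).
Proof.
move=> /(is_rdZ (-1)); rewrite mulN1r; apply: is_rd_ext => s; by rewrite mulN1r.
Qed.

Lemma is_rdB k1 k2 t l1 l2 : is_rd k1 t l1 -> is_rd k2 t l2 ->
  is_rd (fun s => k1 s - k2 s) t (l1 - l2).
Proof. by move=> h1 /is_rdN; exact: is_rdD. Qed.

Lemma is_rd_comp (F : C -> C) k t l m : is_rd k t l -> is_cd F (k t) m ->
  is_rd (fun s => F (k s)) t (m * l).
Proof.
move=> kl /is_cd_eps HF; have [ck] := is_rd_cont kl; case: kl => H.
split=> e e0.
have l0 := cabs_ge0 l; have m0 := cabs_ge0 m.
have e10 : 0 < e / 2 / (cabs l + 1) by rewrite !divr_gt0// ltr_wpDl.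
have e20 : 0 < Num.min 1 (e / 2 / (cabs m + 1)).
  by rewrite lt_min ltr01 /= !divr_gt0// ltr_wpDl.
have [d1 d10 h1] := HF _ e10; have [d2 d20 h2] := H _ e20.
have [d3 d30 h3] := ck _ d10.
exists (Num.min d2 d3); first by rewrite lt_min d20.
move=> s; rewrite lt_min => /andP[/h2 s2 /h3 /h1 s1].
have -> : F (k s) - F (k t) - m * l * (s - t)%:C =
  (F (k s) - F (k t) - m * (k s - k t)) + m * (k s - k t - l * (s - t)%:C).
  by ring.
apply: le_trans (cabsD _ _) _; rewrite cabsM.
set A := cabs (F _ - _ - _) in s1 *; set B := cabs (k s - k t - _) in s2 *.
have kst : cabs (k s - k t) <= (cabs l + 1) * `|s - t|.
  have := cabsD (k s - k t - l * (s - t)%:C) (l * (s - t)%:C).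
  rewrite subrK cabsM cabsR -/B => /le_trans; apply.
  rewrite mulrDl addrC lerD2l; apply: le_trans s2 _.
  by rewrite ler_wpM2r// ge_min lexx.
have A1 : A <= e / 2 * `|s - t|.
  apply: le_trans s1 _; apply: le_trans (ler_wpM2l (ltW e10) kst) _.
  by rewrite mulrA divfK// gt_eqF// ltr_wpDl.
have B1 : cabs m * B <= e / 2 * `|s - t|.
  have : B <= e / 2 / (cabs m + 1) * `|s - t|.
    by apply: le_trans s2 _; rewrite ler_wpM2r// ge_min lexx orbT.
  rewrite mulrAC ler_pdivlMr ?ltr_wpDl// => h.
  have : 0 <= B := cabs_ge0 _; nra.
lra.
Qed.

Lemma rcont_comp (F : C -> C) k t : rcont k t -> ccont F (k t) ->
  rcont (fun s => F (k s)) t.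
Proof.
case=> H /ccontP cF; split=> e /cF[d d0 h]; have [d' d'0 h'] := H _ d0.
by exists d' => // s /h' /h.
Qed.

Lemma rcont_Re c k t : rcont k t -> {for t, continuous (fun s => Re (c * k s))}.
Proof.
case=> H; apply/real_contP => e e0.
have q0 : 0 < e / (cabs c + 1) by rewrite divr_gt0// ltr_wpDl ?cabs_ge0.
have [d d0 h] := H _ q0; exists d => // s /h.
rewrite ltr_pdivlMr ?ltr_wpDl ?cabs_ge0// => hs.
rewrite -ReB -mulrBr; apply: le_lt_trans (Re_le_cabs _) _; rewrite cabsM.
have := cabs_ge0 (k s - k t); nra.
Qed.

Lemma rcont_cabs k t : rcont k t -> {for t, continuous (fun s => cabs (k s))}.
Proof.
case=> H; apply/real_contP => e /H[d d0 h]; exists d => // s /h.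
apply: le_lt_trans; rewrite ler_norml lerBrDl.
have := cabs_lbB (k s) (k t); have := cabs_lbB (k t) (k s).
rewrite cabs_distC => h1 h2; apply/andP; split; lra.
Qed.

(** A rotation u makes k b - k a real and nonnegative; the real mean value theorem applies to g - Re
    (u k), whose derivative is nonnegative. *)
Lemma curve_mvi (k dk : R -> C) (g dg : R -> R) a b : a <= b ->
  (forall t, t \in `]a, b[%R -> is_rd k t (dk t)) ->
  (forall t, t \in `]a, b[%R -> is_derive t 1 g (dg t)) ->
  (forall t, t \in `[a, b]%R -> rcont k t) ->
  (forall t, t \in `[a, b]%R -> {for t, continuous g}) ->
  (forall t, t \in `]a, b[%R -> cabs (dk t) <= dg t) ->
  cabs (k b - k a) <= g b - g a.
Proof.
rewrite le_eqVlt => /predU1P[->|ab]; first by rewrite !subrr cabs0.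
move=> kd gd ck cg kg.
have [u u1 uE] := cabs_dir (k b - k a).
have hd t : t \in `]a, b[%R ->
    is_derive t 1 (fun s => g s - Re (u * k s)) (dg t - Re (u * dk t)).
  move=> tab; apply: is_deriveB; first exact: gd.
  by have [] := (is_rd_parts (fun s => u * k s) t (u * dk t)).1 (is_rdZ u (kd _ tab)).
have hc : {within `[a, b], continuous (fun s => g s - Re (u * k s))}.
  apply: continuous_in_subspaceT => t; rewrite inE /= => tab.
  by apply: continuousB; [exact: cg|apply: rcont_Re; exact: ck].
have [c cab] := MVT ab hd hc.
have : 0 <= (dg c - Re (u * dk c)) * (b - a).
  apply: mulr_ge0; last by rewrite subr_ge0 ltW.
  rewrite subr_ge0; apply: le_trans (kg _ cab).
  have := Re_le_cabs (u * dk c); rewrite cabsM u1 mul1r.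
  by apply: le_trans; exact: ler_norm.
move=> h0 hE; rewrite -hE in h0.
have <- : Re (u * (k b - k a)) = cabs (k b - k a) by rewrite uE.
rewrite mulrBr ReB; lra.
Qed.

Lemma curve_lip (k dk : R -> C) K a b : a <= b ->
  (forall t, t \in `]a, b[%R -> is_rd k t (dk t)) ->
  (forall t, t \in `[a, b]%R -> rcont k t) ->
  (forall t, t \in `]a, b[%R -> cabs (dk t) <= K) ->
  cabs (k b - k a) <= K * (b - a).
Proof.
move=> ab kd ck hK; rewrite mulrBr.
apply: (@curve_mvi k dk (fun t => K * t) (fun=> K)) => //.
  move=> t _; rewrite -[X in is_derive _ _ _ X]mulr1.
  exact: (@is_deriveZ _ R R id K t 1 1).
by move=> t _; apply: continuousM; [exact: cst_continuous|move=> A].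
Qed.

Lemma curve_lip_abs (k dk : R -> C) K a b :
  (forall t, Num.min a b <= t <= Num.max a b -> is_rd k t (dk t)) ->
  (forall t, Num.min a b <= t <= Num.max a b -> cabs (dk t) <= K) ->
  cabs (k b - k a) <= K * `|b - a|.
Proof.
wlog ab : a b / a <= b => [hw kd hK|].
  have [|/ltW ba] := leP a b; first by move=> /hw; exact.
  by rewrite cabs_distC distrC; apply: hw; rewrite // minC maxC.
rewrite min_l// max_r// => kd hK; rewrite ger0_norm ?subr_ge0//.
apply: (@curve_lip k dk) => // t; rewrite in_itv /=.
- by move=> /andP[/ltW t1 /ltW t2]; apply: kd; rewrite t1.
- by move=> /kd; exact: is_rd_cont.
- by move=> /andP[/ltW t1 /ltW t2]; apply: hK; rewrite t1.
Qed.

End RealCurves.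

(** * Integrals along curves as increments of primitives *)

Section Primitive.
Variable R : realType.
Local Notation C := R[i].
Local Notation mu := (@lebesgue_measure R).

Lemma continuous_integrable_itv (f : R -> R) (a b : R) : continuous f ->
  mu.-integrable [set` Interval (BLeft a) (BRight b)] (EFin \o f).
Proof.
move=> cf; apply: continuous_compact_integrable; first exact: segment_compact.
by apply: continuous_subspaceT.
Qed.

Lemma real_primitive (f : R -> R) : continuous f ->
  exists P : R -> R, forall x : R, is_derive x 1 P (f x).
Proof.
move=> cf.
pose P x := (\int[mu]_(t in `]0, x]) f t - \int[mu]_(t in `]x, 0]) f t)%R.
pose F a x := (\int[mu]_(t in [set` Interval (BLeft a) (BRight x)]) f t)%R.
have FB a c x : a <= c -> c <= x ->
    F a x - F a c = (\int[mu]_(t in `]c, x]) f t)%R.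
  move=> ac cx; rewrite /F.
  apply: (@Rintegral_itvB R f (BLeft a) (BRight x) c) => //.
  exact: continuous_integrable_itv.
have F0 c x : x <= c -> (\int[mu]_(t in `]c, x]) f t)%R = 0.
  move=> xc; have -> : `]c, x]%classic = set0 :> set R.
    by apply: set_itv_ge; rewrite bnd_simp -leNgt.
  exact: Rintegral_set0.
have PE a x : a <= 0 -> a <= x -> P x = F a x - F a 0.
  move=> a0 ax; rewrite /P; have [x0|/ltW x0] := leP 0 x.
    by rewrite FB// (F0 x)// subr0.
  by rewrite (F0 0 x x0) sub0r -(FB a x 0 ax x0) opprB.
exists P => x.
(* A base point to the left of 0 and of every y within distance 1 of x, so that all integrals
   involved start at the same point; hence the [Num.min d 1] below. *)
pose a := - (`|x| + 1).
have xa : `|x| < - a by rewrite /a opprK ltrDl.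
have [dF FE] : derivable (F a) x 1 /\ (F a)^`() x = f x.
  apply: (@continuous_FTC1 R f (BLeft a) x (x + 1)) => //.
  - by rewrite ltrDl.
  - exact: continuous_integrable_itv.
  - by move: xa; rewrite ltr_norml opprK => /andP[ax _]; rewrite lte_fin.
  - exact: cf.
have /is_derive_eps H : is_derive x 1 (F a) (f x).
  by apply: DeriveDef; [exact: dF|rewrite -derive1E; exact: FE].
apply/is_derive_eps => e /H[d d0 h].
have ? : 0 <= `|x| by [].
exists (Num.min d 1); first by rewrite lt_min d0 ltr01.
move=> y; rewrite lt_min => /andP[/h yd y1].
move: xa; rewrite ltr_norml opprK => /andP[ax _].
have ya : a <= y.
  move: y1; rewrite ltr_norml => /andP[+ _]; rewrite /a.
  have := ler_norm (- x); rewrite normrN; lra.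
have a0 : a <= 0 by rewrite /a; lra.
rewrite (PE a x a0 (ltW ax)) (PE a y a0 ya).
have -> : F a y - F a 0 - (F a x - F a 0) = F a y - F a x by ring.
exact: yd.
Qed.

Lemma curve_primitive (f : R -> C) : (forall t, rcont f t) ->
  exists P : R -> C, forall t, is_rd P t (f t).
Proof.
move=> cf.
have cRe : continuous (fun t => Re (f t)).
  move=> t; have := @rcont_Re _ 1 _ _ (cf t).
  have -> // : (fun s => Re (1 * f s)) = (fun t => Re (f t)).
  by apply/funext => s; rewrite mul1r.
have cIm : continuous (fun t => Im (f t)).
  move=> t; have := @rcont_Re _ (- i_) _ _ (cf t).
  have -> // : (fun s => Re (- i_ * f s)) = (fun t => Im (f t)).
  apply/funext => s; case: (f s) => u v /=; ring.
have [P HP] := real_primitive cRe; have [Q HQ] := real_primitive cIm.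
exists (fun t => P t +i* Q t) => t.
by apply/is_rd_parts; split; [exact: HP|exact: HQ].
Qed.

(** A chosen primitive, or the zero function if there is none; only its increments are meaningful
    ([cint_unique]). Existence is drawn from continuity on the whole line, which is why functions
    below are required to be continuous everywhere and are extended by clamping when they are
    not. *)
Definition prim (f : R -> C) : R -> C :=
  xget (fun=> 0) [set P | forall t, is_rd P t (f t)].

Definition cint f a b := prim f b - prim f a.

Lemma primP f : (forall t, rcont f t) -> forall t, is_rd (prim f) t (f t).
Proof.
move=> /curve_primitive[P HP]; rewrite /prim.
by case: xgetP => [Q _ //|/(_ P)]; case.
Qed.

Lemma cint_unique f P a b : (forall t, rcont f t) ->
  (forall t, Num.min a b <= t <= Num.max a b -> is_rd P t (f t)) ->
  cint f a b = P b - P a.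
Proof.
move=> cf HP; apply/eqP; rewrite -subr_eq0 -cabs_eq0.
suff : cabs ((prim f b - P b) - (prim f a - P a)) <= 0 * `|b - a|.
  rewrite mul0r /cint => h; rewrite eq_le cabs_ge0 andbT; apply: le_trans h.
  by rewrite le_eqVlt; apply/orP; left; apply/eqP; congr cabs; ring.
apply: (@curve_lip_abs _ (fun t => prim f t - P t) (fun t => f t - f t)).
  by move=> t tab; apply: is_rdB; [exact: primP|exact: HP].
by move=> t _; rewrite subrr cabs0.
Qed.

Lemma cint_dist f g K a b : (forall t, rcont f t) -> (forall t, rcont g t) ->
  (forall t, Num.min a b <= t <= Num.max a b -> cabs (f t - g t) <= K) ->
  cabs (cint f a b - cint g a b) <= K * `|b - a|.
Proof.
move=> cf cg fgK; rewrite /cint.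
have -> : prim f b - prim f a - (prim g b - prim g a) =
  (prim f b - prim g b) - (prim f a - prim g a) by ring.
apply: (@curve_lip_abs _ (fun t => prim f t - prim g t) (fun t => f t - g t)) => //.
by move=> t _; apply: is_rdB; exact: primP.
Qed.

Lemma cint_add f a b c : cint f a b + cint f b c = cint f a c.
Proof. by rewrite /cint; ring. Qed.

Lemma cint_cst c a b : cint (fun=> c) a b = c * (b - a)%:C.
Proof.
rewrite (@cint_unique _ (fun t => c * t%:C)).
- by rewrite rmorphB /= mulrBr.
- by move=> t; exact: is_rd_cont (is_rd_cst c t).
- by move=> t _; have := is_rdZ c (is_rd_id t); rewrite mulr1.
Qed.

End Primitive.

(** * Goursat's theorem *)

Section Goursat.
Variable R : realType.
Local Notation C := R[i].
Implicit Types (F G : C -> C).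

Lemma is_rd_horizontal (y t : R) : is_rd (fun s => s +i* y) t 1.
Proof.
have := is_rdD (is_rd_cst (0 +i* y) t) (is_rd_id t); rewrite add0r.
by apply: is_rd_ext => s; apply/eqP; rewrite eq_complex /= add0r addr0 !eqxx.
Qed.

Lemma is_rd_vertical (x t : R) : is_rd (fun s => x +i* s) t i_.
Proof.
have := is_rdD (is_rd_cst (x%:C) t) (is_rdZ i_ (is_rd_id t)).
rewrite add0r mulr1; apply: is_rd_ext => s.
by apply/eqP; rewrite eq_complex /= !mul0r mulr0 mul1r subr0 addr0 !add0r !eqxx.
Qed.

Lemma rcont_horizontal F (y t : R) : ccont F (t +i* y) ->
  rcont (fun s => F (s +i* y)) t.
Proof. by apply: rcont_comp; exact: is_rd_cont (is_rd_horizontal y t). Qed.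

Lemma rcont_vertical F (x t : R) : ccont F (x +i* t) ->
  rcont (fun s => F (x +i* s)) t.
Proof. by apply: rcont_comp; exact: is_rd_cont (is_rd_vertical x t). Qed.

Definition hint F y a b := cint (fun t => F (t +i* y)) a b.
Definition vint F x c d := cint (fun s => F (x +i* s)) c d.

(** The contour integral over the counterclockwise boundary of [a, b] x [c, d]; the factor [i_] is
    dz on the vertical sides. Being built from signed increments, it is additive without any
    ordering of the bounds. *)
Definition rectI F a b c d :=
  hint F c a b + i_ * vint F b c d - hint F d a b - i_ * vint F a c d.

Lemma rectI_antiderivative F P a b c d : (forall z, ccont F z) ->
  (forall z, is_cd P z (F z)) -> rectI F a b c d = 0.
Proof.
move=> cF PF.
have hE y u v : hint F y u v = P (v +i* y) - P (u +i* y).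
  rewrite /hint (@cint_unique _ _ (fun t => P (t +i* y)))//.
    by move=> t; exact: rcont_horizontal.
  by move=> t _; rewrite -[F _]mulr1; apply: is_rd_comp (is_rd_horizontal y t) _.
have vE x u v : i_ * vint F x u v = P (x +i* v) - P (x +i* u).
  rewrite /vint (@cint_unique _ _ (fun t => - i_ * P (x +i* t))).
  - by rewrite -mulrBr mulrA mulrN -expr2 sqr_i opprK mul1r.
  - by move=> t; exact: rcont_vertical.
  - move=> t _.
    have := is_rdZ (- i_) (is_rd_comp (is_rd_vertical x t) (PF (x +i* t))).
    by rewrite [F _ * _]mulrC mulrA mulNr -expr2 sqr_i opprK mul1r.
by rewrite /rectI !hE !vE; ring.
Qed.

Lemma rectI_dist F G K a b c d : a <= b -> c <= d ->
  (forall z, ccont F z) -> (forall z, ccont G z) ->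
  (forall x y, a <= x <= b -> c <= y <= d ->
    cabs (F (x +i* y) - G (x +i* y)) <= K) ->
  cabs (rectI F a b c d - rectI G a b c d) <= K * (2 * ((b - a) + (d - c))).
Proof.
move=> ab cd cF cG FG.
have hd y : c <= y <= d -> cabs (hint F y a b - hint G y a b) <= K * (b - a).
  move=> ycd; have := @cint_dist R (fun t => F (t +i* y)) (fun t => G (t +i* y)) K a b.
  rewrite ger0_norm ?subr_ge0// min_l// max_r//; apply.
  - by move=> t; exact: rcont_horizontal.
  - by move=> t; exact: rcont_horizontal.
  - by move=> t tab; exact: FG.
have vd x : a <= x <= b -> cabs (vint F x c d - vint G x c d) <= K * (d - c).
  move=> xab; have := @cint_dist R (fun t => F (x +i* t)) (fun t => G (x +i* t)) K c d.
  rewrite ger0_norm ?subr_ge0// min_l// max_r//; apply.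
  - by move=> t; exact: rcont_vertical.
  - by move=> t; exact: rcont_vertical.
  - by move=> t tab; exact: FG.
have := hd c; have := hd d; have := vd a; have := vd b; rewrite !lexx ab cd.
move=> /(_ isT) h1 /(_ isT) h2 /(_ isT) h3 /(_ isT) h4.
have -> : rectI F a b c d - rectI G a b c d =
  (hint F c a b - hint G c a b) + i_ * (vint F b c d - vint G b c d)
  - ((hint F d a b - hint G d a b) + i_ * (vint F a c d - vint G a c d)).
  by rewrite /rectI; ring.
apply: le_trans (cabsB _ _) _.
have := cabsD (hint F c a b - hint G c a b) (i_ * (vint F b c d - vint G b c d)).
have := cabsD (hint F d a b - hint G d a b) (i_ * (vint F a c d - vint G a c d)).
rewrite !cabsM cabs_i !mul1r; lra.
Qed.

Lemma rectI_splitx F a m b c d :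
  rectI F a b c d = rectI F a m c d + rectI F m b c d.
Proof. by rewrite /rectI /hint /vint -!(cint_add _ a m b); ring. Qed.

Lemma rectI_splity F a b c m d :
  rectI F a b c d = rectI F a b c m + rectI F a b m d.
Proof. by rewrite /rectI /hint /vint -!(cint_add _ c m d); ring. Qed.

Lemma rectI_affine (p q z0 : C) a b c d :
  rectI (fun w => p + q * (w - z0)) a b c d = 0.
Proof.
apply: (@rectI_antiderivative _ (fun w => p * w + q / 2 * ((w - z0) * (w - z0)))) => z.
  apply: ccontD; first exact: ccont_cst.
  apply: ccontM; first exact: ccont_cst.
  by apply: ccontB; [exact: ccont_id|exact: ccont_cst].
have d1 := is_cdB (is_cd_id z) (is_cd_cst z0 z).
have := is_cdD (is_cdM (is_cd_cst p z) (is_cd_id z))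
  (is_cdM (is_cd_cst (q / 2) z) (is_cdM d1 d1)).
set v := (X in is_cd _ _ X -> _).
by have -> : v = p + q * (z - z0) by rewrite /v /=; field.
Qed.

(* Goursat: bisection produces nested rectangles on which the integral is at
   least k / 4^n; differentiability at their common point contradicts this. *)
Lemma goursat_closed F a b c d : a < b -> c < d -> (forall z, ccont F z) ->
  (forall x y, a <= x <= b -> c <= y <= d -> cdiff F (x +i* y)) ->
  rectI F a b c d = 0.
Proof.
move=> ab cd cF dF; apply/eqP; rewrite -cabs_eq0; apply: contraT => I0.
set k := cabs _ in I0; have k0 : 0 < k by rewrite lt_neqAle eq_sym I0 cabs_ge0.
pose L1 n := (b - a) / 2 ^+ n; pose L2 n := (d - c) / 2 ^+ n.
have L1S n : L1 n = L1 n.+1 + L1 n.+1 by rewrite /L1 exprS; field; rewrite expf_neq0.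
have L2S n : L2 n = L2 n.+1 + L2 n.+1 by rewrite /L2 exprS; field; rewrite expf_neq0.
have L10 n : 0 < L1 n by rewrite divr_gt0 ?subr_gt0// exprn_gt0.
have L20 n : 0 < L2 n by rewrite divr_gt0 ?subr_gt0// exprn_gt0.
pose J n x y := cabs (rectI F x (x + L1 n) y (y + L2 n)).
pose bad (p : nat * (R * R)) := k / 4 ^+ p.1 <= J p.1 p.2.1 p.2.2.
pose next (p q : nat * (R * R)) := [/\ q.1 = p.1.+1,
  p.2.1 <= q.2.1 <= p.2.1 + L1 p.1.+1, p.2.2 <= q.2.2 <= p.2.2 + L2 p.1.+1 & bad q].
(* If all four quarters fell below a quarter of the bound, so would their sum. The lower bound is
   packed with the rectangle in a subset type so that dependent choice can carry it along. *)
have step (p : {p | bad p}) : {q : {p | bad p} | next (sval p) (sval q)}.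
  apply: cid; case: p => -[n [x y]] /= bp.
  suff [x' [y' [hx hy b']]] : exists x' y', [/\ x <= x' <= x + L1 n.+1,
      y <= y' <= y + L2 n.+1 & k / 4 ^+ n.+1 <= J n.+1 x' y'].
    by exists (exist _ (n.+1, (x', y')) b').
  apply: contrapT => H.
  have lt4 x' y' : x <= x' <= x + L1 n.+1 -> y <= y' <= y + L2 n.+1 ->
      J n.+1 x' y' < k / 4 ^+ n.+1.
    by move=> hx hy; rewrite ltNge; apply/negP => h; apply: H; exists x', y'.
  have l1 := L10 n.+1; have l2 := L20 n.+1.
  have Jsum : J n x y <= J n.+1 x y + J n.+1 x (y + L2 n.+1) +
      (J n.+1 (x + L1 n.+1) y + J n.+1 (x + L1 n.+1) (y + L2 n.+1)).
    have -> : J n x y = cabs (rectI F x (x + L1 n.+1 + L1 n.+1)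
        y (y + L2 n.+1 + L2 n.+1)).
      by rewrite /J (L1S n) (L2S n) !addrA.
    rewrite /J (rectI_splitx F x (x + L1 n.+1)).
    rewrite (rectI_splity F x _ y (y + L2 n.+1)).
    rewrite (rectI_splity F (x + L1 n.+1) _ y (y + L2 n.+1)).
    by apply: le_trans (cabsD _ _) _; apply: lerD; exact: cabsD.
  have k4 : k / 4 ^+ n = 4 * (k / 4 ^+ n.+1).
    by rewrite exprS; field; rewrite expf_neq0.
  move: bp; rewrite /bad /= k4 => bp.
  have := lt4 x y; have := lt4 x (y + L2 n.+1).
  have := lt4 (x + L1 n.+1) y; have := lt4 (x + L1 n.+1) (y + L2 n.+1).
  rewrite !lexx !lerDl !(ltW l1) !(ltW l2).
  move=> /(_ isT isT) h1 /(_ isT isT) h2 /(_ isT isT) h3 /(_ isT isT) h4.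
  lra.
have b0 : bad (0%N, (a, c)).
  by rewrite /bad /J /L1 /L2 /= !expr0 !divr1 !(addrC _ (_ - _)) !subrK.
have [g [g0 gS]] := dependent_choice step
  (exist (fun p => is_true (bad p)) (0%N, (a, c)) b0).
pose u n := (sval (g n)).2.1; pose v n := (sval (g n)).2.2.
have gn n : (sval (g n)).1 = n.
  elim: n => [|n ih]; first by rewrite g0.
  by have [-> _ _ _] := gS n; rewrite ih.
have uS n : u n <= u n.+1 <= u n + L1 n.+1.
  by have [_ h _ _] := gS n; rewrite gn in h.
have vS n : v n <= v n.+1 <= v n + L2 n.+1.
  by have [_ _ h _] := gS n; rewrite gn in h.
have uB n m : u n <= u (n + m)%N /\ u (n + m)%N + L1 (n + m)%N <= u n + L1 n.
  elim: m => [|m [h1 h2]]; first by rewrite addn0.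
  rewrite addnS; have /andP[h3 h4] := uS (n + m)%N.
  have := L1S (n + m)%N; split; lra.
have vB n m : v n <= v (n + m)%N /\ v (n + m)%N + L2 (n + m)%N <= v n + L2 n.
  elim: m => [|m [h1 h2]]; first by rewrite addn0.
  rewrite addnS; have /andP[h3 h4] := vS (n + m)%N.
  have := L2S (n + m)%N; split; lra.
have uU n m : u m <= u n + L1 n.
  have [nm|/ltnW mn] := leqP n m.
    have := uB n (m - n)%N; rewrite subnKC// => -[_].
    by have := L10 m; lra.
  have := uB m (n - m)%N; rewrite subnKC// => -[+ _].
  by have := L10 n; lra.
have vU n m : v m <= v n + L2 n.
  have [nm|/ltnW mn] := leqP n m.
    have := vB n (m - n)%N; rewrite subnKC// => -[_].
    by have := L20 m; lra.
  have := vB m (n - m)%N; rewrite subnKC// => -[+ _].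
  by have := L20 n; lra.
(* Every left end is at most every right end, so the supremum of the left ends lies in all the
   segments. *)
have limP (s : nat -> R) (L : nat -> R) : (forall n m, s m <= s n + L n) ->
    exists t, forall n, s n <= t <= s n + L n.
  move=> h; exists (sup (range s)) => n; apply/andP; split.
    apply: sup_upper_bound; last by exists n.
    split; first by exists (s 0%N), 0%N.
    by exists (s 0%N + L 0%N) => _ [m _ <-].
  apply: ge_sup; first by exists (s 0%N), 0%N.
  by move=> _ [m _ <-].
have [x hx] := limP u L1 uU; have [y hy] := limP v L2 vU.
have u0 : u 0%N = a by rewrite /u g0.
have v0 : v 0%N = c by rewrite /v g0.
have /cdiffP[l] : cdiff F (x +i* y).
  apply: dF.
    by have := hx 0%N; rewrite u0 /L1 expr0 divr1 addrC subrK.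
  by have := hy 0%N; rewrite v0 /L2 expr0 divr1 addrC subrK.
move=> /is_cd_eps dFl.
pose S := (b - a) + (d - c).
have S0 : 0 < S by rewrite /S; lra.
(* The affine part of F integrates to 0, and the remainder is at most e (S / 2^n) times the
   perimeter 2 S / 2^n. This e turns the product into half of k / 4^n. *)
have e0 : 0 < k / (4 * S ^+ 2) by rewrite divr_gt0// mulr_gt0// exprn_gt0.
have [dl dl0 hdl] := dFl _ e0.
have [n Hn] : exists n, S / 2 ^+ n < dl.
  exists (Num.bound (S / dl)).
  rewrite ltr_pdivrMr ?exprn_gt0// mulrC -ltr_pdivrMr//.
  apply: lt_trans (archi_boundP _) _; first by rewrite ltW// divr_gt0.
  by rewrite -natrX ltr_nat ltn_expl.
have Sn : L1 n + L2 n = S / 2 ^+ n by rewrite /L1 /L2 -mulrDl.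
have near s t : u n <= s <= u n + L1 n -> v n <= t <= v n + L2 n ->
    cabs ((s +i* t) - (x +i* y)) <= S / 2 ^+ n.
  move=> hs ht; apply: le_trans (cabs_le_ReIm _) _; rewrite ReB ImB /= -Sn.
  move: (hx n) (hy n) hs ht; move: (u n) (L1 n) (v n) (L2 n); clear.
  move=> u1 l1 v1 l2 /andP[? ?] /andP[? ?] /andP[? ?] /andP[? ?].
  by apply: lerD; rewrite ler_norml; apply/andP; split; lra.
have : bad (sval (g n)) by case: (g n).
rewrite /bad gn /J -/(u n) -/(v n) => bn.
have := @rectI_dist F (fun w => F (x +i* y) + l * (w - (x +i* y)))
  (k / (4 * S ^+ 2) * (S / 2 ^+ n)) (u n) (u n + L1 n) (v n) (v n + L2 n).
rewrite !lerDl !(ltW (L10 _)) !(ltW (L20 _)) => /(_ isT isT cF).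
rewrite rectI_affine subr0 => /(_ _ _) H.
have : cabs (rectI F (u n) (u n + L1 n) (v n) (v n + L2 n)) <=
  k / (4 * S ^+ 2) * (S / 2 ^+ n) * (2 * (L1 n + L2 n)).
  have -> : L1 n + L2 n = (u n + L1 n - u n) + (v n + L2 n - v n) by ring.
  apply: H.
    move=> z; apply: ccontD; first exact: ccont_cst.
    apply: ccontM; first exact: ccont_cst.
    by apply: ccontB; [exact: ccont_id|exact: ccont_cst].
  move=> s t hs ht; have st := near s t hs ht.
  rewrite opprD addrA; apply: le_trans (hdl _ (le_lt_trans st Hn)) _.
  by rewrite ler_wpM2l// ltW.
move=> /(le_trans bn); rewrite Sn.
have -> : k / (4 * S ^+ 2) * (S / 2 ^+ n) * (2 * (S / 2 ^+ n)) = k / 4 ^+ n / 2.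
  have -> : 4 = 2 * 2 :> R by ring.
  by rewrite exprMn; field; rewrite expf_neq0//= gt_eqF.
have : 0 < k / 4 ^+ n by rewrite divr_gt0// exprn_gt0.
lra.
Qed.

Lemma cint_swap (f : R -> C) a b : cint f b a = - cint f a b.
Proof. by rewrite /cint opprB. Qed.

Lemma rectI_swapx F a b c d : rectI F b a c d = - rectI F a b c d.
Proof. by rewrite /rectI /hint !(cint_swap _ a b); ring. Qed.

Lemma rectI_swapy F a b c d : rectI F a b d c = - rectI F a b c d.
Proof. by rewrite /rectI /vint !(cint_swap _ c d); ring. Qed.

Lemma rectI_degx F a c d : rectI F a a c d = 0.
Proof. by rewrite /rectI /hint /cint; ring. Qed.

Lemma rectI_degy F a b c : rectI F a b c c = 0.
Proof. by rewrite /rectI /vint /cint; ring. Qed.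

Lemma goursat F a b c d : a <= b -> c <= d -> (forall z, ccont F z) ->
  (forall x y, a <= x <= b -> c <= y <= d -> cdiff F (x +i* y)) ->
  rectI F a b c d = 0.
Proof.
rewrite le_eqVlt => /predU1P[->|ab]; first by rewrite rectI_degx.
rewrite le_eqVlt => /predU1P[->|cd]; first by rewrite rectI_degy.
exact: goursat_closed.
Qed.

(** A difference quotient is only known to be continuous at its own centre, so one such point has to
    be allowed. The integral equals that over an arbitrarily small rectangle around the point, where
    F is bounded. *)
Lemma goursat_point F x0 y0 a b c d : a <= b -> c <= d ->
  (forall z, ccont F z) ->
  (forall x y, a <= x <= b -> c <= y <= d -> x +i* y != x0 +i* y0 ->
    cdiff F (x +i* y)) ->
  rectI F a b c d = 0.
Proof.
move=> ab cd cF dF.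
have off u v s t : a <= u -> u <= v -> v <= b -> c <= s -> s <= t -> t <= d ->
    (x0 < u) || (v < x0) || (y0 < s) || (t < y0) -> rectI F u v s t = 0.
  move=> au uv vb cs st td h; apply: goursat => // x y /andP[ux xv] /andP[sy yt].
  apply: dF; [by apply/andP; split; lra|by apply/andP; split; lra|].
  apply/negP => /eqP[xx yy]; move: h; rewrite -xx -yy !ltNge ux xv sy yt //.
have [x0a|ax0] := ltP x0 a; first by apply: off => //; rewrite x0a.
have [bx0|x0b] := ltP b x0; first by apply: off => //; rewrite bx0 orbT.
have [y0c|cy0] := ltP y0 c; first by apply: off => //; rewrite y0c !orbT.
have [dy0|y0d] := ltP d y0; first by apply: off => //; rewrite dy0 !orbT.
apply/eqP; rewrite -cabs_eq0; apply: contraT => I0.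
set k := cabs _ in I0; have k0 : 0 < k by rewrite lt_neqAle eq_sym I0 cabs_ge0.
have [dl dl0 hdl] := (ccontP _ _).1 (cF (x0 +i* y0)) 1 ltr01.
pose K := cabs (F (x0 +i* y0)) + 1.
have K0 : 0 < K by rewrite ltr_wpDl// cabs_ge0.
(* The bound dl / 3 keeps the small rectangle in the disc where |F| <= K; the bound k / (16 K) makes
   K times its perimeter, at most 8 e, no larger than k / 2. *)
pose e := Num.min (dl / 3) (k / (16 * K)).
have e0 : 0 < e by rewrite lt_min !divr_gt0// mulr_gt0.
have e1 : e <= dl / 3 by rewrite ge_min lexx.
have e2 : e <= k / (16 * K) by rewrite ge_min lexx orbT.
(* Clipping covers a point close to the boundary: a strip that is clipped away is degenerate and
   contributes 0. *)
pose a' := Num.max a (x0 - e); pose b' := Num.min b (x0 + e).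
pose c' := Num.max c (y0 - e); pose d' := Num.min d (y0 + e).
have aa' : a <= a' by rewrite le_max lexx.
have bb' : b' <= b by rewrite ge_min lexx.
have cc' : c <= c' by rewrite le_max lexx.
have dd' : d' <= d by rewrite ge_min lexx.
have a'x : a' <= x0 by rewrite ge_max ax0 /=; lra.
have xb' : x0 <= b' by rewrite le_min x0b /=; lra.
have c'y : c' <= y0 by rewrite ge_max cy0 /=; lra.
have yd' : y0 <= d' by rewrite le_min y0d /=; lra.
have xa' : x0 - e <= a' by rewrite le_max lexx orbT.
have b'x : b' <= x0 + e by rewrite ge_min lexx orbT.
have yc' : y0 - e <= c' by rewrite le_max lexx orbT.
have d'y : d' <= y0 + e by rewrite ge_min lexx orbT.
have Ea : rectI F a a' c d = 0.
  have [h|h] := leP (x0 - e) a; first by rewrite /a' max_l// rectI_degx.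
  apply: off => //; first lra.
  by rewrite /a' max_r ?(ltW h)// ltrBlDr ltrDl e0 !orbT.
have Eb : rectI F b' b c d = 0.
  have [h|h] := leP b (x0 + e); first by rewrite /b' min_l// rectI_degx.
  apply: off => //; first lra.
  by rewrite /b' min_r ?(ltW h)// ltrDl e0.
have Ec : rectI F a' b' c c' = 0.
  have [h|h] := leP (y0 - e) c; first by rewrite /c' max_l// rectI_degy.
  apply: off => //; [exact: le_trans a'x xb'|exact: le_trans c'y y0d|].
  by rewrite /c' max_r ?(ltW h)// ltrBlDr ltrDl e0 !orbT.
have Ed : rectI F a' b' d' d = 0.
  have [h|h] := leP d (y0 + e); first by rewrite /d' min_l// rectI_degy.
  apply: off => //; [exact: le_trans a'x xb'|exact: le_trans cy0 yd'|].
  by rewrite /d' min_r ?(ltW h)// ltrDl e0 !orbT.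
have kE : k = cabs (rectI F a' b' c' d' - rectI (fun=> 0) a' b' c' d').
  rewrite /k (rectI_splitx F a a') Ea add0r (rectI_splitx F a' b') Eb addr0.
  rewrite (rectI_splity F a' b' c c') Ec add0r (rectI_splity F a' b' c' d') Ed addr0.
  have -> : (fun=> 0) = (fun w : C => 0 + 0 * (w - 0)).
    by apply/funext => w; rewrite mul0r addr0.
  by rewrite rectI_affine subr0.
have : k <= K * (2 * ((b' - a') + (d' - c'))).
  rewrite kE.
  apply: (rectI_dist (le_trans a'x xb') (le_trans c'y yd') cF) => //.
    by move=> z; exact: ccont_cst.
  move=> x y /andP[h1 h2] /andP[h3 h4]; rewrite subr0.
  have : cabs (x +i* y - x0 +i* y0) < dl.
    apply: le_lt_trans (cabs_le_ReIm _) _; rewrite ReB ImB /=.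
    have : `|x - x0| <= e by rewrite ler_distl (le_trans xa' h1) (le_trans h2 b'x).
    have : `|y - y0| <= e by rewrite ler_distl (le_trans yc' h3) (le_trans h4 d'y).
    move: e1; clear -dl0; lra.
  move=> /hdl; have := cabs_lbB (F (x +i* y)) (F (x0 +i* y0)).
  by rewrite /K; clear; lra.
have : K * (2 * ((b' - a') + (d' - c'))) <= K * (8 * e).
  by rewrite ler_pM2l//; move: xa' b'x yc' d'y; clear; lra.
have : K * (8 * e) <= k / 2.
  have -> : k / 2 = K * (8 * (k / (16 * K))) by field; rewrite gt_eqF.
  by rewrite ler_pM2l// ler_pM2l.
lra.
Qed.

Definition primitive_from F (x0 y0 : R) : C -> C := fun z =>
  hint F y0 x0 (Re z) + i_ * vint F (Re z) y0 (Im z).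

(** The vanishing contour integral trades the two long vertical legs for a short horizontal one. The
    increment of the primitive is then an integral along an L-shaped path from x + i y to x' + i y',
    on which F is nearly constant. *)
Lemma is_cd_primitive_from F x0 y0 x y r : 0 < r -> (forall z, ccont F z) ->
  (forall x', `|x' - x| < r -> rectI F x x' y0 y = 0) ->
  is_cd (primitive_from F x0 y0) (x +i* y) (F (x +i* y)).
Proof.
move=> r0 cF HI; apply/is_cd_eps => e e0.
have e20 : 0 < e / 2 by lra.
have [d d0 hd] := (ccontP _ _).1 (cF (x +i* y)) _ e20.
exists (Num.min r (d / 2)); first by rewrite lt_min r0 divr_gt0.
move=> [x' y']; rewrite lt_min => /andP[zr zd].
have hx : `|x' - x| <= cabs (x' +i* y' - x +i* y).
  by have := Re_le_cabs (x' +i* y' - x +i* y).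
have hy : `|y' - y| <= cabs (x' +i* y' - x +i* y).
  by have := Im_le_cabs (x' +i* y' - x +i* y).
have -> : primitive_from F x0 y0 (x' +i* y') - primitive_from F x0 y0 (x +i* y)
    - F (x +i* y) * (x' +i* y' - x +i* y) =
    (hint F y x x' - cint (fun=> F (x +i* y)) x x') +
    i_ * (vint F x' y y' - cint (fun=> F (x +i* y)) y y').
  rewrite !cint_cst.
  have -> : x' +i* y' - x +i* y = (x' - x)%:C + i_ * (y' - y)%:C.
    by rewrite [LHS]complexE ReB ImB.
  have := HI _ (le_lt_trans hx zr); rewrite /rectI /primitive_from /= => H.
  have <- : hint F y0 x0 x + hint F y0 x x' = hint F y0 x0 x' := cint_add _ _ _ _.
  have <- : vint F x' y0 y + vint F x' y y' = vint F x' y0 y' := cint_add _ _ _ _.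
  rewrite -[RHS]addr0 -H; ring.
apply: le_trans (cabsD _ _) _; rewrite cabsM cabs_i mul1r.
have btw (u v t : R) : Num.min u v <= t <= Num.max u v -> `|t - u| <= `|v - u|.
  have [uv|vu] := leP u v => /andP[h1 h2].
    by rewrite !ger0_norm ?subr_ge0// lerB.
  by rewrite !ler0_norm ?subr_le0// ?(ltW vu)// lerN2 lerB.
have h1 : cabs (hint F y x x' - cint (fun=> F (x +i* y)) x x') <= e / 2 * `|x' - x|.
  apply: (@cint_dist R (fun t => F (t +i* y))).
  - by move=> t; exact: rcont_horizontal.
  - by move=> t; exact: is_rd_cont (is_rd_cst _ _).
  - move=> t /btw tx; apply/ltW/hd; apply: le_lt_trans (cabs_le_ReIm _) _.
    by rewrite ReB ImB /= subrr normr0 addr0; lra.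
have h2 : cabs (vint F x' y y' - cint (fun=> F (x +i* y)) y y') <= e / 2 * `|y' - y|.
  apply: (@cint_dist R (fun t => F (x' +i* t))).
  - by move=> t; exact: rcont_vertical.
  - by move=> t; exact: is_rd_cont (is_rd_cst _ _).
  - move=> t /btw tx; apply/ltW/hd; apply: le_lt_trans (cabs_le_ReIm _) _.
    by rewrite ReB ImB /=; lra.
nra.
Qed.

(* The third hypothesis: D is star-shaped with respect to boxes with a corner at
   x0 + i y0. *)
Lemma is_cd_primitive F (D : C -> Prop) x0 y0 : (forall z, ccont F z) ->
  (forall z, D z -> z != x0 +i* y0 -> cdiff F z) ->
  (forall x y s t, D (x +i* y) -> Num.min x0 x <= s <= Num.max x0 x ->
     Num.min y0 y <= t <= Num.max y0 y -> D (s +i* t)) ->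
  (forall x y, D (x +i* y) -> exists2 r, 0 < r &
     forall x', `|x' - x| < r -> D (x' +i* y)) ->
  forall z, D z -> is_cd (primitive_from F x0 y0) z (F z).
Proof.
move=> cF dF boxD openD [x y] Dz.
have [r r0 hr] := openD _ _ Dz.
apply: (@is_cd_primitive_from F x0 y0 x y r r0 cF) => x' x'r.
have key s t : `|s - x| < r -> Num.min y0 y <= t <= Num.max y0 y -> D (s +i* t).
  by move=> /hr Ds; apply: (boxD _ _ _ _ Ds); rewrite ge_min le_max lexx orbT /= orbT.
have wlx u v : Num.min x x' = u -> Num.max x x' = v -> forall s, u <= s <= v ->
    `|s - x| < r.
  move=> <- <- s; have [xx|xx] := leP x x' => /andP[h1 h2];
    by move: x'r; rewrite !ltr_norml => /andP[h3 h4]; apply/andP; split; lra.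
have gen u v p q : u <= v -> p <= q -> Num.min x x' = u -> Num.max x x' = v ->
    Num.min y0 y = p -> Num.max y0 y = q -> rectI F u v p q = 0.
  move=> uv pq hu hv hp hq; apply: (@goursat_point _ x0 y0) => // s t hs ht st.
  by apply: dF => //; apply: key; [exact: (wlx _ _ hu hv)|rewrite hp hq].
have [xx|xx] := leP x x'; have [yy|yy] := leP y0 y.
- by apply: gen; rewrite ?min_l ?max_r.
- rewrite rectI_swapy gen ?oppr0 ?(ltW yy)//;
    by rewrite ?(min_l xx) ?(max_r xx) ?(min_r (ltW yy)) ?(max_l (ltW yy)).
- rewrite rectI_swapx gen ?oppr0 ?(ltW xx)//;
    by rewrite ?(min_r (ltW xx)) ?(max_l (ltW xx)) ?(min_l yy) ?(max_r yy).
- rewrite rectI_swapx rectI_swapy gen ?opprK ?(ltW xx) ?(ltW yy)//;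
    by rewrite ?(min_r (ltW xx)) ?(max_l (ltW xx)) ?(min_r (ltW yy)) ?(max_l (ltW yy)).
Qed.

End Goursat.

(** * The maximum modulus principle *)

Section MaxModulus.
Variable R : realType.
Local Notation C := R[i].
Implicit Types (F G H : C -> C).

Lemma maxr_lip (l s t : R) : `|Num.max l s - Num.max l t| <= `|s - t|.
Proof.
rewrite ler_norml; apply/andP.
have := ler_norm (s - t); have := ler_norm (t - s); rewrite distrC => h1 h2.
have [ls|sl] := leP l s; have [lt|tl] := leP l t; split; lra.
Qed.

Lemma minr_lip (l s t : R) : `|Num.min l s - Num.min l t| <= `|s - t|.
Proof.
rewrite ler_norml; apply/andP.
have := ler_norm (s - t); have := ler_norm (t - s); rewrite distrC => h1 h2.
have [ls|sl] := leP l s; have [lt|tl] := leP l t; split; lra.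
Qed.

Lemma ccont_ReIm (f g : R -> R) z :
  (forall s t, `|f s - f t| <= `|s - t|) ->
  (forall s t, `|g s - g t| <= `|s - t|) ->
  ccont (fun w => f (Re w) +i* g (Im w)) z.
Proof.
move=> hf hg; apply/ccontP => e e0; exists (e / 2); first lra.
move=> w wz; apply: le_lt_trans (cabs_le_ReIm _) _; rewrite ReB ImB /=.
have := hf (Re w) (Re z); have := hg (Im w) (Im z).
have := Re_le_cabs (w - z); have := Im_le_cabs (w - z); rewrite ReB ImB; lra.
Qed.

Definition clampR (lo hi t : R) := Num.max lo (Num.min hi t).

Lemma clampR_lip lo hi s t : `|clampR lo hi s - clampR lo hi t| <= `|s - t|.
Proof. exact: le_trans (maxr_lip _ _ _) (minr_lip _ _ _). Qed.

Lemma clampR_in lo hi t : lo <= hi -> lo <= clampR lo hi t <= hi.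
Proof. by move=> h; rewrite /clampR le_max lexx /= ge_max h ge_min lexx. Qed.

Lemma clampR_id lo hi t : lo <= t <= hi -> clampR lo hi t = t.
Proof. by move=> /andP[h1 h2]; rewrite /clampR min_r// max_r. Qed.

Definition in_rect (a b c d : R) (z : C) := (a <= Re z <= b) && (c <= Im z <= d).
Definition in_orect (a b c d : R) (z : C) := (a < Re z < b) && (c < Im z < d).

Lemma in_rect_near a b c d z w s : s <= Re z - a -> s <= b - Re z ->
  s <= Im z - c -> s <= d - Im z ->
  `|Re (w - z)| <= s -> `|Im (w - z)| <= s -> in_rect a b c d w.
Proof.
rewrite ReB ImB !ler_norml => ? ? ? ? /andP[? ?] /andP[? ?].
by apply/andP; split; apply/andP; split; lra.
Qed.

Lemma in_orect_near a b c d z w s : s < Re z - a -> s < b - Re z ->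
  s < Im z - c -> s < d - Im z ->
  `|Re (w - z)| <= s -> `|Im (w - z)| <= s -> in_orect a b c d w.
Proof.
rewrite ReB ImB !ler_norml => ? ? ? ? /andP[? ?] /andP[? ?].
by apply/andP; split; apply/andP; split; lra.
Qed.

Lemma in_orectW a b c d z : in_orect a b c d z -> in_rect a b c d z.
Proof.
by move=> /andP[/andP[h1 h2] /andP[h3 h4]]; rewrite /in_rect !ltW.
Qed.

Lemma in_orect_open a b c d z : in_orect a b c d z ->
  exists2 r, 0 < r & forall w, cabs (w - z) < r -> in_orect a b c d w.
Proof.
move=> /andP[/andP[h1 h2] /andP[h3 h4]].
exists (Num.min (Num.min (Re z - a) (b - Re z)) (Num.min (Im z - c) (d - Im z))).
  by rewrite !lt_min !subr_gt0 h1 h2 h3.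
move=> w; rewrite !lt_min => /andP[/andP[w1 w2] /andP[w3 w4]].
have := Re_le_cabs (w - z); have := Im_le_cabs (w - z).
rewrite ReB ImB !ler_norml => /andP[? ?] /andP[? ?].
by apply/andP; split; apply/andP; split; lra.
Qed.

Lemma between_oo (lo hi x y s : R) : lo < x < hi -> lo < y < hi ->
  Num.min x y <= s <= Num.max x y -> lo < s < hi.
Proof.
move=> /andP[h1 h2] /andP[h3 h4] /andP[h5 h6].
rewrite (lt_le_trans _ h5) ?(le_lt_trans h6) ?lt_min ?gt_max//.
  by rewrite h2 h4.
by rewrite h1 h3.
Qed.

(** The exceptional point z0 is also the base point of the primitive, so the rectangles that occur
    all fall under [goursat_point]. *)
Lemma local_primitive F a b c d z0 : in_orect a b c d z0 ->
  (forall z, in_rect a b c d z -> ccont F z) ->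
  (forall z, in_orect a b c d z -> z != z0 -> cdiff F z) ->
  exists P, forall z, in_orect a b c d z -> is_cd P z (F z).
Proof.
case: z0 => x0 y0 z0in cF dF.
have [/andP[h1 h2] /andP[h3 h4]] := andP z0in.
have ab : a <= b by lra.
have cd : c <= d by lra.
(* Retracting the plane onto the closed rectangle extends F to a function continuous everywhere,
   unchanged on the rectangle. *)
pose cl (w : C) : C := clampR a b (Re w) +i* clampR c d (Im w).
have cl_in w : in_rect a b c d (cl w) by rewrite /in_rect !clampR_in.
have cl_id w : in_rect a b c d w -> cl w = w.
  case: w => s t /andP[/= hs ht]; rewrite /cl /= !clampR_id//.
have ccl w : ccont cl w by apply: ccont_ReIm; exact: clampR_lip.
pose G w := F (cl w).
have cG w : ccont G w by apply: ccont_comp (ccl w) _; exact: cF.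
have GF z : in_orect a b c d z -> exists2 r, 0 < r &
    forall w, cabs (w - z) < r -> F w = G w.
  move=> /in_orect_open[r r0 h]; exists r => // w /h /in_orectW /cl_id.
  by rewrite /G => ->.
have dG z : in_orect a b c d z -> z != x0 +i* y0 -> cdiff G z.
  move=> zin zz; have [r r0 h] := GF z zin.
  by apply: (cdiff_near r0 h); exact: dF.
exists (primitive_from G x0 y0) => z zin.
have -> : F z = G z by have [r r0 ->//] := GF z zin; rewrite subrr cabs0.
apply: (@is_cd_primitive _ G (fun z => in_orect a b c d z)) => //.
  move=> x y s t /andP[/= hx hy] hs ht.
  by apply/andP; split => /=; [apply: between_oo hx hs|apply: between_oo hy ht];
     rewrite ?h1 ?h3.
move=> x y /in_orect_open[r r0 h]; exists r => // x' xx; apply: h.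
apply: le_lt_trans (cabs_le_ReIm _) _.
by rewrite ReB ImB /= subrr normr0 addr0.
Qed.

Definition cis (t : R) : C := cos t +i* sin t.

Lemma is_rd_cis t : is_rd cis t (i_ * cis t).
Proof.
apply/is_rd_parts; split => /=.
  by rewrite mul0r sub0r mul1r; exact: is_derive_cos.
by rewrite mul0r mul1r add0r; exact: is_derive_sin.
Qed.

Lemma cabs_cis t : cabs (cis t) = 1.
Proof. by rewrite /cabs /= cos2Dsin2 sqrtr1. Qed.

Lemma cis0 : cis 0 = 1.
Proof. by rewrite /cis cos0 sin0. Qed.

Lemma cispi : cis pi = -1.
Proof. by rewrite /cis cospi sinpi; apply/eqP; rewrite eq_complex /= oppr0 !eqxx. Qed.

Lemma cis2pi : cis (pi *+ 2) = 1.
Proof. by rewrite /cis cos2pi sin2pi. Qed.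

(* Integrating (H - H(z0)) / (z - z0) around a circle gives the mean value
   property; at a maximum of |H| the integrand has a sign, so it vanishes. *)
Lemma max_circle H z0 (r : R) :
  (forall z, `|Re (z - z0)| <= r -> `|Im (z - z0)| <= r -> cdiff H z) ->
  (forall z, `|Re (z - z0)| <= r -> `|Im (z - z0)| <= r ->
     cabs (H z) <= cabs (H z0)) ->
  forall u, cabs u < r -> H (z0 + u) = H z0.
Proof.
move=> dH mH.
suff key u : cabs u < r -> H (z0 - u) = H z0.
  by move=> u ur; rewrite -[u]opprK key// cabsN.
move=> ur; have r0 : 0 < r by apply: le_lt_trans ur; exact: cabs_ge0.
pose a := Re z0 - r; pose b := Re z0 + r; pose c := Im z0 - r; pose d := Im z0 + r.
have rectE z : in_rect a b c d z = (`|Re (z - z0)| <= r) && (`|Im (z - z0)| <= r).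
  by rewrite /in_rect ReB ImB !ler_distl.
have z0in : in_orect a b c d z0.
  by rewrite /in_orect /a /b /c /d; apply/andP; split; apply/andP; split; lra.
have /cdiffP[l Hl] : cdiff H z0 by apply: dH; rewrite subrr normr0 ltW.
have [P HP] : exists P, forall z, in_orect a b c d z -> is_cd P z (dq H z0 l z).
  apply: (@local_primitive _ a b c d z0) => // z.
    rewrite rectE => /andP[h1 h2]; have [->|zz0] := eqVneq z z0; first exact: Hl.
    have dd : cdiff (dq H z0 l) z.
      have zz : 0 < cabs (z - z0) by rewrite cabs_gt0 subr_eq0.
      apply: (@cdiff_near _ (fun w => (H w - H z0) / (w - z0)) _ _ (cabs (z - z0))) => //.
        move=> w wz; rewrite /dq; case: eqVneq => // wz0.
        by rewrite wz0 cabs_distC ltxx in wz.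
      apply: cdiff_div; first by apply: cdiffB; [exact: dH|exact: cdiff_cst].
        by apply: cdiffB; [exact: cdiff_id|exact: cdiff_cst].
      by rewrite subr_eq0.
    exact: cdiff_cont.
  move=> /in_orectW; rewrite rectE => /andP[h1 h2] zz0.
  have zz : 0 < cabs (z - z0) by rewrite cabs_gt0 subr_eq0.
  apply: (@cdiff_near _ (fun w => (H w - H z0) / (w - z0)) _ _ (cabs (z - z0))) => //.
    move=> w wz; rewrite /dq; case: eqVneq => // wz0.
    by rewrite wz0 cabs_distC ltxx in wz.
  apply: cdiff_div; first by apply: cdiffB; [exact: dH|exact: cdiff_cst].
    by apply: cdiffB; [exact: cdiff_id|exact: cdiff_cst].
  by rewrite subr_eq0.
have [v v1 vE] := cabs_dir (H z0).
set m := cabs (H z0) in vE mH.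
pose k t := z0 + u * cis t.
have kin t : in_orect a b c d (k t).
  have cu : cabs (u * cis t) = cabs u by rewrite cabsM cabs_cis mulr1.
  have kE : k t - z0 = u * cis t by rewrite /k addrC addKr.
  apply: (@in_orect_near _ _ _ _ z0 _ (cabs u)).
  - by rewrite /a subKr.
  - by rewrite /b addrC addKr.
  - by rewrite /c subKr.
  - by rewrite /d addrC addKr.
  - by rewrite kE -cu Re_le_cabs.
  - by rewrite kE -cu Im_le_cabs.
have kd t : is_rd k t (u * (i_ * cis t)).
  have := is_rdD (is_rd_cst z0 t) (is_rdZ u (is_rd_cis t)); rewrite add0r; exact.
(* On the circle k' = i (k - z0), so the factor -i v makes the derivative of B equal to Re (v H) - m
   <= 0. As P is single-valued, B takes the same value at 0 and 2 pi, and a monotone B must be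
   constant. *)
pose B t := Re (- i_ * v * P (k t)).
have Bd (t : R) : is_derive t 1 B (Re (v * H (k t)) - m).
  have := is_rdZ (- i_ * v) (is_rd_comp (kd t) (HP _ (kin t))).
  move=> /is_rd_parts[+ _].
  have -> : Re (- i_ * v * (dq H z0 l (k t) * (u * (i_ * cis t)))) =
     Re (v * H (k t)) - m.
    have -> : - i_ * v * (dq H z0 l (k t) * (u * (i_ * cis t))) =
      (- (i_ ^+ 2)) * (v * (dq H z0 l (k t) * (k t - z0))).
      by rewrite /k (addrC z0) addrK; ring.
    rewrite sqr_i opprK mul1r (dqE H z0 l (k t)).
    by rewrite (mulrDr v (H z0)) ReD vE [Re m%:C]/= [m + _]addrC addrK.
  exact.
have Bneg t : Re (v * H (k t)) - m <= 0.
  rewrite subr_le0; apply: le_trans (ler_norm _) _.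
  apply: le_trans (Re_le_cabs _) _; rewrite cabsM v1 mul1r.
  by have := in_orectW (kin t); rewrite rectE => /andP[h1 h2]; exact: mH.
have Bmono s t : s <= t -> B t <= B s.
  move=> st; have [cc _ E] : exists2 w, w \in `[s, t]%R &
      B t - B s = (Re (v * H (k w)) - m) * (t - s).
    apply: (@MVT_segment R B (fun w => Re (v * H (k w)) - m)) => //.
    apply: continuous_in_subspaceT => w _; apply: differentiable_continuous.
    by apply/derivable1_diffP; have [] := Bd w.
  by rewrite -subr_le0 E mulr_le0_ge0// subr_ge0.
have pi0 := @pi_gt0 R.
have E0 : B (pi *+ 2) = B 0 by rewrite /B /k cis2pi cis0.
have Bc t : 0 <= t <= pi *+ 2 -> B t = B 0.
  move=> /andP[/Bmono h1 /Bmono h2]; apply/eqP; rewrite eq_le h1 -E0 h2//.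
have Dpi : Re (v * H (k pi)) - m = 0.
  have := Bneg pi; rewrite le_eqVlt => /predU1P[//|D0].
  set D := Re _ - m in D0 *; have e0 : 0 < - D / 2 by lra.
  have [dl dl0 hd] := (is_derive_eps _ _ _).1 (Bd pi) _ e0.
  pose s := Num.min (dl / 2) pi.
  have s0 : 0 < s by rewrite lt_min pi0 divr_gt0.
  have s1 : s <= dl / 2 by rewrite ge_min lexx.
  have s2 : s <= pi by rewrite ge_min lexx orbT.
  have := hd (pi + s); rewrite (addrC pi) addrK gtr0_norm// => /(_ _)/wrap[]; first lra.
  have B1 : B (pi + s) = B 0.
    by apply: Bc; rewrite mulr2n lerD2l s2 andbT addr_ge0// ltW.
  have B2 : B pi = B 0 by apply: Bc; rewrite mulr2n lerDl andbb ltW.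
  rewrite [s + _]addrC B1 B2.
  rewrite subrr sub0r normrN normrM (gtr0_norm s0) ler_pM2r// -/D ltr0_norm//.
  by lra.
have kpi : k pi = z0 - u by rewrite /k cispi mulrN1.
have vH : v * H (z0 - u) = m%:C.
  rewrite kpi in Dpi.
  have h1 : cabs (v * H (z0 - u)) <= m.
    rewrite cabsM v1 mul1r.
    by have := in_orectW (kin pi); rewrite kpi rectE => /andP[? ?]; exact: mH.
  have h2 : Re (v * H (z0 - u)) = m by lra.
  have h3 : Im (v * H (z0 - u)) = 0.
    have := cabs_sq (v * H (z0 - u)); rewrite h2.
    have := cabs_ge0 (v * H (z0 - u)) => h4 h5.
    apply/eqP; rewrite -sqrf_eq0 -[_ == 0]/(_ == _) eq_le sqr_ge0 andbT; nra.
  by apply/eqP; rewrite eq_complex h2 h3 /= !eqxx.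
apply: (@mulfI _ v); last by rewrite vH vE.
by rewrite -cabs_eq0 v1 oner_eq0.
Qed.

End MaxModulus.

Section MaxModulusRect.
Variable R : realType.
Local Notation C := R[i].
Implicit Types (F G H : C -> C).

Lemma cabs_max_rect H (a b c d : R) : a <= b -> c <= d ->
  (forall z, in_rect a b c d z -> ccont H z) ->
  exists2 z1, in_rect a b c d z1 &
    forall z, in_rect a b c d z -> cabs (H z) <= cabs (H z1).
Proof.
move=> ab cd cH.
pose f (q : R * R) := cabs (H (q.1 +i* q.2)).
pose A : set (R * R) := `[a, b]%classic `*` `[c, d]%classic.
have A0 : A !=set0.
  by exists (a, c); split; rewrite /= in_itv /= lexx.
have cA : compact A by apply: compact_setX; exact: segment_compact.
have cf : {within A, continuous f}.
  apply: continuous_in_subspaceT => q; rewrite inE => -[] /=.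
  rewrite !in_itv /= => q1 q2; apply/cvgrPdist_lt => e e0.
  have /ccontP/(_ e e0)[dl dl0 h] : ccont H (q.1 +i* q.2).
    by apply: cH; rewrite /in_rect q1 q2.
  have dl20 : 0 < dl / 2 by lra.
  have : nbhs q (ball q (dl / 2)) by apply: nbhsx_ballx.
  apply: filterS => w [w1 w2].
  have /h hw : cabs (w.1 +i* w.2 - q.1 +i* q.2) < dl.
    apply: le_lt_trans (cabs_le_ReIm _) _; rewrite ReB ImB /=.
    move: w1 w2; rewrite -!ball_normE /= => w1 w2.
    by rewrite distrC (distrC w.2); lra.
  apply: le_lt_trans hw; rewrite /f ler_norml.
  have := cabs_lbB (H (w.1 +i* w.2)) (H (q.1 +i* q.2)).
  have := cabs_lbB (H (q.1 +i* q.2)) (H (w.1 +i* w.2)).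
  rewrite cabs_distC => h1 h2; apply/andP; split; lra.
have [q qA hq] := compact_EVT_max A0 cA cf.
move: qA; rewrite inE => -[] /=; rewrite !in_itv /= => q1 q2.
exists (q.1 +i* q.2); first by rewrite /in_rect q1 q2.
move=> [x y] /andP[/= xab ycd]; apply: (hq (x, y)); rewrite inE.
by split; rewrite /= in_itv.
Qed.

Lemma max_mod_rect H (a b c d m : R) : a <= b -> c <= d ->
  (forall z, in_rect a b c d z -> ccont H z) ->
  (forall z, in_orect a b c d z -> cdiff H z) ->
  (forall z, in_rect a b c d z -> ~~ in_orect a b c d z -> cabs (H z) <= m) ->
  forall z, in_rect a b c d z -> cabs (H z) <= m.
Proof.
move=> ab cd cH dH bH z zin.
have [z1 z1in mz1] := cabs_max_rect ab cd cH.
apply: le_trans (mz1 _ zin) _; rewrite leNgt; apply/negP => mM.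
have z1o : in_orect a b c d z1.
  by apply: contraLR mM => /(bH _ z1in); rewrite -leNgt.
pose r1 := Num.min (Re z1 - a) (b - Re z1).
pose r2 := Num.min (Im z1 - c) (d - Im z1).
pose r := Num.min r1 r2.
have [/andP[h1 h2] /andP[h3 h4]] := andP z1o.
have r0 : 0 < r by rewrite !lt_min !subr_gt0 h1 h2 h3.
have rin w (s : R) : s <= r -> `|Re (w - z1)| <= s -> `|Im (w - z1)| <= s ->
    in_rect a b c d w.
  by rewrite !le_min => /andP[/andP[s1 s2] /andP[s3 s4]]; exact: in_rect_near.
have rino w (s : R) : s < r -> `|Re (w - z1)| <= s -> `|Im (w - z1)| <= s ->
    in_orect a b c d w.
  by rewrite !lt_min => /andP[/andP[s1 s2] /andP[s3 s4]]; exact: in_orect_near.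
have Hc u : cabs u < r -> H (z1 + u) = H z1.
  move=> ur; pose s := (cabs u + r) / 2.
  have sr : s < r by rewrite /s; lra.
  apply: (@max_circle _ _ _ s); last by rewrite /s; lra.
    by move=> w w1 w2; apply: dH; exact: (rino _ s).
  by move=> w w1 w2; apply: mz1; apply: (rin _ s) => //; exact: ltW.
have key u : cabs u = r -> in_rect a b c d (z1 + u) -> in_orect a b c d (z1 + u).
  move=> ur zu; apply: contraT => /(bH _ zu) hm.
  have M0 : 0 < cabs (H z1) - m by lra.
  have [dl dl0 hd] := (ccontP _ _).1 (cH _ zu) _ M0.
  pose s := Num.min (1 / 2) (dl / (2 * r)).
  have s0 : 0 < s by rewrite lt_min !divr_gt0// mulr_gt0.
  have s1 : s <= 1 / 2 by rewrite ge_min lexx.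
  have s2 : s <= dl / (2 * r) by rewrite ge_min lexx orbT.
  have := hd (z1 + (1 - s)%:C * u).
  have -> : z1 + (1 - s)%:C * u - (z1 + u) = - (s%:C * u).
    by rewrite rmorphB /=; ring.
  rewrite cabsN cabsM cabsR gtr0_norm// ur Hc; last first.
    by rewrite cabsM cabsR ur ger0_norm; [nra|lra].
  move=> /(_ _)/wrap[].
    apply: (@le_lt_trans _ _ (dl / 2)); last lra.
    have -> : dl / 2 = dl / (2 * r) * r by field; rewrite gt_eqF.
    by rewrite ler_pM2r.
  have := cabs_lbB (H z1) (H (z1 + u)); lra.
have : [\/ Re z1 - r = a, Re z1 + r = b, Im z1 - r = c | Im z1 + r = d].
  have minE (s t : R) : Num.min s t = s \/ Num.min s t = t.
    by case: leP => _; [left|right].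
  rewrite /r; have [->|->] := minE r1 r2; rewrite /r1 /r2.
    have [->|->] := minE (Re z1 - a) (b - Re z1); first by constructor 1; rewrite subKr.
    by constructor 2; rewrite addrC subrK.
  have [->|->] := minE (Im z1 - c) (d - Im z1); first by constructor 3; rewrite subKr.
  by constructor 4; rewrite addrC subrK.
have nr : cabs (r%:C) = r by rewrite cabsR gtr0_norm.
have rr : `|r| <= r by rewrite ger0_norm// ltW.
have inu u : `|Re u| <= r -> `|Im u| <= r -> in_rect a b c d (z1 + u).
  by move=> ? ?; apply: (rin _ r) => //; rewrite addrC addKr.
case=> E.
- have := key (- r%:C); rewrite cabsN nr /in_orect ReD [Re (- _)]/= E ltxx.
  by move=> /(_ erefl) /(_ (inu _ _ _)) /wrap[] //=; rewrite ?oppr0 ?normr0 ?normrN// ltW.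
- have := key (r%:C); rewrite nr /in_orect ReD [Re r%:C]/= E ltxx andbF.
  by move=> /(_ erefl) /(_ (inu _ _ _)) /wrap[] //=; rewrite ?normr0// ltW.
- have := key (- (i_ * r%:C)); rewrite cabsN cabsM cabs_i mul1r nr.
  rewrite /in_orect ImD.
  have -> : Im (- (i_ * r%:C)) = - r by rewrite /= mul0r mul1r add0r.
  rewrite E ltxx /= andbF.
  move=> /(_ erefl) /(_ (inu _ _ _)) /wrap[] //=.
    by rewrite !mul0r mulr0 subrr oppr0 normr0 ltW.
  by rewrite mul0r mul1r add0r normrN.
- have := key (i_ * r%:C); rewrite cabsM cabs_i mul1r nr.
  rewrite /in_orect ImD.
  have -> : Im (i_ * r%:C) = r by rewrite /= mul0r mul1r add0r.
  rewrite E ltxx !andbF.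
  move=> /(_ erefl) /(_ (inu _ _ _)) /wrap[] //=.
    by rewrite !mul0r mulr0 subrr normr0 ltW.
  by rewrite mul0r mul1r add0r.
Qed.

Lemma bernoulli_unbounded (q K : R) : 1 < q -> exists n, K < q ^+ n.+1.
Proof.
move=> q1; have q10 : 0 < q - 1 by lra.
exists (Num.bound (`|K| / (q - 1))).
set n := Num.bound _.
have hn : `|K| / (q - 1) < n%:R by apply: archi_boundP; rewrite divr_ge0// ltW.
rewrite ltr_pdivrMr// in hn.
have bern k : 1 + k%:R * (q - 1) <= q ^+ k.
  elim: k => [|k ih]; first by rewrite mul0r addr0 expr0.
  rewrite exprS -natr1.
  have h1 : q * (1 + k%:R * (q - 1)) <= q * q ^+ k by rewrite ler_pM2l//; lra.
  have : 0 <= k%:R * ((q - 1) * (q - 1)) by rewrite !mulr_ge0// ltW.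
  lra.
have := bern n.+1; rewrite -natr1 => h; apply: lt_le_trans h.
have := ler_norm K; lra.
Qed.

Lemma ccontX H z n : ccont H z -> ccont (fun w => H w ^+ n) z.
Proof.
move=> cH; elim: n => [|n ih].
  have -> : (fun w => H w ^+ 0) = (fun=> 1) by apply/funext => w; rewrite expr0.
  exact: ccont_cst.
have -> : (fun w => H w ^+ n.+1) = (fun w => H w * H w ^+ n).
  by apply/funext => w; rewrite exprS.
exact: ccontM.
Qed.

(* Isolated points at which H is merely continuous do no harm: H^n times the
   product of the z - s is differentiable, and n -> oo gives the bound. *)
Lemma max_mod_exc H (S : seq C) (a b c d m : R) : a <= b -> c <= d ->
  (forall z, in_rect a b c d z -> ccont H z) ->
  (forall z, in_orect a b c d z -> z \notin S -> cdiff H z) ->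
  (forall z, in_rect a b c d z -> ~~ in_orect a b c d z -> cabs (H z) <= m) ->
  forall z, in_rect a b c d z -> z \notin S -> cabs (H z) <= m.
Proof.
move=> ab cd cH dH bH z zin zS; rewrite leNgt; apply/negP => mz.
pose P (s : seq C) w := \prod_(x <- s) (w - x).
have dP s w : cdiff (P s) w.
  elim: s => [|x s ih].
    have -> : P [::] = (fun=> 1) by apply/funext => v; rewrite /P big_nil.
    exact: cdiff_cst.
  have -> : P (x :: s) = (fun v => (v - x) * P s v).
    by apply/funext => v; rewrite /P big_cons.
  by apply: cdiffM => //; exact: (cdiffB (cdiff_id w) (cdiff_cst x w)).
have [zM _ hM] := @cabs_max_rect (P S) a b c d ab cd (fun w _ => cdiff_cont (dP S w)).
set p := cabs (P S zM) in hM.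
have m0 : 0 <= m.
  have ca : in_rect a b c d (a +i* c) by rewrite /in_rect /= !lexx ab cd.
  apply: le_trans (cabs_ge0 _) (bH _ ca _).
  by rewrite /in_orect /= ltxx.
set h := cabs (H z) in mz.
have Pz : 0 < cabs (P S z).
  rewrite cabs_gt0 /P prodf_seq_neq0; apply/allP => x xS /=.
  by rewrite subr_eq0; apply: contraNneq zS => ->.
(* Strictly between m and h, hence positive even if m = 0, so that the powers of h / m' can be
   used. *)
pose m' := (h + m) / 2.
have m'0 : 0 < m' by rewrite /m'; lra.
have mm' : m <= m' by rewrite /m'; lra.
have q1 : 1 < h / m' by rewrite ltr_pdivlMr// mul1r /m'; lra.
have [n hn] := bernoulli_unbounded (p / cabs (P S z)) q1.
have : cabs (H z ^+ n.+1 * P S z) <= m' ^+ n.+1 * p.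
  apply: (@max_mod_rect (fun w => H w ^+ n.+1 * P S w) a b c d) => //.
  - move=> w win; apply: ccontM; last exact: cdiff_cont.
    by apply: ccontX; exact: cH.
  - move=> w win; have [wS|wS] := boolP (w \in S); last first.
      by apply: cdiffM => //; apply: cdiffX; exact: dH.
    (* At an exceptional point w the product contains the factor v - w, and its cofactor is
       continuous: this is differentiability by Caratheodory's criterion. *)
    apply: (@is_cd_cdiff _ _ _ (H w ^+ n.+1 * P (rem w S) w)).
    apply: (@is_cd_phi _ _ _ (fun v => H v ^+ n.+1 * P (rem w S) v)).
      apply: ccontM; last exact: cdiff_cont.
      by apply: ccontX; apply: cH; exact: in_orectW.
    move=> v; rewrite /P !(big_rem w wS) /= subrr mul0r mulr0 add0r; ring.
  - move=> w win wo; rewrite cabsM cabsX; apply: ler_pM; rewrite ?exprn_ge0 ?cabs_ge0//.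
      by apply: lerXn2r; rewrite ?nnegrE ?cabs_ge0 ?(ltW m'0)// (le_trans (bH _ win wo)).
    exact: hM.
rewrite cabsM cabsX -/h.
rewrite expr_div_n ltr_pdivrMr// mulrAC ltr_pdivlMr ?exprn_gt0// in hn.
by move=> /(lt_le_trans hn); rewrite mulrC ltxx.
Qed.

End MaxModulusRect.

(** * Removable singularities *)

Section Removable.
Variable R : realType.
Local Notation C := R[i].
Implicit Types (F G H N : C -> C).

Lemma dq_neq F z0 l z : z != z0 -> exists2 d : R, 0 < d &
  forall w, cabs (w - z) < d -> (F w - F z0) / (w - z0) = dq F z0 l w.
Proof.
move=> zz0; exists (cabs (z - z0)); first by rewrite cabs_gt0 subr_eq0.
move=> w wz; rewrite /dq; case: eqVneq => // wz0.
by rewrite wz0 cabs_distC ltxx in wz.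
Qed.

Lemma ccont_dq F z0 l z : is_cd F z0 l -> ccont F z -> ccont (dq F z0 l) z.
Proof.
move=> Fl cF; have [->//|zz0] := eqVneq z z0.
have [d d0 h] := dq_neq F l zz0; apply: (ccont_near d0 h).
have cz : ccont (fun w => w - z0) z := ccontB (ccont_id z) (ccont_cst z0 z).
apply: ccontM; first exact: ccontB cF (ccont_cst _ _).
by apply: (ccontV cz); rewrite subr_eq0.
Qed.

Lemma cdiff_dq F z0 l z : z != z0 -> cdiff F z -> cdiff (dq F z0 l) z.
Proof.
move=> zz0 dF; have [d d0 h] := dq_neq F l zz0; apply: (cdiff_near d0 h).
have dz : cdiff (fun w => w - z0) z := cdiffB (cdiff_id z) (cdiff_cst z0 z).
apply: (cdiff_div _ dz); first exact: cdiffB dF (cdiff_cst _ _).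
by rewrite subr_eq0.
Qed.

(** Schwarz's lemma: the maximum principle for the quotient N / (z - z1), with z1 added to the
    exceptional points. *)
Lemma schwarz N (S : seq C) (a b c d m : R) z1 : a <= b -> c <= d ->
  (forall z, in_rect a b c d z -> ccont N z) ->
  (forall z, in_orect a b c d z -> z \notin S -> cdiff N z) ->
  in_orect a b c d z1 -> z1 \notin S -> N z1 = 0 ->
  (forall z, in_rect a b c d z -> ~~ in_orect a b c d z ->
     cabs (N z) <= m * cabs (z - z1)) ->
  forall z, in_rect a b c d z -> z \notin S -> cabs (N z) <= m * cabs (z - z1).
Proof.
move=> ab cd cN dN z1o z1S N0 bN z zin zS.
have /cdiffP[n Nn] := dN _ z1o z1S.
have [->|zz1] := eqVneq z z1; first by rewrite N0 cabs0 subrr cabs0 mulr0.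
rewrite (dqE N z1 n z) N0 add0r cabsM ler_wpM2r ?cabs_ge0//.
apply: (@max_mod_exc _ (dq N z1 n) (z1 :: S) a b c d) => //.
- by move=> w win; apply: ccont_dq => //; exact: cN.
- move=> w wo; rewrite inE negb_or => /andP[wz1 wS].
  by apply: cdiff_dq => //; exact: dN.
- move=> w win wo; have wz1 : w != z1 by apply: contraNneq wo => ->.
  have w0 : 0 < cabs (w - z1) by rewrite cabs_gt0 subr_eq0.
  rewrite -(ler_pM2r w0) -cabsM.
  by have := bN _ win wo; rewrite {1}(dqE N z1 n w) N0 add0r.
- by rewrite inE negb_or zz1.
Qed.

Definition in_sq (l : C) (r : R) := in_rect (Re l - r) (Re l + r) (Im l - r) (Im l + r).
Definition in_osq (l : C) (r : R) := in_orect (Re l - r) (Re l + r) (Im l - r) (Im l + r).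

Lemma in_sq_cabs l r z : cabs (z - l) <= r -> in_sq l r z.
Proof.
move=> zl; have := Re_le_cabs (z - l); have := Im_le_cabs (z - l).
rewrite ReB ImB => h1 h2.
by rewrite /in_sq /in_rect -!ler_distl (le_trans h1 zl) (le_trans h2 zl).
Qed.

Lemma in_osq_cabs l r z : cabs (z - l) < r -> in_osq l r z.
Proof.
move=> zl; have := Re_le_cabs (z - l); have := Im_le_cabs (z - l).
rewrite ReB ImB => h1 h2.
by rewrite /in_osq /in_orect -!ltr_distl (le_lt_trans h1 zl) (le_lt_trans h2 zl).
Qed.

Lemma in_osqN l r z : ~~ in_osq l r z -> r <= cabs (z - l).
Proof. by rewrite leNgt; apply: contra; exact: in_osq_cabs. Qed.

Lemma ccont_cabs_le F l (r c : R) (S : seq C) : 0 < r -> ccont F l ->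
  (forall z, cabs (z - l) < r -> z != l -> z \notin S -> cabs (F z) <= c) ->
  cabs (F l) <= c.
Proof.
move=> r0 /ccontP cF h; rewrite leNgt; apply/negP => cl.
have e0 : 0 < cabs (F l) - c by lra.
have [d d0 hd] := cF _ e0.
have [rho rho0 hS] : exists2 rho : R, 0 < rho &
    forall z, cabs (z - l) < rho -> z != l -> z \notin S.
  elim: S {h} => [|s S [rho rho0 ih]]; first by exists 1.
  have [->|sl] := eqVneq s l.
    by exists rho => // z /ih h zl; rewrite inE negb_or zl h.
  exists (Num.min rho (cabs (s - l))); first by rewrite lt_min rho0 cabs_gt0 subr_eq0.
  move=> z; rewrite lt_min => /andP[/ih h zs] zl; rewrite inE negb_or h// andbT.
  by apply: contraTneq zs => ->; rewrite ltxx.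
pose t := Num.min (Num.min r d) rho / 2.
have t0 : 0 < t by rewrite divr_gt0// !lt_min r0 d0.
have tm : t < Num.min (Num.min r d) rho by rewrite /t in t0 *; lra.
move: tm; rewrite !lt_min => /andP[/andP[tr td] trho].
have E : l + t%:C - l = t%:C by rewrite addrC addKr.
have nt : cabs (t%:C) = t by rewrite cabsR gtr0_norm.
have zl : l + t%:C != l by rewrite -subr_eq0 E -cabs_eq0 nt gt_eqF.
have := h (l + t%:C); rewrite E nt => /(_ tr zl (hS _ _ zl)) h1.
have := hd (l + t%:C); rewrite E nt => /(_ td).
have := cabs_lbB (F l) (F (l + t%:C)); rewrite cabs_distC.
have := h1 _; rewrite E nt => /(_ trho); lra.
Qed.

(** A Lipschitz difference quotient is Cauchy at l. Its limit is found on the ray l + t, for real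
    and imaginary parts separately, as a supremum of lower bounds g s - M s. *)
Lemma is_cd_lipschitz F l (r M : R) : 0 < r -> 0 <= M ->
  (forall z w, cabs (z - l) < r -> cabs (w - l) < r -> z != l -> w != l ->
     cabs ((F z - F l) / (z - l) - (F w - F l) / (w - l)) <= M * cabs (z - w)) ->
  cdiff F l.
Proof.
move=> r0 M0 hL; pose q z := (F z - F l) / (z - l).
pose pt (t : R) := l + t%:C.
have ptE t : pt t - l = t%:C by rewrite /pt addrC addKr.
have ptn (t : R) : 0 < t -> cabs (pt t - l) = t by move=> t0; rewrite ptE cabsR gtr0_norm.
have ptl (t : R) : 0 < t -> pt t != l.
  by move=> t0; rewrite -subr_eq0 -cabs_eq0 ptn// gt_eqF.
have hq s t : 0 < s < r -> 0 < t < r -> cabs (q (pt s) - q (pt t)) <= M * (s + t).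
  move=> /andP[s0 sr] /andP[t0 tr].
  apply: le_trans (hL _ _ _ _ (ptl _ s0) (ptl _ t0)) _; rewrite ?ptn//.
  have -> : pt s - pt t = (pt s - l) - (pt t - l) by ring.
  by rewrite ler_wpM2l// (le_trans (cabsB _ _))// !ptn.
have lim (g : R -> R) : (forall s t, 0 < s < r -> 0 < t < r -> g s - g t <= M * (s + t)) ->
    exists L, forall t, 0 < t < r -> `|g t - L| <= M * t.
  move=> hg; pose A := [set x | exists2 s, 0 < s < r & x = g s - M * s].
  have ubA t : 0 < t < r -> ubound A (g t + M * t).
    by move=> tr _ [s sr ->]; have := hg s t sr tr; lra.
  have rr : 0 < r / 2 < r by apply/andP; split; lra.
  have A0 : A !=set0 by exists (g (r / 2) - M * (r / 2)); exists (r / 2).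
  exists (sup A) => t tr; rewrite ler_norml; apply/andP; split.
    by have := ge_sup A0 (ubA _ tr); lra.
  have : g t - M * t <= sup A.
    apply: sup_upper_bound; last by exists t.
    by split=> //; exists (g (r / 2) + M * (r / 2)); exact: ubA.
  lra.
have [L1 h1] : exists L, forall t, 0 < t < r -> `|Re (q (pt t)) - L| <= M * t.
  apply: lim => s t sr tr; apply: le_trans (hq s t sr tr).
  by rewrite -ReB; apply: le_trans (ler_norm _) (Re_le_cabs _).
have [L2 h2] : exists L, forall t, 0 < t < r -> `|Im (q (pt t)) - L| <= M * t.
  apply: lim => s t sr tr; apply: le_trans (hq s t sr tr).
  by rewrite -ImB; apply: le_trans (ler_norm _) (Im_le_cabs _).
pose L := L1 +i* L2.
have qL z : cabs (z - l) < r -> z != l -> cabs (q z - L) <= 4 * M * cabs (z - l).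
  move=> zr zl; set t := cabs (z - l).
  have t0 : 0 < t by rewrite cabs_gt0 subr_eq0.
  have tr : 0 < t < r by rewrite t0.
  have -> : q z - L = (q z - q (pt t)) + (q (pt t) - L) by ring.
  have a1 : cabs (q (pt t) - L) <= M * t + M * t.
    apply: le_trans (cabs_le_ReIm _) _; rewrite ReB ImB /=.
    by apply: lerD; [exact: h1|exact: h2].
  have a2 : cabs (q z - q (pt t)) <= M * (2 * t).
    apply: le_trans (hL _ _ zr _ zl (ptl _ t0)) _; first by rewrite ptn.
    rewrite ler_wpM2l//; have -> : z - pt t = (z - l) - (pt t - l) by ring.
    by apply: le_trans (cabsB _ _) _; rewrite ptn// -/t; lra.
  by apply: le_trans (cabsD _ _) _; lra.
apply/cdiffP; exists L; apply/ccontP => e e0.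
exists (Num.min r (e / (4 * M + 1))).
  by rewrite lt_min r0 divr_gt0// ltr_wpDl// mulr_ge0.
move=> z; rewrite lt_min => /andP[zr ze].
rewrite dq_id /dq; case: eqVneq => [_|zl]; first by rewrite subrr cabs0.
rewrite ltr_pdivlMr in ze; last by rewrite ltr_wpDl// mulr_ge0.
apply: le_lt_trans (qL _ zr zl) _; have := cabs_ge0 (z - l); lra.
Qed.

(** For a centre z1 other than l, the difference quotient of F is bounded by the maximum principle
    and then Lipschitz by [schwarz], with a constant independent of z1. Letting z1 tend to l, by
    mere continuity of F, gives the Lipschitz bound for the quotient centred at l. *)
Lemma removable F l (r : R) : 0 < r ->
  (forall z, in_sq l r z -> ccont F z) ->
  (forall z, in_sq l r z -> z != l -> cdiff F z) -> cdiff F l.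
Proof.
move=> r0 cF dF.
have abr : Re l - r <= Re l + r by lra.
have cdr : Im l - r <= Im l + r by lra.
have [zM _ hM] := cabs_max_rect abr cdr cF.
set K := cabs (F zM) in hM.
have K0 : 0 <= K := cabs_ge0 _.
have dFo z : in_osq l r z -> z \notin [:: l] -> cdiff F z.
  by move=> /in_orectW zin; rewrite inE => zl; exact: dF.
have lo : in_osq l r l by apply: in_osq_cabs; rewrite subrr cabs0.
have half z w : cabs (z - l) < r / 2 -> ~~ in_osq l r w -> r / 2 <= cabs (w - z).
  move=> zr /in_osqN wr.
  have := cabs_lbB (w - l) (z - l).
  have -> : w - l - (z - l) = w - z by ring.
  lra.
have inr z : cabs (z - l) < r / 2 -> in_osq l r z.
  by move=> zr; apply: in_osq_cabs; lra.
(* Boundary points are at distance at least r / 2 from z1 and z2. So the quotient is at most 2 K /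
   (r / 2) = 4 K / r there, its variation N at most 8 K / r, which is M (r / 2). *)
pose M := 16 * K / r ^+ 2.
have M0 : 0 <= M by rewrite divr_ge0 ?mulr_ge0 ?exprn_ge0 ?(ltW r0).
have key z1 z2 z : cabs (z1 - l) < r / 2 -> cabs (z2 - l) < r / 2 ->
    cabs (z - l) < r / 2 -> z1 != l -> z2 != l -> z != l -> z1 != z -> z1 != z2 ->
    cabs ((F z - F z1) / (z - z1) - (F z2 - F z1) / (z2 - z1)) <= M * cabs (z - z2).
  move=> z1r z2r zr z1l z2l zl z1z z12.
  have /cdiffP[f1 Ff1] : cdiff F z1 by apply: dFo; rewrite ?inE//; exact: inr.
  have cD w : in_sq l r w -> ccont (dq F z1 f1) w.
    by move=> win; apply: ccont_dq => //; exact: cF.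
  have dD w : in_osq l r w -> w \notin [:: l; z1] -> cdiff (dq F z1 f1) w.
    move=> wo; rewrite !inE negb_or => /andP[wl wz1].
    by apply: cdiff_dq => //; apply: dFo; rewrite ?inE.
  have D1 v : in_sq l r v -> ~~ in_osq l r v -> cabs (dq F z1 f1 v) <= 4 * K / r.
    move=> vin vo; have hv := half _ _ z1r vo.
    have vz1 : v != z1.
      by apply: contraTneq hv => ->; rewrite subrr cabs0 -ltNge; lra.
    rewrite /dq ifN// cabsM cabsV ler_pdivrMr ?cabs_gt0 ?subr_eq0//.
    have : cabs (F v - F z1) <= 2 * K.
      apply: le_trans (cabsB _ _) _.
      have := hM _ vin; have := hM _ (in_orectW (inr _ z1r)); lra.
    move=> h; apply: le_trans h _.
    have -> : 2 * K = 4 * K / r * (r / 2) by field; rewrite gt_eqF.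
    by rewrite ler_wpM2l// divr_ge0 ?(ltW r0)// mulr_ge0.
  have z2S : z2 \notin [:: l; z1] by rewrite !inE negb_or z2l eq_sym.
  have D2 : cabs (dq F z1 f1 z2) <= 4 * K / r.
    exact: (max_mod_exc abr cdr cD dD D1 (in_orectW (inr _ z2r)) z2S).
  pose N w := dq F z1 f1 w - dq F z1 f1 z2.
  have := @schwarz N [:: l; z1] _ _ _ _ M z2 abr cdr.
  move=> /(_ _ _ (inr _ z2r) z2S (subrr _)) H.
  have -> : (F z - F z1) / (z - z1) - (F z2 - F z1) / (z2 - z1) = N z.
    by rewrite /N /dq !ifN// eq_sym.
  apply: H; last 2 first.
  - exact: in_orectW (inr _ zr).
  - by rewrite !inE negb_or zl eq_sym.
  - by move=> w win; apply: ccontB; [exact: cD|exact: ccont_cst].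
  - by move=> w wo wS; apply: cdiffB; [exact: dD|exact: cdiff_cst].
  - move=> w win wo; have hw := half _ _ z2r wo.
    apply: le_trans (cabsB _ _) _; have := D1 _ win wo => h.
    have : M * (r / 2) <= M * cabs (w - z2) by rewrite ler_wpM2l.
    have -> : M * (r / 2) = 8 * K / r by rewrite /M; field; rewrite gt_eqF.
    lra.
have r20 : 0 < r / 2 by lra.
apply: (is_cd_lipschitz r20 M0) => z z2 zr z2r zl z2l.
pose T z1 := (F z - F z1) / (z - z1) - (F z2 - F z1) / (z2 - z1).
rewrite -/(T l); apply: (@ccont_cabs_le T l (r / 2) _ [:: z; z2] r20).
  have cl : ccont F l by apply: cF; exact: in_orectW.
  have ct x : x != l -> ccont (fun z1 => (F x - F z1) / (x - z1)) l.
    move=> xl; have cx : ccont (fun w => x - w) l := ccontB (ccont_cst x l) (ccont_id l).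
    apply: ccontM; first exact: ccontB (ccont_cst _ _) cl.
    by apply: (ccontV cx); rewrite subr_eq0.
  by apply: ccontB; exact: ct.
move=> z1 z1r z1l; rewrite !inE negb_or => /andP[z1z z1z2].
exact: key.
Qed.

Lemma entire_div F l : (forall z, cdiff F z) -> F l = 0 ->
  exists2 G, (forall z, cdiff G z) & forall z, F z = (z - l) * G z.
Proof.
move=> dF Fl; have /cdiffP[f Ff] := dF l.
exists (dq F l f); last by move=> z; rewrite {1}(dqE F l f z) Fl add0r mulrC.
move=> z; have [->|zl] := eqVneq z l; last exact: cdiff_dq.
apply: (@removable _ _ 1) => // w _.
  by apply: ccont_dq => //; exact: cdiff_cont.
by move=> wl; exact: cdiff_dq.
Qed.

End Removable.

(** * The Phragmen-Lindelof principle *)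

Section PhragmenLindelof.
Variable R : realType.
Local Notation C := R[i].
Implicit Types (F G H : C -> C).

Lemma one_Bie (e : R) z : 1 - i_ * (e%:C * z) = (1 + e * Im z) +i* (- (e * Re z)).
Proof.
by case: z => x y; apply/eqP; rewrite eq_complex /=; apply/andP; split; apply/eqP; ring.
Qed.

(** The denominator 1 - i e z has modulus at least 1 on the closed half-plane and grows linearly. It
    makes the crude bound K harmless on the far sides of a large rectangle, and e can be taken small
    afterwards. *)
Lemma phragmen_lindelof H (K t : R) :
  (forall z, 0 <= Im z -> cdiff H z) ->
  (forall z, 0 < Im z -> cabs (H z) <= K) ->
  (forall x : R, cabs (H (x%:C)) <= t) ->
  forall z, 0 <= Im z -> cabs (H z) <= t.
Proof.
move=> dH HK Ht z z0; rewrite leNgt; apply/negP => tz.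
have t0 : 0 <= t := le_trans (cabs_ge0 _) (Ht 0).
have K0 : 0 <= K.
  by apply: le_trans (cabs_ge0 _) (HK (0 +i* 1) _); rewrite /= ltr01.
set h := cabs (H z) in tz.
pose t1 := (t + h) / 2.
have t10 : 0 < t1 by rewrite /t1; lra.
have tt1 : t <= t1 by rewrite /t1; lra.
have t1h : t1 < h by rewrite /t1; lra.
have z1 : 0 < cabs z + 1 by rewrite ltr_wpDl// cabs_ge0.
(* Chosen so that the price paid at z, t1 (1 + e (|z| + 1)), is t1 + (h - t1) / 2, still less than
   h. *)
pose e := (h - t1) / (2 * t1 * (cabs z + 1)).
have e0 : 0 < e by apply: divr_gt0; [lra|apply: mulr_gt0 => //; lra].
(* Large enough that z is inside the rectangle and K <= e rho t1, which gives |H / D| <= t1 on the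
   three sides off the real line. *)
pose rho := K / (e * t1) + cabs z + 1.
have K1 : 0 <= K / (e * t1) by rewrite divr_ge0// ltW// mulr_gt0.
have rz : cabs z <= rho by rewrite /rho; have := cabs_ge0 z; lra.
have r0 : 0 < rho by rewrite /rho; lra.
have rK : K <= e * rho * t1.
  have -> : K = e * (K / (e * t1)) * t1 by field; rewrite !gt_eqF.
  by rewrite ler_pM2r// ler_pM2l// /rho; lra.
pose D w : C := 1 - i_ * (e%:C * w).
have D1 w : 0 <= Im w -> 1 <= cabs (D w).
  move=> w0; apply: le_trans (Re_le_cabs _); rewrite /D one_Bie /=.
  by apply: le_trans (ler_norm _); rewrite lerDl mulr_ge0// ltW.
have Dn0 w : 0 <= Im w -> D w != 0.
  by move=> /D1 ?; rewrite -cabs_eq0 gt_eqF//; lra.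
have zin : in_rect (- rho) rho 0 rho z.
  have := Re_le_cabs z; have := Im_le_cabs z.
  move: z0 rz; rewrite /in_rect !ler_norml; move: (Re z) (Im z) (cabs z); clear.
  by move=> u v w ? ? /andP[? ?] /andP[? ?]; apply/andP; split; apply/andP; split; lra.
have dW w : 0 <= Im w -> cdiff (fun v => H v / D v) w.
  move=> w0; apply: cdiff_div; [exact: dH| |exact: Dn0].
  apply: (cdiffB (cdiff_cst 1 w)).
  apply: (cdiffM (cdiff_cst _ _)).
  by apply: (cdiffM (cdiff_cst _ _)); exact: cdiff_id.
have : cabs (H z / D z) <= t1.
  apply: (@max_mod_rect _ (fun v => H v / D v) (- rho) rho 0 rho) => //; [lra|lra|..].
  - by move=> w /andP[_ /andP[w0 _]]; apply: cdiff_cont; exact: dW.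
  - by move=> w /andP[_ /andP[/ltW w0 _]]; exact: dW.
  - move=> w /andP[/andP[w1 w2] /andP[w3 w4]] wo.
    have Dw : 0 < cabs (D w) by rewrite cabs_gt0 Dn0.
    rewrite cabsM cabsV ler_pdivrMr//.
    move: w3; rewrite le_eqVlt => /predU1P[w3|w3].
      have -> : w = (Re w)%:C by apply/eqP; rewrite eq_complex /= w3 !eqxx.
      apply: le_trans (Ht _) _; apply: le_trans tt1 _.
      by rewrite ler_peMr ?(ltW t10)// D1.
    apply: le_trans (HK _ w3) _; apply: le_trans rK _.
    rewrite mulrC ler_pM2l//.
    have [wE|wE] : `|Re w| = rho \/ Im w = rho.
      move: wo; rewrite /in_orect w3 /= !negb_and -!leNgt => /orP[/orP[]|] hw.
      - left; have -> : Re w = - rho by lra.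
        by rewrite normrN gtr0_norm.
      - by left; have -> : Re w = rho by [lra]; rewrite gtr0_norm.
      - by right; lra.
    + apply: le_trans (Im_le_cabs _); rewrite /D one_Bie /= normrN normrM wE.
      by rewrite gtr0_norm.
    + apply: le_trans (Re_le_cabs _); rewrite /D one_Bie /= wE.
      by apply: le_trans (ler_norm _); lra.
have Dz : 0 < cabs (D z) by rewrite cabs_gt0 Dn0.
rewrite cabsM cabsV ler_pdivrMr// -/h => hD.
have Dle : cabs (D z) <= 1 + e * (cabs z + 1).
  apply: le_trans (cabsB _ _) _; rewrite cabs1 !cabsM cabs_i mul1r cabsR gtr0_norm//.
  by rewrite lerD2l ler_pM2l//; lra.
have : t1 * cabs (D z) <= t1 * (1 + e * (cabs z + 1)) by rewrite ler_pM2l.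
have -> : t1 * (1 + e * (cabs z + 1)) = t1 + (h - t1) / 2.
  by rewrite /e; field; rewrite !gt_eqF.
lra.
Qed.

(** On the boundary of the square the difference quotient is at most 2 m / r. The maximum principle
    carries this inside, and continuity of the quotient carries it to the centre. *)
Lemma cauchy_estimate H z l (r m : R) : 0 < r ->
  (forall w, in_sq z r w -> cdiff H w) -> is_cd H z l ->
  (forall w, in_sq z r w -> cabs (H w) <= m) -> cabs l <= 2 * m / r.
Proof.
move=> r0 dH Hl Hm.
have abr : Re z - r <= Re z + r by lra.
have cdr : Im z - r <= Im z + r by lra.
have zo : in_osq z r z by apply: in_osq_cabs; rewrite subrr cabs0.
rewrite -(dq_id H z l).
apply: (@ccont_cabs_le _ _ z r _ [::] r0); first exact: Hl.
move=> v vr vz _; apply: (@max_mod_exc _ (dq H z l) [:: z] _ _ _ _ _ abr cdr).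
- by move=> w win; apply: ccont_dq => //; apply: cdiff_cont; exact: dH.
- move=> w wo; rewrite inE => wz; apply: cdiff_dq => //; apply: dH; exact: in_orectW.
- move=> w win wo; have := in_osqN wo => rw.
  have wz0 : 0 < cabs (w - z) by lra.
  have wz : w != z by rewrite -subr_eq0 -cabs_gt0.
  rewrite /dq ifN// cabsM cabsV.
  apply: (@le_trans _ _ (2 * m / cabs (w - z))).
    rewrite ler_pM2r ?invr_gt0//; apply: le_trans (cabsB _ _) _.
    have := Hm _ win; have := Hm _ (in_orectW zo); lra.
  have m0 : 0 <= m := le_trans (cabs_ge0 _) (Hm _ (in_orectW zo)).
  by rewrite ler_wpM2l ?mulr_ge0// lef_pV2.
- by apply: in_orectW; exact: in_osq_cabs.
- by rewrite inE.
Qed.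

End PhragmenLindelof.

(** * The inner function of E *)

Section Theta.
Variable R : realType.
Local Notation C := R[i].
Local Notation mu := (@lebesgue_measure R).
Variable E : C -> C.
Hypothesis hbE : hermite_biehler (E : CC R -> CC R).
Hypothesis E0 : forall x : R, E (x%:C) != 0.

(** The definitions use the imaginary part with values in R[i]; the rest of the proof uses the real
    coordinate. *)
Lemma Num_Im_gt0 (z : C) : (0 < Num.Theory.Im z) = (0 < Im z).
Proof. by rewrite -complexIm ltcR. Qed.

Lemma hb_cdiff z : cdiff E z.
Proof. by split; exact: (hbE.1 z). Qed.

Lemma hb_lt z : 0 < Im z -> cabs (E (z^*)) < cabs (E z).
Proof. by move=> z0; apply: (hbE.2 z); rewrite Num_Im_gt0. Qed.

Lemma ImJ (z : C) : Im (z^*) = - Im z.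
Proof. by case: z. Qed.

Lemma real_Im0 (z : C) : Im z = 0 -> z = (Re z)%:C.
Proof. by move=> z0; apply/eqP; rewrite eq_complex /= z0 !eqxx. Qed.

Lemma hb_neq0 z : 0 <= Im z -> E z != 0.
Proof.
rewrite le_eqVlt => /predU1P[/esym/real_Im0 ->//|/hb_lt].
by rewrite -cabs_gt0; apply: le_lt_trans; exact: cabs_ge0.
Qed.

Definition Theta z := sharp (E : CC R -> CC R) z / E z.

Lemma cdiff_Theta z : 0 <= Im z -> cdiff Theta z.
Proof.
move=> z0; apply: cdiff_div; [|exact: hb_cdiff|exact: hb_neq0].
by apply: cdiff_sharp; exact: hb_cdiff.
Qed.

Lemma Theta_le1 z : 0 < Im z -> cabs (Theta z) <= 1.
Proof.
move=> z0; rewrite /Theta cabsM cabsV ler_pdivrMr; last first.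
  by rewrite cabs_gt0 hb_neq0// ltW.
by rewrite mul1r cabsJ; apply/ltW/hb_lt.
Qed.

Lemma cis_lip (s t : R) : cabs (cis s - cis t) <= `|s - t|.
Proof.
rewrite -[leRHS]mul1r.
apply: (@curve_lip_abs _ (@cis R) (fun t => i_ * cis t)) => r _.
  exact: is_rd_cis.
by rewrite cabsM cabs_i cabs_cis mulr1.
Qed.

(** By continuity a violation at one point spreads to an interval, which has positive measure. *)
Lemma continuous_ae_le (g : R -> R) (B : R) : continuous g ->
  {ae mu, forall x, g x <= B} -> forall x, g x <= B.
Proof.
move=> cg [N [mN N0 sub]] x; rewrite leNgt; apply/negP => Bx.
have e0 : 0 < g x - B by lra.
have [d d0 h] := (real_contP g x).1 (cg x) _ e0.
have sN : `]x - d, x + d[%classic `<=` N.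
  move=> y /=; rewrite in_itv /= -ltr_distl => yd; apply: sub => /= gy.
  have := h y yd; rewrite ltr_norml => /andP[h1 _].
  by have := gy; lra.
have : (mu `](x - d)%R, (x + d)%R[%classic <= mu N)%E.
  by apply: le_measure => //; rewrite inE//; exact: measurable_itv.
rewrite N0 lebesgue_measure_itv /=.
rewrite lte_fin ltrBlDr -addrA ltrDl addr_gt0// -EFinD lee_fin; lra.
Qed.

Lemma phase_lip : phase_deriv_Linf (E : CC R -> CC R) ->
  exists2 B : R, 0 < B & forall x y : R, cabs (Theta (x%:C) - Theta (y%:C)) <= B * `|x - y|.
Proof.
case=> phi [smooth [phiE Lphi]].
have cphi' : continuous (derive1 phi).
  move=> x; apply: differentiable_continuous; apply/derivable1_diffP.
  exact: (smooth 1%N x).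
have [B B0 hB] : exists2 B : R, 0 < B & forall x, `|derive1 phi x| <= B.
  move: Lphi; rewrite unlock /=; case: ifPn => [_|]; last first.
    by rewrite -set_itvNyy lebesgue_measure_itv /= ltry.
  set s := ess_sup _ _ => sy.
  have s0 : {ae mu, forall x, ((abse \o (EFin \o derive1 phi)) x <= s)%E}.
    by apply/ess_supP.
  (* The maximum with 1 makes the Lipschitz constant both finite and positive. *)
  pose B := fine (Order.max s 1%E).
  have m1 : (1%E <= Order.max s 1%:E)%E by rewrite le_max lexx orbT.
  have BE : B%:E = Order.max s 1%E.
    rewrite fineK// ge0_fin_numE; last exact: le_trans m1.
    by rewrite gt_max sy ltry.
  exists B; first by rewrite -lte_fin BE; exact: lt_le_trans m1.
  apply: (@continuous_ae_le (fun x => `|derive1 phi x|)).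
    by move=> x; apply: continuous_comp; [exact: cphi'|exact: norm_continuous].
  apply: filterS s0; first exact: (ae_filter_ringOfSetsType mu).
  move=> x /= h; rewrite -lee_fin BE.
  by apply: le_trans h _; rewrite le_max lexx.
exists B => // x y.
have TE u : Theta (u%:C) = cis (phi u) by rewrite /Theta phiE.
rewrite !TE; apply: le_trans (cis_lip _ _) _.
wlog yx : x y / y <= x => [hw|].
  by have [/hw//|/ltW /hw] := leP y x; rewrite distrC (distrC y).
have [c _ ->] : exists2 c, c \in `[y, x]%R & phi x - phi y = derive1 phi c * (x - y).
  apply: (@MVT_segment R phi (derive1 phi)) => //.
    move=> w _; apply: DeriveDef; first exact: (smooth 0%N w).
    by rewrite derive1E.
  apply: continuous_in_subspaceT => w _; apply: differentiable_continuous.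
  by apply/derivable1_diffP; exact: (smooth 0%N w).
by rewrite normrM ler_wpM2r.
Qed.

(* Phragmen-Lindelof applied to z |-> Theta (z + h) - Theta z bounds Theta' by B
   in the upper half-plane, so |Theta| stays away from 0 in a strip. *)
Lemma Theta_ge (B : R) : 0 < B ->
  (forall x y : R, cabs (Theta (x%:C) - Theta (y%:C)) <= B * `|x - y|) ->
  forall x y : R, 0 <= y -> 1 - B * y <= cabs (Theta (x +i* y)).
Proof.
move=> B0 hB.
have Im_shift z (h : R) : Im (z + h%:C) = Im z by rewrite ImD /= addr0.
have shift (h : R) z : 0 <= Im z ->
    cabs (Theta (z + h%:C) - Theta z) <= B * `|h|.
  apply: (@phragmen_lindelof _ (fun w => Theta (w + h%:C) - Theta w) 2).
  - move=> w w0; apply: cdiffB; last exact: cdiff_Theta.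
    have dw : cdiff (fun v => v + h%:C) w := cdiffD (cdiff_id w) (cdiff_cst _ w).
    by apply: (cdiff_comp (G := Theta) dw); apply: cdiff_Theta; rewrite Im_shift.
  - move=> w w0; apply: le_trans (cabsB _ _) _.
    have := Theta_le1 w0; have : cabs (Theta (w + h%:C)) <= 1.
      by apply: Theta_le1; rewrite Im_shift.
    lra.
  - move=> x; rewrite -rmorphD /=; apply: le_trans (hB _ _) _.
    by rewrite [x + h]addrC addrK.
have dTheta z l : 0 <= Im z -> is_cd Theta z l -> cabs l <= B.
  move=> z0 Tl; rewrite leNgt; apply/negP => Bl.
  have e0 : 0 < (cabs l - B) / 2 by lra.
  have [d d0 h] := (is_cd_eps _ _ _).1 Tl _ e0.
  have nd : cabs ((d / 2)%:C : C) = d / 2 by rewrite cabsR gtr0_norm// divr_gt0.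
  have zd : z + (d / 2)%:C - z = (d / 2)%:C by rewrite [z + _]addrC addrK.
  have := h (z + (d / 2)%:C); rewrite zd nd => /(_ _)/wrap[].
    lra.
  have := shift (d / 2) z z0; rewrite gtr0_norm ?divr_gt0// => h1 h2.
  have := cabs_lbB (l * (d / 2)%:C) (Theta (z + (d / 2)%:C) - Theta z).
  rewrite cabsM nd cabs_distC; nra.
move=> x y y0.
have T0 : cabs (Theta (x +i* 0)) = 1.
  have -> : x +i* 0 = x%:C by [].
  by rewrite /Theta /sharp conjc_real cabsM cabsV cabsJ divff// cabs_eq0 E0.
suff : cabs (Theta (x +i* y) - Theta (x +i* 0)) <= B * (y - 0).
  have := cabs_lbB (Theta (x +i* 0)) (Theta (x +i* y)).
  rewrite cabs_distC T0; lra.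
have dT t : 0 <= t -> exists l, is_cd Theta (x +i* t) l.
  by move=> t0; apply/cdiffP; exact: cdiff_Theta.
pose dk (t : R) := if pselect (0 <= t) is left t0 then projT1 (cid (dT t t0)) * i_ else 0.
have kd t : 0 <= t -> is_rd (fun s => Theta (x +i* s)) t (dk t).
  move=> t0; rewrite /dk; case: pselect => // t0'.
  by apply: is_rd_comp (is_rd_vertical x t) _; case: cid.
apply: (@curve_lip _ (fun t => Theta (x +i* t)) dk) => //.
- by move=> t; rewrite in_itv /= => /andP[/ltW t0 _]; exact: kd.
- by move=> t; rewrite in_itv /= => /andP[t0 _]; exact: is_rd_cont (kd _ t0).
- move=> t; rewrite in_itv /= => /andP[/ltW t0 _]; rewrite /dk.
  case: pselect => // t0'; rewrite cabsM cabs_i mulr1.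
  by apply: (dTheta (x +i* t)) => //; case: cid.
Qed.

Lemma hb_strip : phase_deriv_Linf (E : CC R -> CC R) ->
  exists2 eta : R, 0 < eta & forall z, 0 <= Im z <= eta ->
    cabs (E z) <= 2 * cabs (E (z^*)).
Proof.
move=> /phase_lip[B B0 /(Theta_ge B0) hB]; exists (1 / (2 * B)).
  by rewrite divr_gt0// mulr_gt0.
move=> [x y] /andP[/= y0 y1]; have := hB x y y0.
have Exy : 0 < cabs (E (x +i* y)) by rewrite cabs_gt0 hb_neq0.
rewrite /Theta /sharp cabsM cabsV cabsJ ler_pdivlMr//.
have By : B * y <= 1 / 2.
  by rewrite mulrC -ler_pdivlMr//; have -> : 1 / 2 / B = 1 / (2 * B) by field; rewrite gt_eqF.
have := cabs_ge0 (E (x +i* y)); simpl; nra.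
Qed.

End Theta.

(** * Bounds from the p-th power integrals *)

Section HardyBound.
Variable R : realType.
Local Notation C := R[i].
Local Notation mu := (@lebesgue_measure R).
Variable p : R.
Hypothesis p1 : 1 <= p.
Implicit Types (F G H : C -> C).

Let p0 : 0 < p := lt_le_trans ltr01 p1.

(** The power function is differentiable at positive points only; at a zero of g, the inequality u^p
    <= u on ]0, 1] takes over. *)
Lemma continuous_powR_comp (g : R -> R) (t : R) : (forall s, 0 <= g s) ->
  {for t, continuous g} -> {for t, continuous (fun s => g s `^ p)}.
Proof.
move=> g0 cg; have [gt0|gtn0] := eqVneq (g t) 0; last first.
  apply: (@continuous_comp _ _ _ g (fun a => a `^ p)); first exact: cg.
  apply: differentiable_continuous; apply/derivable1_diffP.
  by apply: derivable_powR; rewrite /= in_itv /= andbT lt_neqAle eq_sym gtn0 g0.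
apply/real_contP => e e0; have q0 : 0 < Num.min 1 e by rewrite lt_min ltr01.
have [d d0 h] := (real_contP g t).1 cg _ q0; exists d => // s /h.
rewrite gt0 powR0 ?gt_eqF// !subr0 !ger0_norm ?powR_ge0//.
rewrite lt_min => /andP[s1 se].
have [->|gs] := eqVneq (g s) 0; first by rewrite powR0// gt_eqF.
apply: le_lt_trans se; apply: ge1r_powR => //.
by rewrite lt_neqAle eq_sym gs g0 ltW.
Qed.

(** If u > s, then u / s <= (u / s)^p. This plays the role of Hoelder's inequality on a unit
    segment: with s equal to a bound t for the L^p norm, it integrates to t + t. *)
Lemma powR_young (u s : R) : 0 <= u -> 0 < s -> u <= s + s / s `^ p * u `^ p.
Proof.
move=> u0 s0; have [us|su] := leP u s.
  by apply: ler_wpDr => //; rewrite mulr_ge0 ?powR_ge0// divr_ge0 ?powR_ge0// ltW.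
apply: ler_wpDl; first exact: ltW.
have us1 : 1 <= u / s by rewrite ler_pdivlMr// mul1r ltW.
have := le1r_powR us1 p1; rewrite powRM//; last by rewrite invr_ge0 ltW.
have -> : s^-1 `^ p = (s `^ p)^-1.
  by rewrite -(powR_inv1 (ltW s0)) -powRrM mulN1r powRN.
rewrite ler_pdivrMr// => h; apply: le_trans h _.
by rewrite le_eqVlt; apply/orP; left; apply/eqP; ring.
Qed.

Lemma primitive_le_integral (k P : R -> R) (N : R) : continuous k ->
  (forall t, 0 <= k t) -> (forall t : R, is_derive t 1 P (k t)) ->
  (\int[mu]_x (k x)%:E <= N%:E)%E -> forall a b, a <= b -> P b - P a <= N.
Proof.
move=> ck k0 Pk kN a b; rewrite le_eqVlt => /predU1P[->|ab].
  rewrite subrr -lee_fin; apply: le_trans kN.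
  by apply: integral_ge0 => x _; rewrite lee_fin.
have cP : continuous P.
  move=> x; apply: differentiable_continuous; apply/derivable1_diffP.
  by have [] := Pk x.
rewrite -lee_fin EFinB -(@continuous_FTC2 _ k P a b ab).
- apply: le_trans kN; apply: ge0_subset_integral => //.
    apply/measurable_EFinP; exact: continuous_measurable_fun.
  by move=> x _; rewrite lee_fin.
- exact: continuous_subspaceT.
- split; first by move=> x _; have [] := Pk x.
    by apply: cvg_at_right_filter; exact: cP.
  by apply: cvg_at_left_filter; exact: cP.
- by move=> x _; rewrite derive1E; exact: derive_val.
Qed.

(** The mean value inequality with gauge s t + c P(t), where P is a primitive of |dk|^p and c = s /
    s^p; [powR_young] compares the derivatives. *)
Lemma segment_bound (k dk : R -> C) (s N : R) : 0 < s ->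
  (forall t, is_rd k t (dk t)) -> (forall t, rcont dk t) ->
  (\int[mu]_x (cabs (dk x) `^ p)%:E <= N%:E)%E ->
  forall x h, 0 <= h <= 1 -> cabs (k (x + h) - k x) <= s + s / s `^ p * N.
Proof.
move=> s0 kd cdk dkN x h /andP[h0 h1].
have c0 t : 0 <= cabs (dk t) by exact: cabs_ge0.
have ck : continuous (fun t => cabs (dk t) `^ p).
  by move=> t; apply: continuous_powR_comp => //; exact: rcont_cabs.
have [P HP] := real_primitive ck.
have PN := primitive_le_integral ck (fun t => powR_ge0 _ _) HP dkN.
pose c := s / s `^ p.
have c_0 : 0 <= c by rewrite divr_ge0 ?powR_ge0// ltW.
have xh : x <= x + h by rewrite lerDl.
have gd (t : R) : is_derive t 1 (fun t => s * t + c * P t) (s + c * cabs (dk t) `^ p).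
  have d1 : is_derive t 1 (fun u => s * u) s.
    rewrite -[X in is_derive _ _ _ X]mulr1; exact: (@is_deriveZ _ R R id s t 1 1).
  have d2 := @is_deriveZ _ R R P c t 1 (cabs (dk t) `^ p) (HP t).
  exact: is_deriveD d1 d2.
apply: (@le_trans _ _ ((s * (x + h) + c * P (x + h)) - (s * x + c * P x))).
  apply: (@curve_mvi _ k dk (fun t => s * t + c * P t)
    (fun t => s + c * cabs (dk t) `^ p)) => //.
  - by move=> t _; exact: is_rd_cont (kd t).
  - move=> t _; apply: differentiable_continuous; apply/derivable1_diffP.
    by have [] := gd t.
  - by move=> t _; exact: powR_young.
have := PN _ _ xh; rewrite -/c => h2.
have : c * (P (x + h) - P x) <= c * N by rewrite ler_wpM2l.
have : s * h <= s * 1 by rewrite ler_pM2l.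
lra.
Qed.

(* The increments of a primitive over horizontal segments are controlled by the
   L^p norms on horizontal lines; Phragmen-Lindelof transfers the bound from the
   real line to the half-plane. *)
Lemma hardy_pointwise G (eta M t : R) : 0 < eta -> 0 < t ->
  (forall z, - eta < Im z -> cdiff G z) ->
  (forall y, 0 < y -> (\int[mu]_x (cabs (G (x +i* y)) `^ p)%:E <= M%:E)%E) ->
  (\int[mu]_x (cabs (G (x%:C)) `^ p)%:E <= (t `^ p)%:E)%E ->
  forall z, 0 < Im z -> cabs (G z) <= 2 * t + 4 * t / Im z.
Proof.
move=> eta0 t0 dG GM Gt.
(* Clamping the imaginary part at e2 makes G continuous on the plane without changing it above e2.
   Stopping below 0 makes the primitive differentiable on the real line too. *)
pose e2 := - (eta / 2).
have e20 : e2 < 0 by rewrite /e2; lra.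
have ee2 : - eta < e2 by rewrite /e2; lra.
pose cl (w : C) : C := Re w +i* Num.max e2 (Im w).
pose F w := G (cl w).
have ccl w : ccont cl w by apply: (@ccont_ReIm _ id) => //; exact: maxr_lip.
have cF w : ccont F w.
  apply: ccont_comp (ccl w) _; apply/cdiff_cont/dG => /=.
  by rewrite lt_max ee2.
have FG w : e2 <= Im w -> F w = G w.
  by case: w => x y /= h; rewrite /F /cl /= max_r.
have dF w : e2 < Im w -> cdiff F w.
  move=> w2; apply: (@cdiff_near _ G _ _ (Im w - e2)); first by rewrite subr_gt0.
    move=> v vw; rewrite FG//; have := Im_le_cabs (v - w).
    rewrite ImB ler_norml => /andP[? ?]; lra.
  by apply: dG; lra.
pose Gam := primitive_from F 0 0.
have Gamd w : e2 < Im w -> is_cd Gam w (G w).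
  move=> w2; rewrite -FG ?(ltW w2)//.
  apply: (@is_cd_primitive _ F (fun z => e2 < Im z)) => //.
  - by move=> z z2 _; exact: dF.
  - move=> x y u v /= y2 _ /andP[+ _]; apply: lt_le_trans.
    by rewrite lt_min e20.
  - by move=> x y /= y2; exists 1.
have seg y : 0 <= y -> forall (s N : R), 0 < s ->
    (\int[mu]_x (cabs (G (x +i* y)) `^ p)%:E <= N%:E)%E ->
    forall x h, 0 <= h <= 1 ->
    cabs (Gam ((x + h) +i* y) - Gam (x +i* y)) <= s + s / s `^ p * N.
  move=> y0 s N s0 HN x h h01.
  apply: (@segment_bound (fun t => Gam (t +i* y)) (fun t => G (t +i* y))) => //.
  - move=> u; rewrite -[G _]mulr1.
    by apply: is_rd_comp (is_rd_horizontal y u) _; apply: Gamd => /=; lra.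
  - by move=> u; apply: rcont_horizontal; apply: cdiff_cont; apply: dG => /=; lra.
have addE (z : C) (h : R) : z + h%:C = (Re z + h) +i* Im z.
  by case: z => x y; apply/eqP; rewrite eq_complex /= addr0 !eqxx.
have Im_shift z (h : R) : Im (z + h%:C) = Im z by rewrite addE.
pose Phi h z := Gam (z + h%:C) - Gam z.
have Phid h z : 0 <= Im z -> is_cd (Phi h) z (G (z + h%:C) - G z).
  move=> z0; have zs := is_cdD (is_cd_id z) (is_cd_cst (h%:C) z).
  have := is_cd_comp zs (Gamd (z + h%:C) _); rewrite Im_shift addr0 mulr1.
  move=> /(_ (lt_le_trans e20 z0)) d1; apply: is_cdB d1 _.
  by apply: Gamd; exact: lt_le_trans z0.
have Phit h z : 0 <= h <= 1 -> 0 <= Im z -> cabs (Phi h z) <= 2 * t.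
  move=> h01; apply: (@phragmen_lindelof _ _ (1 + M)).
  - by move=> w w0; exact: is_cd_cdiff (Phid h w w0).
  - move=> [u v] w0; rewrite /Phi addE.
    have := seg _ (ltW w0) 1 M ltr01 (GM _ w0) u h h01.
    by rewrite powR1 divr1 mul1r.
  - move=> x; rewrite /Phi addE /=.
    have := seg 0 (lexx 0) t (t `^ p) t0 Gt x h h01.
    by rewrite divfK ?gt_eqF ?powR_gt0// => /le_trans; apply; lra.
move=> z z0.
(* [Phi h] has derivative G (z + h) - G z and is at most 2 t on the square of half-side Im z about
   z, which stays in the closed half-plane. *)
have osc h : 0 <= h <= 1 -> cabs (G (z + h%:C) - G z) <= 4 * t / Im z.
  move=> h01; have sqP w : in_sq z (Im z) w -> 0 <= Im w.
    by move=> /andP[_ /andP[+ _]]; rewrite subrr.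
  have -> : 4 * t = 2 * (2 * t) by ring.
  apply: (@cauchy_estimate _ (Phi h) z (G (z + h%:C) - G z) (Im z) (2 * t) z0).
  - by move=> w /sqP w0; exact: is_cd_cdiff (Phid h w w0).
  - by apply: Phid; exact: ltW.
  - by move=> w /sqP w0; exact: Phit.
have kd s : is_rd (fun s => Gam (z + s%:C) - G z * s%:C) s (G (z + s%:C) - G z).
  apply: is_rdB; last by have := is_rdZ (G z) (is_rd_id s); rewrite mulr1.
  have ds := is_rdD (is_rd_cst z s) (is_rd_id s); rewrite add0r in ds.
  rewrite -[G (z + _)]mulr1; apply: is_rd_comp ds _; apply: Gamd.
  by rewrite Im_shift; apply: lt_trans z0.
(* G z is compared with its average over a horizontal unit segment: [Phi 1 z] - G z is the integral
   of G (z + s) - G z for s in [0, 1]. *)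
have : cabs ((Gam (z + 1%:C) - G z * 1%:C) - (Gam (z + 0%:C) - G z * 0%:C))
     <= 4 * t / Im z * (1 - 0).
  apply: (@curve_lip _ (fun s => Gam (z + s%:C) - G z * s%:C)
    (fun s => G (z + s%:C) - G z)) => //.
  - by move=> s _; exact: is_rd_cont (kd s).
  - by move=> s; rewrite in_itv /= => /andP[/ltW s0 /ltW s1]; apply: osc; rewrite s0.
have := Phit 1 z; rewrite lexx ler01 (ltW z0) => /(_ isT isT).
set a := Phi 1 z.
have -> : Gam (z + 1%:C) - G z * 1%:C - (Gam (z + 0%:C) - G z * 0%:C) = a - G z.
  by rewrite /a /Phi addr0; ring.
have := cabs_lbB (G z) a; rewrite cabs_distC subr0 mulr1; lra.
Qed.

End HardyBound.

(** * The space H^p(E): linear operations, division by a zero, boundary integral *)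

Section Space.
Variable R : realType.
Local Notation C := R[i].
Local Notation mu := (@lebesgue_measure R).
Variable p : R.
Hypothesis p1 : 1 <= p.
Variable E : C -> C.
Hypothesis hbE : hermite_biehler (E : CC R -> CC R).
Hypothesis E0 : forall x : R, E (x%:C) != 0.
Implicit Types (f g h k : C -> C).

Let p0 : 0 < p := lt_le_trans ltr01 p1.

Definition qE g z := cabs (g z / E z).
Definition JE (y : R) g : \bar R := \int[mu]_x (qE g (x +i* y) `^ p)%:E.
Definition bddE g := exists M : R, forall y, 0 < y -> (JE y g <= M%:E)%E.

Lemma qE_ge0 g z : 0 <= qE g z. Proof. exact: cabs_ge0. Qed.

Lemma JE_ge0 y g : (0 <= JE y g)%E.
Proof. by apply: integral_ge0 => x _; rewrite lee_fin powR_ge0. Qed.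

(** Holomorphy of g / E in the upper half-plane is automatic, E having no zeros there; only the
    bounds on horizontal lines remain. *)
Lemma HpEP g : HpE p (E : CC R -> CC R) (g : CC R -> CC R) <->
  [/\ forall z, cdiff g z, bddE g & bddE (sharp (g : CC R -> CC R))].
Proof.
have ptE (x y : R) : x%:C + Num.imaginary * y%:C = x +i* y :> C.
  by rewrite -complexiE; apply/eqP; rewrite eq_complex /= !(mul0r, mulr0, mul1r, subr0, add0r, addr0) !eqxx.
have hardyP k : (forall z, cdiff k z) ->
    hardy p (fun z : CC R => k z / E z) <-> bddE k.
  move=> dk; split.
    case=> _ [M HM]; exists M => y y0; apply: le_trans (HM y y0).
    rewrite /JE le_eqVlt; apply/orP; left; apply/eqP.
    by apply: eq_integral => x _; rewrite /qE ptE.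
  case=> M HM; split.
    move=> z; rewrite Num_Im_gt0 => z0.
    suff [] : cdiff (fun z => k z / E z) z by [].
    apply: (cdiff_div (dk z) (hb_cdiff hbE z)).
    exact: (hb_neq0 hbE E0 (ltW z0)).
  exists M => y y0; apply: le_trans (HM y y0).
  rewrite /JE le_eqVlt; apply/orP; left; apply/eqP.
  by apply: eq_integral => x _; rewrite /qE ptE.
split.
  case=> dg [h1 h2]; have cg z : cdiff g z by split; exact: dg.
  have csg z : cdiff (sharp (g : CC R -> CC R)) z by exact: cdiff_sharp.
  split; [exact: cg|exact: (hardyP g cg).1 h1|exact: (hardyP _ csg).1 h2].
case=> dg b1 b2; split; first by move=> z; case: (dg z).
have csg z : cdiff (sharp (g : CC R -> CC R)) z by exact: cdiff_sharp.
by split; [exact: (hardyP g dg).2 b1|exact: (hardyP _ csg).2 b2].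
Qed.

Lemma continuous_qE g y : 0 <= y -> (forall z, cdiff g z) ->
  continuous (fun x : R => qE g (x +i* y)).
Proof.
move=> y0 dg x; apply: (@rcont_cabs _ (fun x => g (x +i* y) / E (x +i* y))).
apply: (@rcont_horizontal _ (fun z => g z / E z)); apply: cdiff_cont.
by apply: cdiff_div => //; [exact: hb_cdiff|exact: hb_neq0].
Qed.

Lemma continuous_qEp g y : 0 <= y -> (forall z, cdiff g z) ->
  continuous (fun x : R => qE g (x +i* y) `^ p).
Proof.
move=> y0 dg x; apply: continuous_powR_comp => //; first by move=> s; exact: qE_ge0.
exact: continuous_qE.
Qed.

Lemma measurable_qEp g y : 0 <= y -> (forall z, cdiff g z) ->
  measurable_fun [set: R] (fun x : R => qE g (x +i* y) `^ p).
Proof. by move=> y0 dg; apply: continuous_measurable_fun; exact: continuous_qEp. Qed.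

Lemma integral_indic_itv (c a b : R) : a <= b -> 0 <= c ->
  (\int[mu]_x (c * \1_(`[a, b]%classic) x)%:E = (c * (b - a))%:E)%E.
Proof.
move=> ab c0; under eq_integral do rewrite EFinM.
rewrite ge0_integralZl_EFin//; last first.
  by apply/measurable_EFinP; exact: measurable_indic.
rewrite integral_indic//= setIT lebesgue_measure_itv /= lte_fin.
case: ltP => [_|ba]; first by rewrite -EFinD -EFinM.
by have -> : b = a by [lra]; rewrite subrr mulr0 mule0.
Qed.

(** Keeping nonnegative summands on both sides avoids subtracting integrals that might be infinite.
    The constant c stands for a loss confined to a compact interval. *)
Lemma int_dom (u1 u2 v1 v2 : R -> R) (c a b : R) : a <= b -> 0 <= c ->
  measurable_fun [set: R] u1 -> measurable_fun [set: R] u2 ->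
  measurable_fun [set: R] v1 -> measurable_fun [set: R] v2 ->
  (forall x, 0 <= u1 x) -> (forall x, 0 <= u2 x) ->
  (forall x, 0 <= v1 x) -> (forall x, 0 <= v2 x) ->
  (forall x, u1 x + u2 x <= v1 x + v2 x + (if a <= x <= b then c else 0)) ->
  (\int[mu]_x (u1 x)%:E + \int[mu]_x (u2 x)%:E <=
   \int[mu]_x (v1 x)%:E + \int[mu]_x (v2 x)%:E + (c * (b - a))%:E)%E.
Proof.
move=> ab c0 mu1 mu2 mv1 mv2 u10 u20 v10 v20 huv.
have mc : measurable_fun [set: R] (fun x => c * \1_(`[a, b]%classic) x).
  by apply: measurable_funM => //; exact: measurable_indic.
have Ic := integral_indic_itv ab c0.
rewrite -ge0_integralD//=; last 4 first.
- by move=> x _; rewrite lee_fin.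
- exact/measurable_EFinP.
- by move=> x _; rewrite lee_fin.
- exact/measurable_EFinP.
rewrite -Ic -ge0_integralD//=; last 4 first.
- by move=> x _; rewrite lee_fin.
- exact/measurable_EFinP.
- by move=> x _; rewrite lee_fin.
- exact/measurable_EFinP.
rewrite -ge0_integralD//=; last 4 first.
- by move=> x _; rewrite adde_ge0// lee_fin.
- by apply: emeasurable_funD; exact/measurable_EFinP.
- by move=> x _; rewrite lee_fin mulr_ge0.
- exact/measurable_EFinP.
apply: ge0_le_integral => //.
- by move=> x _; rewrite adde_ge0// lee_fin.
- by apply: emeasurable_funD; exact/measurable_EFinP.
- by apply: emeasurable_funD; [apply: emeasurable_funD|]; exact/measurable_EFinP.
move=> x _; rewrite -!EFinD lee_fin; apply: le_trans (huv x) _.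
rewrite lerD2l indicE; case: ifPn => h.
  by rewrite mem_set ?mulr1//= in_itv.
by rewrite mulr_ge0.
Qed.

Lemma int_dom2 (u1 u2 v : R -> R) (c a b : R) : a <= b -> 0 <= c ->
  measurable_fun [set: R] u1 -> measurable_fun [set: R] u2 ->
  measurable_fun [set: R] v -> (forall x, 0 <= u1 x) -> (forall x, 0 <= u2 x) ->
  (forall x, 0 <= v x) ->
  (forall x, u1 x + u2 x <= v x + (if a <= x <= b then c else 0)) ->
  (\int[mu]_x (u1 x)%:E + \int[mu]_x (u2 x)%:E <=
   \int[mu]_x (v x)%:E + (c * (b - a))%:E)%E.
Proof.
move=> ab c0 mu1 mu2 mv u10 u20 v0 uv.
have m0 : measurable_fun [set: R] (fun _ : R => 0 : R) by [].
have := int_dom ab c0 mu1 mu2 mv m0 u10 u20 v0 (fun=> lexx 0).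
by rewrite integral0 adde0; apply=> x; rewrite addr0.
Qed.

Lemma int_dom1 (u v : R -> R) (c a b : R) : a <= b -> 0 <= c ->
  measurable_fun [set: R] u -> measurable_fun [set: R] v ->
  (forall x, 0 <= u x) -> (forall x, 0 <= v x) ->
  (forall x, u x <= v x + (if a <= x <= b then c else 0)) ->
  (\int[mu]_x (u x)%:E <= \int[mu]_x (v x)%:E + (c * (b - a))%:E)%E.
Proof.
move=> ab c0 mu_ mv u0 v0 uv.
have m0 : measurable_fun [set: R] (fun _ : R => 0 : R) by [].
have := int_dom2 ab c0 mu_ m0 mv u0 (fun=> lexx 0) v0.
by rewrite integral0 adde0; apply=> x; rewrite addr0.
Qed.

Lemma powRD_le (a b : R) : 0 <= a -> 0 <= b ->
  (a + b) `^ p <= 2 `^ p * a `^ p + 2 `^ p * b `^ p.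
Proof.
move=> a0 b0; rewrite -!powRM//.
have m (u v : R) : 0 <= u -> 0 <= v -> u <= v -> u `^ p <= v `^ p.
  by move=> ? ? ?; apply: ge0_ler_powR; rewrite ?nnegrE// ltW.
have [ab|ba] := leP a b.
  apply: ler_wpDl; first exact: powR_ge0.
  by apply: m; rewrite ?addr_ge0 ?mulr_ge0//; lra.
apply: ler_wpDr; first exact: powR_ge0.
by apply: m; rewrite ?addr_ge0 ?mulr_ge0//; lra.
Qed.

Lemma bddED g h : (forall z, cdiff g z) -> (forall z, cdiff h z) ->
  bddE g -> bddE h -> bddE (fun z => g z + h z).
Proof.
move=> dg dh [M HM] [N HN]; exists (2 `^ p * M + 2 `^ p * N) => y y0.
have y0' := ltW y0; have c0 : 0 <= 2 `^ p :> R := powR_ge0 _ _.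
have mg := measurable_qEp y0' dg; have mh := measurable_qEp y0' dh.
have mgh := @measurable_qEp (fun z => g z + h z) y y0' (fun z => cdiffD (dg z) (dh z)).
have := @int_dom (fun x => qE (fun z => g z + h z) (x +i* y) `^ p) (fun=> 0)
  (fun x => 2 `^ p * qE g (x +i* y) `^ p) (fun x => 2 `^ p * qE h (x +i* y) `^ p)
  0 0 0 (lexx _) (lexx _).
rewrite integral0 adde0 subrr mulr0 adde0 => H.
apply: le_trans (H _ _ _ _ _ _ _ _ _) _ => //.
- by apply: measurable_funM.
- by apply: measurable_funM.
- by move=> x; exact: powR_ge0.
- by move=> x; rewrite mulr_ge0// powR_ge0.
- by move=> x; rewrite mulr_ge0// powR_ge0.
- move=> x; rewrite if_same !addr0; apply: le_trans (powRD_le (qE_ge0 _ _) (qE_ge0 _ _)).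
  apply: ge0_ler_powR; rewrite ?nnegrE ?addr_ge0 ?qE_ge0 ?(ltW p0)//.
  by rewrite /qE mulrDl cabsD.
have sc k : measurable_fun [set: R] (fun x => qE k (x +i* y) `^ p) ->
    (\int[mu]_x (2 `^ p * qE k (x +i* y) `^ p)%:E = (2 `^ p)%:E * JE y k)%E.
  move=> mk; under eq_integral do rewrite EFinM.
  rewrite ge0_integralZl_EFin//; first by move=> x _; rewrite lee_fin powR_ge0.
  exact/measurable_EFinP.
rewrite !sc// EFinD !EFinM; apply: leeD; apply: lee_wpmul2l; rewrite ?lee_fin//.
  exact: HM.
exact: HN.
Qed.

Lemma bddEZ c g : (forall z, cdiff g z) -> bddE g -> bddE (fun z => c * g z).
Proof.
move=> dg [M HM]; exists (cabs c `^ p * M) => y y0.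
have mg := measurable_qEp (ltW y0) dg.
rewrite /JE (_ : \int[mu]_x _ = (cabs c `^ p)%:E * JE y g)%E.
  by rewrite EFinM; apply: lee_wpmul2l; [rewrite lee_fin powR_ge0|exact: HM].
under eq_integral do rewrite /qE -mulrA cabsM powRM ?cabs_ge0// EFinM.
rewrite ge0_integralZl_EFin//; [|exact/measurable_EFinP|exact: powR_ge0].
by move=> x _; rewrite lee_fin powR_ge0.
Qed.

Lemma HpE_add g h : HpE p (E : CC R -> CC R) g -> HpE p (E : CC R -> CC R) h ->
  HpE p (E : CC R -> CC R) (fun z => g z + h z).
Proof.
move=> /HpEP[dg bg sg] /HpEP[dh bh sh]; apply/HpEP; split.
- by move=> z; exact: cdiffD.
- exact: bddED.
have -> : sharp (fun z => g z + h z) = (fun z => sharp g z + sharp h z).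
  by apply/funext => z; rewrite /sharp rmorphD.
by apply: bddED => // z; exact: cdiff_sharp.
Qed.

Lemma HpE_scale c g : HpE p (E : CC R -> CC R) g ->
  HpE p (E : CC R -> CC R) (fun z => c * g z).
Proof.
move=> /HpEP[dg bg sg]; apply/HpEP; split.
- by move=> z; apply: cdiffM => //; exact: cdiff_cst.
- exact: bddEZ.
have -> : sharp (fun z => c * g z) = (fun z => c^* * sharp g z).
  by apply/funext => z; rewrite /sharp rmorphM.
by apply: bddEZ => // z; exact: cdiff_sharp.
Qed.

(** Where |z - l| >= 1, |k| <= |h|. The other points of the closed upper half-plane lie in a compact
    rectangle of width 2, on which k / E is bounded by K; they add at most 2 K^p on each line. *)
Lemma bddE_div h k l : (forall z, cdiff h z) -> (forall z, cdiff k z) ->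
  (forall z, h z = (z - l) * k z) -> bddE h -> bddE k.
Proof.
move=> dh dk hk [M HM].
have ab : Re l - 1 <= Re l + 1 by lra.
have cd : 0 <= `|Im l| + 1 by rewrite addr_ge0.
have cq z : in_rect (Re l - 1) (Re l + 1) 0 (`|Im l| + 1) z ->
    ccont (fun z => k z / E z) z.
  move=> /andP[_ /andP[z0 _]]; apply: cdiff_cont.
  exact: (cdiff_div (dk z) (hb_cdiff hbE z) (hb_neq0 hbE E0 z0)).
have [zM _ hM] := cabs_max_rect ab cd cq.
pose K := qE k zM; exists (M + K `^ p * 2) => y y0.
have y0' := ltW y0.
have mh := measurable_qEp y0' dh; have mk := measurable_qEp y0' dk.
have H := int_dom1 ab (powR_ge0 K p) mk mh (fun=> powR_ge0 _ _) (fun=> powR_ge0 _ _).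
apply: le_trans (H _) _ => {H} [x|].
  have [hl|hl] := leP 1 (cabs (x +i* y - l)).
    apply: ler_wpDr; first by case: ifP => // _; exact: powR_ge0.
    apply: ge0_ler_powR; rewrite ?nnegrE ?qE_ge0 ?(ltW p0)//.
    by rewrite /qE hk -mulrA [leRHS]cabsM ler_peMl// cabs_ge0.
  have := Re_le_cabs (x +i* y - l); have := Im_le_cabs (x +i* y - l).
  rewrite ReB ImB /= !ler_norml => /andP[h1 h2] /andP[h3 h4].
  have xin : Re l - 1 <= x <= Re l + 1 by apply/andP; split; lra.
  rewrite xin; apply: ler_wpDl; first exact: powR_ge0.
  apply: ge0_ler_powR; rewrite ?nnegrE ?qE_ge0 ?(ltW p0)//.
  apply: hM; rewrite /in_rect /= xin y0' /=.
  by have := ler_norm (Im l); lra.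
rewrite EFinD; apply: leeD; first exact: HM.
by rewrite lee_fin; apply: ler_wpM2l; [exact: powR_ge0|lra].
Qed.

Lemma HpE_div h l : HpE p (E : CC R -> CC R) h -> h l = 0 ->
  exists2 k, HpE p (E : CC R -> CC R) k & forall z, h z = (z - l) * k z.
Proof.
move=> /HpEP[dh bh sh] hl; have [k dk hk] := entire_div dh hl.
exists k; last exact: hk.
have dsh z : cdiff (sharp (h : CC R -> CC R)) z by exact: cdiff_sharp.
have dsk z : cdiff (sharp (k : CC R -> CC R)) z by exact: cdiff_sharp.
have hsk z : sharp (h : CC R -> CC R) z = (z - l^*) * sharp (k : CC R -> CC R) z.
  by rewrite /sharp hk rmorphM rmorphB /= conjcK.
apply/HpEP; split; [exact: dk|exact: (bddE_div dh dk hk)|].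
exact: (bddE_div dsh dsk hsk).
Qed.

(** The Hardy condition only sees heights y > 0; Fatou's lemma along y = 1 / (n + 1) makes the
    integral on the real line finite as well. *)
Lemma JE_fatou g M : (forall z, cdiff g z) ->
  (forall y, 0 < y -> (JE y g <= M%:E)%E) -> (JE 0 g <= M%:E)%E.
Proof.
move=> dg HM.
pose u n x := (qE g (x +i* n.+1%:R^-1) `^ p)%:E.
have ulim x : limn_einf (u ^~ x) = (qE g (x +i* 0) `^ p)%:E.
  suff : u ^~ x @ \oo --> (qE g (x +i* 0) `^ p)%:E.
    by move=> /cvg_limn_einf_sup[].
  apply: cvg_EFin; first by apply: nearW.
  have c0 : {for 0, continuous (fun s : R => qE g (x +i* s) `^ p)}.
    apply: continuous_powR_comp => //; first by move=> s; exact: qE_ge0.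
    apply: (@rcont_cabs _ (fun s => g (x +i* s) / E (x +i* s))).
    apply: (@rcont_vertical _ (fun z => g z / E z)); apply: cdiff_cont.
    exact: (cdiff_div (dg _) (hb_cdiff hbE _) (E0 x)).
  exact: (cvg_comp _ _ (@cvg_harmonic R) c0).
have -> : JE 0 g = (\int[mu]_x limn_einf (u ^~ x))%E.
  by congr integral; apply/funext => x; rewrite ulim.
have mu_ n : measurable_fun [set: R] (u n).
  by apply/measurable_EFinP; exact: measurable_qEp.
have u0 n x : [set: R] x -> (0 <= u n x)%E by rewrite lee_fin powR_ge0.
have H := @fatou _ _ _ mu setT measurableT u mu_ u0.
apply: (le_trans H).
rewrite limn_einf_lim; apply: lime_le; first exact: is_cvg_einfs.
near=> n; apply: le_trans (HM n.+1%:R^-1 _); last by rewrite invr_gt0.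
by apply: ereal_inf_lbound; exists n => //=.
Unshelve. all: by end_near.
Qed.

End Space.

(** * Boundedness of evaluation on the real line *)

Section Evaluation.
Variable R : realType.
Local Notation C := R[i].
Local Notation mu := (@lebesgue_measure R).
Variable p : R.
Hypothesis p1 : 1 <= p.
Variable E : C -> C.
Hypothesis hbE : hermite_biehler (E : CC R -> CC R).
Hypothesis E0 : forall x : R, E (x%:C) != 0.
Hypothesis phaseE : phase_deriv_Linf (E : CC R -> CC R).
Implicit Types (f g h k : C -> C).

Let p0 : 0 < p := lt_le_trans ltr01 p1.

Lemma sharpK g z : sharp (sharp (g : CC R -> CC R)) z = g z.
Proof. by rewrite /sharp !conjcK. Qed.

Lemma sharp_HpE g : HpE p (E : CC R -> CC R) g ->
  HpE p (E : CC R -> CC R) (sharp (g : CC R -> CC R)).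
Proof.
move=> /(HpEP p hbE E0)[dg bg sg]; apply/(HpEP p hbE E0).
have sK : sharp (sharp (g : CC R -> CC R)) = g by apply/funext => z; exact: sharpK.
by rewrite sK; split; [move=> z; exact: cdiff_sharp|exact: sg|exact: bg].
Qed.

Lemma JE0_sharp g : JE p E 0 (sharp (g : CC R -> CC R)) = JE p E 0 g.
Proof.
apply: eq_integral => x _; rewrite /qE /sharp.
have -> : (x +i* 0)^* = x +i* 0 :> C by rewrite /= oppr0.
by rewrite !cabsM cabsJ.
Qed.

(** The comparison |E z| <= 2 |E (conj z)| carries the absence of zeros from the closed upper
    half-plane to a strip below it. *)
Lemma hb_neq0_strip : exists eta : R, [/\ 0 < eta,
  forall z, - eta <= Im z -> E z != 0 &
  forall z, 0 <= Im z <= eta -> cabs (E z) <= 2 * cabs (E (z^*))].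
Proof.
have [eta eta0 hE] := hb_strip hbE E0 phaseE; exists eta; split=> // z zeta.
have [z0|z0] := leP 0 (Im z); first exact: (hb_neq0 hbE E0).
have := hE (z^*); rewrite ImJ conjcK => /(_ _)/wrap[]; first by apply/andP; split; lra.
have : 0 < cabs (E (z^*)) by rewrite cabs_gt0 (hb_neq0 hbE E0)// ImJ; lra.
by rewrite -cabs_gt0; lra.
Qed.

Lemma HpE_upper g (t : R) : HpE p (E : CC R -> CC R) g -> 0 < t ->
  (JE p E 0 g <= (t `^ p)%:E)%E ->
  forall z, 0 < Im z -> qE E g z <= 2 * t + 4 * t / Im z.
Proof.
move=> /(HpEP p hbE E0)[dg [M HM] _] t0 Jg.
have [eta [eta0 Eeta _]] := hb_neq0_strip.
apply: (@hardy_pointwise _ p p1 (fun z => g z / E z) eta M t eta0 t0 _ HM Jg).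
by move=> z z0; apply: (cdiff_div (dg z) (hb_cdiff hbE z)); apply: Eeta; exact: ltW.
Qed.

(** With a vanishing integral, [HpE_upper] holds for every t > 0, so g is 0 in the upper half-plane.
    The lower one follows by [sharp], the real line by continuity. *)
Lemma HpE_eq0 g : HpE p (E : CC R -> CC R) g -> (JE p E 0 g <= 0)%E ->
  forall z, g z = 0.
Proof.
have upper h : HpE p (E : CC R -> CC R) h -> (JE p E 0 h <= 0)%E ->
    forall z, 0 < Im z -> h z = 0.
  move=> Hh Jh z z0; have hq t : 0 < t -> qE E h z <= t * (2 + 4 / Im z).
    move=> t0; have := @HpE_upper h t Hh t0 _ z z0.
    rewrite mulrDr (mulrC t 2) mulrA (mulrC t 4); apply.
    by apply: le_trans Jh _; rewrite lee_fin powR_ge0.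
  apply/eqP; apply: contraT => hz.
  have q0 : 0 < qE E h z.
    by rewrite /qE cabs_gt0 mulf_neq0// invr_eq0 (hb_neq0 hbE E0)// ltW.
  have c0 : 0 < 2 + 4 / Im z by rewrite addr_gt0// divr_gt0.
  have := hq (qE E h z / 2 / (2 + 4 / Im z)); rewrite divfK ?gt_eqF//.
  by rewrite !divr_gt0// => /(_ isT); lra.
move=> Hg Jg z.
have [z0|z0|z0] := ltgtP (Im z) 0; last first.
- have [dg _ _] := (HpEP p hbE E0 g).1 Hg.
  apply/eqP; rewrite -cabs_eq0 eq_le cabs_ge0 andbT leNgt; apply/negP => gz.
  have [d d0 hd] := (ccontP _ _).1 (cdiff_cont (dg z)) _ gz.
  have := hd (z + (0 +i* (d / 2))); rewrite [z + _]addrC addrK.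
  rewrite (upper g Hg Jg); last by rewrite ImD /= z0 addr0 divr_gt0.
  rewrite sub0r cabsN ltxx => /(_ _)/wrap[]//.
  by rewrite /cabs /= expr0n /= add0r sqrtr_sqr gtr0_norm ?divr_gt0//; lra.
- exact: upper.
- have := upper _ (sharp_HpE Hg); rewrite JE0_sharp => /(_ Jg (z^*)).
  rewrite ImJ oppr_gt0 => /(_ z0)/eqP; rewrite /sharp conjcK conjc_eq0.
  by move/eqP.
Qed.

(** On a vertical side one of the factors w - r, w + r equals i y and the other is at most 3 r. On a
    horizontal side |y| = r and |w|^2 + r^2 <= 5 r^2. *)
Lemma square_boundary_le (x0 r x y : R) : 0 < r ->
  x0 - r <= x <= x0 + r -> - r <= y <= r ->
  ~~ ((x0 - r < x < x0 + r) && (- r < y < r)) ->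
  cabs ((x +i* y - x0%:C) ^+ 2 - (r%:C) ^+ 2) <= 5 * r * `|y|.
Proof.
move=> r0 /andP[x1 x2] /andP[y1 y2] zo.
set w := x +i* y - x0%:C.
have wE : w = (x - x0) +i* y.
  by apply/eqP; rewrite eq_complex /= subr0 !eqxx.
have w2 : cabs w <= 2 * r.
  apply: le_trans (cabs_le_ReIm _) _; rewrite wE /=.
  have : `|x - x0| <= r by rewrite ler_distl; apply/andP; split; lra.
  have : `|y| <= r by rewrite ler_norml; apply/andP; split; lra.
  lra.
have nr : cabs (r%:C : C) = r by rewrite cabsR gtr0_norm.
have niy : cabs (0 +i* y : C) = `|y| by rewrite /cabs /= expr0n /= add0r sqrtr_sqr.
have fac : w ^+ 2 - r%:C ^+ 2 = (w - r%:C) * (w + r%:C) by ring.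
have y00 : 0 <= `|y| by [].
move: zo; rewrite !negb_and -!leNgt => /orP[/orP[]|/orP[]] hz.
- have E1 : w + r%:C = 0 +i* y.
    by rewrite wE; apply/eqP; rewrite eq_complex /= addr0 eqxx andbT; apply/eqP; lra.
  rewrite fac E1 cabsM niy ler_wpM2r//.
  by apply: le_trans (cabsB _ _) _; rewrite nr; lra.
- have E1 : w - r%:C = 0 +i* y.
    by rewrite wE; apply/eqP; rewrite eq_complex /= subr0 eqxx andbT; apply/eqP; lra.
  rewrite fac E1 cabsM niy mulrC ler_wpM2r//.
  by apply: le_trans (cabsD _ _) _; rewrite nr; lra.
- have -> : `|y| = r by rewrite ler0_norm; lra.
  by apply: le_trans (cabsB _ _) _; rewrite !cabsX nr; have := cabs_ge0 w; nra.
- have -> : `|y| = r by rewrite ger0_norm; lra.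
  by apply: le_trans (cabsB _ _) _; rewrite !cabsX nr; have := cabs_ge0 w; nra.
Qed.

(* The zeros of (z - x0)^2 - r^2 at the corners of the contour on the real line
   absorb the singularity 1 / |Im z| of the bound on the half-planes. *)
Lemma evaluation_bound : exists2 K : R, 0 < K & forall g t,
  HpE p (E : CC R -> CC R) g -> 0 < t -> (JE p E 0 g <= (t `^ p)%:E)%E ->
  forall x0 : R, qE E g (x0%:C) <= K * t.
Proof.
have [eta [eta0 Eeta hE]] := hb_neq0_strip.
pose r := Num.min eta 1.
have r0 : 0 < r by rewrite lt_min eta0 ltr01.
have r1 : r <= 1 by rewrite ge_min lexx orbT.
have reta : r <= eta by rewrite ge_min lexx.
(* On the boundary |G| <= 12 t / |y| meets the factor 5 r |y|, giving 60 r t; at the centre the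
   factor is r^2. The 12 is 6 from each half-plane, doubled below the real line by the comparison of
   E z with E (conj z). *)
exists (60 / r); first by rewrite divr_gt0.
move=> g t Hg t0 Jg x0.
have [dg _ _] := (HpEP p hbE E0 g).1 Hg.
pose G z := g z / E z.
have dG z : - eta <= Im z -> cdiff G z.
  by move=> z0; apply: (cdiff_div (dg z) (hb_cdiff hbE z)); exact: Eeta.
have six y : 0 < y -> y <= 1 -> 2 * t + 4 * t / y <= 6 * t / y.
  move=> y0 y1; have : t <= t / y by rewrite ler_pdivlMr// ler_piMr// ltW.
  have -> : 4 * t / y = 4 * (t / y) by ring.
  have -> : 6 * t / y = 6 * (t / y) by ring.
  lra.
have Gup z : 0 < Im z <= r -> cabs (G z) <= 6 * t / Im z.
  by move=> /andP[z0 zr]; apply: le_trans (HpE_upper Hg t0 Jg z0) (six _ z0 _); lra.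
have Gdn z : - r <= Im z < 0 -> cabs (G z) <= 12 * t / `|Im z|.
  move=> /andP[zr z0]; rewrite ltr0_norm//.
  have J' : (JE p E 0 (sharp (g : CC R -> CC R)) <= (t `^ p)%:E)%E by rewrite JE0_sharp.
  have zc0 : 0 < Im (z^*) by rewrite ImJ; lra.
  have h1 := HpE_upper (sharp_HpE Hg) t0 J' zc0.
  have h2 := le_trans h1 (six _ zc0 _); move: h2; rewrite ImJ => h2.
  have {}h2 : qE E (sharp (g : CC R -> CC R)) (z^*) <= 6 * t / (- Im z) by apply: h2; lra.
  have Ez : 0 < cabs (E z) by rewrite cabs_gt0 Eeta//; lra.
  have Ezc : 0 < cabs (E (z^*)) by rewrite cabs_gt0 (hb_neq0 hbE E0)// ltW.
  have := hE (z^*); rewrite ImJ conjcK => /(_ _)/wrap[]; first by apply/andP; split; lra.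
  move=> hEz; rewrite /G cabsM cabsV ler_pdivrMr//.
  move: h2; rewrite /qE /sharp conjcK cabsM cabsV cabsJ ler_pdivrMr// => h2.
  apply: le_trans h2 _.
  have -> : 12 * t / - Im z * cabs (E z) = 6 * t / - Im z * (2 * cabs (E z)) by ring.
  by rewrite ler_wpM2l// divr_ge0 ?mulr_ge0// ltW//; lra.
pose H z := G z * ((z - x0%:C) ^+ 2 - (r%:C) ^+ 2).
have dH z : - eta <= Im z -> cdiff H z.
  move=> z0; apply: cdiffM; first exact: dG.
  apply: cdiffB; last exact: cdiff_cst.
  by apply: cdiffX; apply: (cdiffB (cdiff_id z) (cdiff_cst _ z)).
have ab : Re (x0%:C : C) - r <= Re (x0%:C : C) + r by rewrite /=; lra.
have cd : Im (x0%:C : C) - r <= Im (x0%:C : C) + r by rewrite /=; lra.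
have : cabs (H (x0%:C)) <= 60 * r * t.
  apply: (max_mod_rect ab cd) => /=.
  - by move=> z /andP[_ /andP[+ _]] => h; apply/cdiff_cont/dH; move: h; rewrite /=; lra.
  - by move=> z /andP[_ /andP[+ _]] => h; apply/dH; move: h; rewrite /=; lra.
  - move=> [x y] /andP[/andP[x1 x2] /andP[y1 y2]]; simpl in *.
    rewrite /in_orect /= !sub0r !add0r => zo.
    have nP : cabs ((x +i* y - x0%:C) ^+ 2 - (r%:C) ^+ 2) <= 5 * r * `|y|.
      have y1' : - r <= y by rewrite -[- r]sub0r.
      have y2' : y <= r by rewrite -[r]add0r.
      by apply: square_boundary_le r0 _ _ zo; apply/andP.
    have [y0|y0] := eqVneq y 0.
      rewrite /H cabsM; apply: (@le_trans _ _ 0); last by rewrite !mulr_ge0// ltW.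
      have : cabs ((x +i* y - x0%:C) ^+ 2 - (r%:C) ^+ 2) <= 0.
        by move: nP; rewrite y0 normr0 mulr0.
      by move=> h; rewrite mulr_ge0_le0// cabs_ge0.
    have ny0 : 0 < `|y| by rewrite normr_gt0.
    have nG : cabs (G (x +i* y)) <= 12 * t / `|y|.
      have [yp|yn] := ltP 0 y.
        apply: le_trans (Gup (x +i* y) _) _; first by rewrite /= yp; lra.
        by rewrite /= gtr0_norm// ler_pM2r ?invr_gt0// ler_pM2r//; lra.
      by apply: (Gdn (x +i* y)) => /=; rewrite lt_neqAle y0 yn andbT; lra.
    rewrite /H cabsM.
    have -> : 60 * r * t = 12 * t / `|y| * (5 * r * `|y|) by field; rewrite gt_eqF.
    by apply: ler_pM => //; exact: cabs_ge0.
  - by rewrite /in_rect /=; apply/andP; split; apply/andP; split; lra.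
rewrite /H subrr expr0n /= sub0r cabsM cabsN cabsX cabsR gtr0_norm// /qE -/(G _).
have r2 : 0 < r ^+ 2 by rewrite exprn_gt0.
rewrite -ler_pdivlMr// => h; apply: le_trans h _.
by rewrite le_eqVlt; apply/orP; left; apply/eqP; field; rewrite gt_eqF.
Qed.

End Evaluation.

(** * Size of the weight (x - x0)^2 / ((x - a)(x - b)) near a and away from a *)

Section Weight.
Variable R : realType.

Lemma absorb_lt (u v w y : R) : u <= v -> 0 < w -> y <= w / 2 ->
  v + w <= u + y -> False.
Proof. lra. Qed.

(** The left side is at most 3/2 eta^2, while |x - x0| >= 3/4 D makes the scaled square at least
    9/64 eta^2; the ratio 32/3 is rounded up to 11. *)
Lemma weight_near (x a b x0 eta D : R) : 0 < eta -> `|b - a| <= eta / 2 ->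
  `|a - x0| = D -> eta <= D / 4 -> `|x - a| <= eta ->
  `|x - a| * `|x - b| <= 11 * (eta ^+ 2 / (4 * D ^+ 2) * `|x - x0| ^+ 2).
Proof.
move=> eta0 ba DE etaD xa; have D0 : 0 < D by lra.
have s0 : 0 < eta ^+ 2 / (4 * D ^+ 2).
  by rewrite divr_gt0 ?exprn_gt0// mulr_gt0// exprn_gt0.
have xb : `|x - b| <= 3 / 2 * eta.
  by have := ler_distD a x b; rewrite (distrC a b); lra.
have xx0 : 3 / 4 * D <= `|x - x0|.
  by have := ler_distD x a x0; rewrite (distrC a x) DE; lra.
have e1 : `|x - a| * `|x - b| <= eta * (3 / 2 * eta) by apply: ler_pM.
have e2 : (3 / 4 * D) ^+ 2 <= `|x - x0| ^+ 2.
  by apply: lerXn2r => //; rewrite nnegrE; lra.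
have := e2; rewrite -(ler_pM2l s0) => e3.
have e4 : eta ^+ 2 / (4 * D ^+ 2) * (3 / 4 * D) ^+ 2 = 9 / 64 * eta ^+ 2.
  by field; rewrite gt_eqF.
have e5 : 0 <= eta ^+ 2 := sqr_ge0 _.
have e6 : eta * (3 / 2 * eta) = 3 / 2 * eta ^+ 2 by ring.
lra.
Qed.

(** With X = |x - a| > eta, the product is at least X^2 / 2, and |x - x0| <= D + X <= 5/4 (D / eta)
    X. The scale eta^2 / (4 D^2) is chosen so that its multiple of the square is at most 25/64 X^2,
    below X^2 / 2. *)
Lemma weight_far (x a b x0 eta D : R) : 0 < eta -> `|b - a| <= eta / 2 ->
  `|a - x0| = D -> eta <= D / 4 -> eta < `|x - a| -> 0 < (x - a) * (x - b) /\
  eta ^+ 2 / (4 * D ^+ 2) * (x - x0) ^+ 2 <= (x - a) * (x - b).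
Proof.
move=> eta0 ba DE etaD; set X := `|x - a|; set P := _ * (x - b) => xa.
have D0 : 0 < D by lra.
have X0 : 0 < X by lra.
have PX : X ^+ 2 / 2 <= P.
  have -> : P = X ^+ 2 - (x - a) * (b - a).
    by rewrite /X real_normK ?num_real// /P; ring.
  have : (x - a) * (b - a) <= X * `|b - a|.
    by rewrite -normrM; exact: ler_norm.
  have : X * `|b - a| <= X * (X / 2) by rewrite ler_pM2l//; lra.
  have -> : X * (X / 2) = X ^+ 2 / 2 by ring.
  lra.
have X20 : 0 < X ^+ 2 by rewrite exprn_gt0.
split; first lra.
have s0 : 0 < eta ^+ 2 / (4 * D ^+ 2).
  by rewrite divr_gt0 ?exprn_gt0// mulr_gt0// exprn_gt0.
have e1 : `|x - x0| <= 5 / 4 * (D / eta) * X.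
  have h3 := ler_distD a x x0; rewrite -/X DE in h3.
  have h4 : D <= D / eta * X by rewrite mulrAC ler_pdivlMr// ler_pM2l// ltW.
  have h5 : X <= D / eta / 4 * X.
    by rewrite ler_pMl// ler_pdivlMr// mul1r ler_pdivlMr//; lra.
  have -> : 5 / 4 * (D / eta) * X = D / eta * X + D / eta / 4 * X.
    by field; rewrite gt_eqF.
  lra.
have e2 : `|x - x0| ^+ 2 <= (5 / 4 * (D / eta) * X) ^+ 2.
  by apply: lerXn2r => //; rewrite nnegrE; apply: le_trans e1.
have := e2; rewrite -(ler_pM2l s0) => e3.
have e4 : eta ^+ 2 / (4 * D ^+ 2) * (5 / 4 * (D / eta) * X) ^+ 2 = 25 / 64 * X ^+ 2.
  by field; rewrite !gt_eqF.
by rewrite -[(x - x0) ^+ 2]real_normK ?num_real//; lra.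
Qed.

End Weight.

(** * Zeros of extremal functions *)

Section Extremal.
Variable R : realType.
Local Notation C := R[i].
Local Notation mu := (@lebesgue_measure R).
Variable p : R.
Hypothesis p1 : 1 <= p.
Variable E : C -> C.
Hypothesis hbE : hermite_biehler (E : CC R -> CC R).
Hypothesis E0 : forall x : R, E (x%:C) != 0.
Hypothesis phaseE : phase_deriv_Linf (E : CC R -> CC R).
Variables (xi : R) (f : C -> C).
Hypothesis Hf : HpE p (E : CC R -> CC R) f.
Hypothesis f_neq0 : exists z, f z != 0.
Hypothesis f_extremal : ((cabs (f (xi%:C) / E (xi%:C)))%:E
  = Cbest p (E : CC R -> CC R) xi * normpE p (E : CC R -> CC R) f)%E.
Implicit Types (g h k : C -> C).

Let p0 : 0 < p := lt_le_trans ltr01 p1.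
Local Notation Hp g := (HpE p (E : CC R -> CC R) g).
Local Notation q := (qE E).
Local Notation J := (JE p E 0).

(** A strict inequality at one point leaves, by continuity, a gap c on an interval; since the
    integral of v is finite, the two integrals would differ. *)
Lemma int_strict (u v : R -> R) : continuous u -> continuous v ->
  (forall x, 0 <= u x) -> (forall x, u x <= v x) ->
  (\int[mu]_x (v x)%:E < +oo)%E ->
  (\int[mu]_x (v x)%:E <= \int[mu]_x (u x)%:E)%E -> u = v.
Proof.
move=> cu cv u0 uv vfin vu; apply/funext => x1; apply/eqP; rewrite eq_le uv /=.
rewrite leNgt; apply/negP => ux.
pose c := (v x1 - u x1) / 2; have c0 : 0 < c by rewrite /c; lra.
have cvu : {for x1, continuous (fun x => v x - u x)}.
  by apply: continuousB; [exact: cv|exact: cu].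
have [d d0 hd] := (real_contP _ x1).1 cvu c c0.
pose a := x1 - d / 2; pose b := x1 + d / 2.
have ab : a <= b by rewrite /a /b; lra.
have mu_ : measurable_fun [set: R] u by exact: continuous_measurable_fun.
have mv : measurable_fun [set: R] v by exact: continuous_measurable_fun.
have mi : measurable_fun [set: R] (fun x => c * \1_(`[a, b]%classic) x).
  by apply: measurable_funM => //; exact: measurable_indic.
have i0 x : 0 <= c * \1_(`[a, b]%classic) x :> R by rewrite mulr_ge0// ltW.
have := int_dom2 ab (lexx 0) mu_ mi mv u0 i0 (fun x => le_trans (u0 x) (uv x)).
rewrite mul0r adde0 (integral_indic_itv ab (ltW c0)) => H.
have {}H : (\int[mu]_x (u x)%:E + (c * (b - a))%:E <= \int[mu]_x (v x)%:E)%E.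
  apply: H => x; rewrite if_same addr0 indicE; case: (boolP (x \in _)) => xi_.
    move: xi_; rewrite inE /= in_itv /= mulr1 => /andP[h1 h2].
    have /hd : `|x - x1| < d.
      by move: h1 h2; rewrite /a /b ltr_norml => h1 h2; apply/andP; split; lra.
    by rewrite ltr_norml /c => /andP[h3 _]; lra.
  by rewrite mulr0 addr0.
have : (\int[mu]_x (v x)%:E + (c * (b - a))%:E <= \int[mu]_x (v x)%:E)%E.
  by apply: le_trans H; exact: leeD2r.
have : (0 <= \int[mu]_x (v x)%:E)%E.
  by apply: integral_ge0 => x _; rewrite lee_fin (le_trans (u0 x)).
move: vfin; case: (\int[mu]_x _)%E => // s _ _.
rewrite -EFinD lee_fin; have : 0 < c * (b - a) by rewrite mulr_gt0// /a /b; lra.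
lra.
Qed.

Definition jE g : R := fine (J g).

Lemma jEE g : Hp g -> J g = (jE g)%:E.
Proof.
move=> /(HpEP p hbE E0)[dg [M HM] _]; rewrite /jE fineK// ge0_fin_numE ?JE_ge0//.
by apply: le_lt_trans (JE_fatou p1 hbE E0 dg HM) _; exact: ltry.
Qed.

Lemma jE_ge0 g : 0 <= jE g.
Proof. by rewrite fine_ge0// JE_ge0. Qed.

Lemma normpE_jE g : Hp g -> normpE p (E : CC R -> CC R) g = (jE g `^ p^-1)%:E.
Proof.
move=> Hg; rewrite -poweR_EFin -(jEE Hg) /normpE unlock /JE.
have -> // : (fun x : R => `|(cabs (g (x%:C) / E (x%:C)))%:E| `^ p)%E =
  (fun x : R => (q g (x +i* 0) `^ p)%:E).
by apply/funext => x; rewrite /= ger0_norm ?cabs_ge0.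
Qed.

Lemma jE_gt0 g : Hp g -> (exists z, g z != 0) -> 0 < jE g.
Proof.
move=> Hg [z gz]; rewrite lt_neqAle jE_ge0 andbT; apply: contraNneq gz => j0.
by rewrite (HpE_eq0 p1 hbE E0 phaseE Hg)// jEE// -j0.
Qed.

(** The best constant is finite: otherwise the right side of the extremal equality would be +oo, the
    norm of f being positive. Its own inequality follows by taking the infimum of admissible
    constants. *)
Lemma best_constant : exists2 r : R, 0 <= r &
  q f (xi%:C) = r * jE f `^ p^-1 /\ forall g, Hp g -> q g (xi%:C) <= r * jE g `^ p^-1.
Proof.
have nf : 0 < jE f `^ p^-1 by rewrite powR_gt0// jE_gt0.
move: f_extremal; rewrite normpE_jE// /Cbest; set S := [set _ | _ in _].
have S0 : lbound S 0%E by move=> _ [c [c0 _] <-]; rewrite lee_fin.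
have iS : (0 <= ereal_inf S)%E by exact: le_ereal_inf_tmp.
case E1 : (ereal_inf S) iS => [r| |] // r0; last first.
  by rewrite mulyr gtr0_sg// mul1e.
rewrite -EFinM => -[fE]; exists r; first by rewrite -lee_fin.
split=> // g Hg; set n := jE g `^ p^-1.
have n0 : 0 <= n := powR_ge0 _ _.
have hS c : S c%:E -> q g (xi%:C) <= c * n.
  by move=> [c' [c'0 hc'] [<-]]; have := hc' g Hg; rewrite normpE_jE// -EFinM lee_fin.
(* For a g of norm 0 division by the norm is impossible; any admissible constant, such as one below
   r + 1, already gives the bound 0. *)
have [n00|nn0] := eqVneq n 0.
  have [_ [c hc <-] _] : exists2 x, S x & (x < (r + 1)%:E)%E.
    by apply: ereal_inf_lt; rewrite E1 lte_fin ltrDl.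
  rewrite n00 mulr0; have := hS c; rewrite n00 mulr0; apply.
  by exists c.
have np : 0 < n by rewrite lt_neqAle eq_sym nn0.
rewrite -ler_pdivrMr// -lee_fin -E1; apply: le_ereal_inf_tmp => _ [c hc <-].
by rewrite lee_fin ler_pdivrMr//; apply: hS; exists c.
Qed.

(** Otherwise the best constant is 0 and every element of H^p(E) vanishes at xi. Division by z - xi
    stays in the space, so f would have a zero of infinite order, and the maximum principle would
    force f = 0. *)
Lemma f_xi_neq0 : f (xi%:C) != 0.
Proof.
apply/negP => /eqP fx0; have [r r0 [fE rE]] := best_constant.
have nf : 0 < jE f `^ p^-1 by rewrite powR_gt0// jE_gt0.
have rz : r = 0.
  move: fE; rewrite /qE fx0 mul0r cabs0 => /esym/eqP.
  by rewrite mulf_eq0 (gt_eqF nf) orbF => /eqP.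
have van g : Hp g -> g (xi%:C) = 0.
  move=> /rE; rewrite rz mul0r /qE => h; apply/eqP.
  have : cabs (g (xi%:C) / E (xi%:C)) == 0 by rewrite eq_le h cabs_ge0.
  by rewrite cabs_eq0 mulf_eq0 invr_eq0 (negbTE (E0 xi)) orbF.
have divn n : exists2 k, Hp k & forall z, f z = (z - xi%:C) ^+ n * k z.
  elim: n => [|n [k Hk fk]]; first by exists f => // z; rewrite expr0 mul1r.
  have [k' Hk' kk'] := HpE_div p1 hbE E0 Hk (van k Hk).
  by exists k' => // z; rewrite fk kk' exprSr mulrA.
have [z fz] := f_neq0.
(* More than twice the distance from xi to z, so each division by z - xi gains a factor 2 in the
   bound for |f z|. *)
pose rho := 2 * (cabs (z - xi%:C) + 1).
have zx := cabs_ge0 (z - xi%:C).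
have rho0 : 0 < rho by rewrite /rho; lra.
have ab : Re (xi%:C : C) - rho <= Re (xi%:C : C) + rho by lra.
have cd : Im (xi%:C : C) - rho <= Im (xi%:C : C) + rho by lra.
have [df _ _] := (HpEP p hbE E0 f).1 Hf.
have [zM _ hM] := cabs_max_rect ab cd (fun w _ => cdiff_cont (df w)).
set K := cabs (f zM) in hM.
have zin : in_sq (xi%:C) rho z by apply: in_sq_cabs; rewrite /rho; lra.
have fzn n : cabs (f z) * 2 ^+ n <= K.
  have [k /(HpEP p hbE E0)[dk _ _] fk] := divn n.
  have kz : cabs (k z) <= K / rho ^+ n.
    apply: (max_mod_rect ab cd (fun w _ => cdiff_cont (dk w)) (fun w _ => dk w)) => //.
    move=> w win /in_osqN rw; rewrite ler_pdivlMr ?exprn_gt0//.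
    have := hM _ win; rewrite fk cabsM cabsX mulrC; apply: le_trans.
    by rewrite ler_wpM2l ?cabs_ge0// lerXn2r ?nnegrE// ?cabs_ge0// ltW.
  rewrite ler_pdivlMr ?exprn_gt0// in kz.
  have -> : cabs (f z) * 2 ^+ n = cabs (k z) * (cabs (z - xi%:C) * 2) ^+ n.
    by rewrite fk cabsM cabsX exprMn; ring.
  apply: le_trans kz; rewrite ler_wpM2l ?cabs_ge0//.
  apply: lerXn2r; rewrite ?nnegrE; [lra|lra|rewrite /rho; lra].
have fz0 : 0 < cabs (f z) by rewrite cabs_gt0.
have [n hn] := @bernoulli_unbounded R 2 (K / cabs (f z)) (ltr1n R 2).
have := fzn n.+1; rewrite ltr_pdivrMr// in hn; lra.
Qed.

Lemma jE_min g : Hp g -> q g (xi%:C) = q f (xi%:C) -> jE f <= jE g.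
Proof.
move=> Hg gf; have [r r0 [fE rE]] := best_constant.
have qf : 0 < q f (xi%:C) by rewrite /qE cabs_gt0 mulf_neq0 ?f_xi_neq0// invr_eq0.
have rp : 0 < r.
  by rewrite lt_neqAle r0 andbT; apply: contraTneq qf => h; rewrite fE -h mul0r ltxx.
have := rE g Hg; rewrite gf fE (ler_pM2l rp) => h.
rewrite leNgt; apply/negP => jj.
have ip : 0 < p^-1 by rewrite invr_gt0; exact: p0.
have jg : jE g \in Num.nneg by rewrite nnegrE; exact: jE_ge0.
have jf : jE f \in Num.nneg by rewrite nnegrE; exact: jE_ge0.
by have := gt0_ltr_powR ip jg jf jj; rewrite ltNge h.
Qed.

Lemma f_neq0_near : exists2 d : R, 0 < d &
  forall z, cabs (z - xi%:C) < d -> f z != 0.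
Proof.
have [df _ _] := (HpEP p hbE E0 f).1 Hf.
have f0 : 0 < cabs (f (xi%:C)) by rewrite cabs_gt0 f_xi_neq0.
have [d d0 hd] := (ccontP _ _).1 (cdiff_cont (df (xi%:C))) _ f0.
exists d; first exact: d0.
move=> z /hd; apply: contraTneq => ->.
by rewrite sub0r cabsN ltxx.
Qed.

Lemma cabsRB (x y : R) : cabs (x%:C - y%:C) = `|x - y|.
Proof. by rewrite -cabsR rmorphB. Qed.

Lemma exists_real_neq : exists2 x1 : R, x1 != xi & f (x1%:C) != 0.
Proof.
have [d d0 hd] := f_neq0_near; exists (xi + d / 2).
  by rewrite -subr_eq0 [xi + _]addrC addrK gt_eqF// divr_gt0.
apply: hd; rewrite cabsRB [xi + _]addrC addrK gtr0_norm ?divr_gt0//; lra.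
Qed.

(* Replacing 1 - (z - xi) / (l - xi) by the real part (on the real line) of
   this factor keeps the value at xi and decreases |f| on the real line. *)
Lemma zeros_real l : f l = 0 -> Im l = 0.
Proof.
move=> fl; apply/eqP; apply: contraT => Iml.
have [f1 Hf1 ff1] := HpE_div p1 hbE E0 Hf fl.
pose el := l - xi%:C.
have el0 : el != 0.
  by apply: contra Iml => /eqP e0; have := congr1 (@complex.Im R) e0; rewrite ImB /= subr0 => ->.
pose ka := Re el^-1.
(* Partial fractions of (1 - ka (z - xi)) / (1 - (z - xi) / el): they present g as a combination of
   f / (z - l) and f, so membership in H^p(E) is immediate. *)
pose c1 := - el * (1 - ka%:C * el); pose c2 := el * ka%:C.
pose g z := c1 * f1 z + c2 * f z.
have Hg : Hp g.
  by apply: (HpE_add p1 hbE E0); exact: (HpE_scale p1 hbE E0).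
have gE z : g z * (z - l) = - el * (1 - ka%:C * (z - xi%:C)) * f z.
  by rewrite /g /c1 /c2 ff1 /el; ring.
have gxi : g (xi%:C) = f (xi%:C).
  apply: (mulIf (x := xi%:C - l)); first by rewrite -opprB oppr_eq0.
  by rewrite gE /el; ring.
have jfg : jE f <= jE g by apply: jE_min => //; rewrite /qE gxi.
have Im_inv : Im el^-1 != 0.
  have : Im el != 0 by rewrite /el ImB /= subr0.
  case: (el) el0 => u v /= uv v0.
  by rewrite oppr_eq0 mulf_eq0 (negbTE v0) /= invr_eq0 paddr_eq0 ?sqr_ge0// !sqrf_eq0 negb_and v0 orbT.
have rel x : cabs (g (x%:C)) * cabs (1 - (x - xi)%:C * el^-1) =
    `|1 - ka * (x - xi)| * cabs (f (x%:C)).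
  have e1 : x%:C - l = - el * (1 - (x - xi)%:C * el^-1).
    by rewrite mulrBr mulr1 mulrCA mulNr mulfV// /el [(x - xi)%:C]rmorphB /=; ring.
  have := gE (x%:C); rewrite e1 mulrCA -!mulrA => /(mulfI _) h.
  rewrite -(cabsR (1 - ka * (x - xi))) -!cabsM; congr cabs.
  have -> : (1 - ka * (x - xi))%:C = 1 - ka%:C * (x%:C - xi%:C) :> C.
    by rewrite !rmorphB rmorphM rmorphB.
  by rewrite h// oppr_eq0.
have key x : `|1 - ka * (x - xi)| <= cabs (1 - (x - xi)%:C * el^-1) /\
    (x != xi -> `|1 - ka * (x - xi)| < cabs (1 - (x - xi)%:C * el^-1)).
  set m := cabs _.
  have m2 : m ^+ 2 = (1 - ka * (x - xi)) ^+ 2 + ((x - xi) * Im el^-1) ^+ 2.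
    rewrite /m cabs_sq ReB ImB /ka; case: (el^-1) => u v /=.
    by ring.
  have m0 : 0 <= m := cabs_ge0 _.
  split.
    by rewrite -(ler_pXn2r (n := 2)) ?nnegrE// m2 real_normK ?num_real// lerDl sqr_ge0.
  move=> xxi; rewrite -(ltr_pXn2r (n := 2)) ?nnegrE// m2 real_normK ?num_real//.
  by rewrite ltrDl exprn_even_gt0//= mulf_neq0// subr_eq0.
have [x1 x1xi fx1] := exists_real_neq.
have mpos x : 0 < cabs (1 - (x - xi)%:C * el^-1).
  have [h1 h2] := key x; have [->|xx] := eqVneq x xi.
    by rewrite subrr mul0r subr0 cabs1.
  by apply: le_lt_trans (h2 xx).
have gle x : cabs (g (x%:C)) <= cabs (f (x%:C)).
  rewrite -(ler_pM2r (mpos x)) rel [leRHS]mulrC ler_wpM2r ?cabs_ge0//.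
  exact: (key x).1.
have glt : cabs (g (x1%:C)) < cabs (f (x1%:C)).
  rewrite -(ltr_pM2r (mpos x1)) rel [ltRHS]mulrC ltr_pM2r ?cabs_gt0//.
  exact: (key x1).2.
have [dg _ _] := (HpEP p hbE E0 g).1 Hg; have [df _ _] := (HpEP p hbE E0 f).1 Hf.
have mono u v : 0 <= u -> 0 <= v -> u <= v -> u `^ p <= v `^ p.
  by move=> ? ? ?; apply: ge0_ler_powR; rewrite ?nnegrE// ltW.
have qle x : q g (x +i* 0) <= q f (x +i* 0).
  by rewrite /qE !cabsM ler_wpM2r ?cabs_ge0//; exact: gle.
have := @int_strict (fun x => q g (x +i* 0) `^ p) (fun x => q f (x +i* 0) `^ p)
  (continuous_qEp p1 hbE E0 (lexx 0) dg) (continuous_qEp p1 hbE E0 (lexx 0) df).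
have fin : (J f < +oo)%E by rewrite (jEE Hf) ltry.
have le : (J f <= J g)%E by rewrite (jEE Hf) (jEE Hg) lee_fin.
move=> /(_ _ _ fin le) H.
have /(congr1 (fun u => u x1)) /= := H (fun x => powR_ge0 _ _) (fun x => mono _ _ (qE_ge0 _ _ _) (qE_ge0 _ _ _) (qle x)).
have qlt : q g (x1 +i* 0) < q f (x1 +i* 0).
  rewrite /qE !cabsM ltr_pM2r; first exact: glt.
  by rewrite cabs_gt0 invr_eq0; exact: E0.
have ng k : q k (x1 +i* 0) \in Num.nneg by rewrite nnegrE; exact: qE_ge0.
by have := gt0_ltr_powR p0 (ng g) (ng f) qlt => /= h1 h2; rewrite h2 ltxx in h1.
Qed.

(** For p >= 1, v^p <= v on [0, 1]. With u = G / f this says that subtracting G lowers |f|^p by at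
    least |G|^p. *)
Lemma powR_sub_le (u : R) : 0 <= u <= 1 -> (1 - u) `^ p + u `^ p <= 1.
Proof.
have le v : 0 <= v <= 1 -> v `^ p <= v.
  move=> /andP[v0 v1]; have [->|vn] := eqVneq v 0; first by rewrite powR0 ?gt_eqF.
  by apply: ge1r_powR => //; rewrite lt_neqAle eq_sym vn v0.
move=> u01; have := le u u01; have := le (1 - u).
have -> : 0 <= 1 - u <= 1 by move: u01 => /andP[? ?]; apply/andP; split; lra.
move=> /(_ isT); lra.
Qed.

(* For real zeros a, b with b - a small, put w = (z - xi)^2 / ((z - a)(z - b)) and
   take s with s w <= 1 away from a.  The competitor f (1 - s w) gains
   |s w f|^p there, and loses only a small multiple of the integral of |s w f|^p
   near a, by the evaluation bound. *)
Lemma real_zeros_separated : exists2 eta : R, 0 < eta &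
  forall a b : R, f (a%:C) = 0 -> f (b%:C) = 0 -> a != b -> eta / 2 < `|b - a|.
Proof.
have [K K0 hK] := evaluation_bound p1 hbE E0 phaseE.
have [d d0 hd] := f_neq0_near.
(* Near a, |g| <= |f| + |G| <= 12 |G|, so |g / E|^p + |G / E|^p is at most (12^p + 1) (K ||G /
   E||_p)^p, that is, c0 times [jE G]. *)
pose c0 : R := (12 `^ p + 1) * K `^ p.
have Kp : 0 < K `^ p by rewrite powR_gt0.
have c00 : 0 < c0 by rewrite mulr_gt0// ltr_wpDl// powR_ge0.
(* Every real zero is at distance D >= d from xi, so eta <= D / 4 uniformly. The other bound makes
   the loss, c0 [jE G] over an interval of length 2 eta, at most half of the gain [jE G]. *)
pose eta := Num.min (d / 4) (1 / (4 * c0)).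
have eta0 : 0 < eta by rewrite lt_min !divr_gt0// mulr_gt0.
exists eta => // a b fa fb ab; rewrite ltNge; apply/negP => ba.
have eta1 : eta <= d / 4 by rewrite ge_min lexx.
have eta2 : eta <= 1 / (4 * c0) by rewrite ge_min lexx orbT.
have [h1 Hh1 fh1] := HpE_div p1 hbE E0 Hf fa.
have h1b : h1 (b%:C) = 0.
  have /eqP := fh1 (b%:C); rewrite fb eq_sym mulf_eq0 => /orP[|/eqP//].
  rewrite -cabs_eq0 cabsRB normr_eq0 subr_eq0 eq_sym => /eqP eab.
  by rewrite eab eqxx in ab.
have [h2 Hh2 h1h2] := HpE_div p1 hbE E0 Hh1 h1b.
pose D := `|a - xi|.
have Dd : d <= D.
  rewrite leNgt; apply/negP => aD; have := hd (a%:C); rewrite cabsRB => /(_ aD).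
  by rewrite fa eqxx.
have D0 : 0 < D := lt_le_trans d0 Dd.
pose s := eta ^+ 2 / (4 * D ^+ 2).
have s0 : 0 < s by rewrite divr_gt0 ?exprn_gt0// mulr_gt0// exprn_gt0.
pose A : C := (a - xi)%:C; pose B : C := (b - xi)%:C.
(* With x = z - xi, x^2 = (x - A)(x - B) + (A + B)(x - B) + B^2. Dividing by (x - A)(x - B) writes w
   f through f, [h1] and [h2], all in H^p(E). *)
pose G z := s%:C * (f z + ((A + B) * h1 z + B ^+ 2 * h2 z)).
have HG : Hp G.
  apply: (HpE_scale p1 hbE E0 (s%:C) (HpE_add p1 hbE E0 Hf _)).
  exact: (HpE_add p1 hbE E0 (HpE_scale p1 hbE E0 (A + B) Hh1)
    (HpE_scale p1 hbE E0 (B ^+ 2) Hh2)).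
have GE z : G z = s%:C * (z - xi%:C) ^+ 2 * h2 z.
  rewrite /G fh1 h1h2 /A /B [(a - xi)%:C]rmorphB [(b - xi)%:C]rmorphB /=.
  ring.
pose g z := f z + (-1) * G z.
have Hg : Hp g := HpE_add p1 hbE E0 Hf (HpE_scale p1 hbE E0 (-1) HG).
have gxi : g (xi%:C) = f (xi%:C).
  by rewrite /g GE subrr expr0n /= mulr0 mul0r mulr0 addr0.
have jfg : jE f <= jE g by apply: (jE_min Hg); rewrite /qE gxi.
have jG : 0 < jE G.
  have [x1 x1xi fx1] := exists_real_neq.
  have h20 : h2 (x1%:C) != 0.
    by apply: contra fx1 => /eqP e; rewrite fh1 h1h2 e !mulr0.
  apply: (jE_gt0 HG); exists (x1%:C); rewrite GE.
  apply: mulf_neq0 h20; apply: mulf_neq0.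
    by rewrite -cabs_eq0 cabsR normr_eq0 gt_eqF.
  by apply: expf_neq0; rewrite -cabs_eq0 cabsRB normr_eq0 subr_eq0.
pose t := jE G `^ p^-1.
have t0 : 0 < t by rewrite powR_gt0.
have tp : t `^ p = jE G by rewrite /t -powRrM mulVf ?gt_eqF// powRr1 ?ltW.
have Gx x : q G (x +i* 0) <= K * t.
  have JG : (J G <= (t `^ p)%:E)%E by rewrite tp -(jEE HG); exact: lexx.
  exact: (hK G t HG t0 JG x).
have mono u v : 0 <= u -> 0 <= v -> u <= v -> u `^ p <= v `^ p.
  by move=> ? ? ?; apply: ge0_ler_powR; rewrite ?nnegrE// ltW.
pose c := (12 `^ p + 1) * (K * t) `^ p.
have cE : c = c0 * jE G by rewrite /c /c0 powRM ?ltW// tp mulrA.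
have c_0 : 0 <= c by rewrite cE mulr_ge0 ?jE_ge0// ltW.
have etaD : eta <= D / 4 by apply: le_trans eta1 _; rewrite ler_pM2r.
have qfE x : q f (x +i* 0) = `|x - a| * `|x - b| * q h2 (x +i* 0).
  by rewrite /qE (_ : x +i* 0 = x%:C)// fh1 h1h2 -!mulrA !cabsM !cabsRB.
have qGE x : q G (x +i* 0) = s * `|x - xi| ^+ 2 * q h2 (x +i* 0).
  by rewrite /qE (_ : x +i* 0 = x%:C)// GE !cabsM !cabsRB cabsR gtr0_norm//; ring.
have near_a x : `|x - a| <= eta -> q f (x +i* 0) <= 11 * q G (x +i* 0).
  move=> xa; rewrite qfE qGE mulrA; apply: ler_wpM2r; first exact: qE_ge0.
  exact: (weight_near eta0 ba (erefl D) etaD xa).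
have far_a x : eta < `|x - a| ->
    exists2 u : R, 0 <= u <= 1 & G (x%:C) = u%:C * f (x%:C).
  move=> xa; have [P0 sP] := weight_far eta0 ba (erefl D) etaD xa.
  exists (s * (x - xi) ^+ 2 / ((x - a) * (x - b))).
    rewrite ler_pdivrMr// mul1r sP andbT; apply: divr_ge0 (ltW P0).
    by apply: mulr_ge0 (ltW s0) _; exact: sqr_ge0.
  rewrite GE fh1 h1h2.
  have -> : (x%:C - a%:C) * ((x%:C - b%:C) * h2 x%:C) =
      ((x - a) * (x - b))%:C * h2 x%:C.
    by rewrite rmorphM !rmorphB /= mulrA.
  rewrite mulrA -rmorphM /= divfK ?gt_eqF//.
  have -> // : (s * (x - xi) ^+ 2)%:C = s%:C * (x%:C - xi%:C) ^+ 2 :> C.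
  by rewrite !expr2 !rmorphM rmorphB.
have point x : q g (x +i* 0) `^ p + q G (x +i* 0) `^ p <=
    q f (x +i* 0) `^ p + (if a - eta <= x <= a + eta then c else 0).
  rewrite -ler_distl; case: ifPn => [xa|]; last first.
    rewrite -ltNge => /far_a[u u01 Gu]; have /andP[u0 u1] := u01.
    have qG : q G (x +i* 0) = u * q f (x +i* 0).
      by rewrite /qE (_ : x +i* 0 = x%:C)// Gu -mulrA cabsM cabsR ger0_norm.
    have qg : q g (x +i* 0) = (1 - u) * q f (x +i* 0).
      rewrite /qE (_ : x +i* 0 = x%:C)// /g Gu.
      have -> : f x%:C + -1 * (u%:C * f x%:C) = (1 - u)%:C * f x%:C.
        by rewrite rmorphB /=; ring.
      by rewrite -mulrA cabsM cabsR ger0_norm// subr_ge0.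
    rewrite qG qg !powRM ?qE_ge0 ?subr_ge0// -mulrDl addr0 ler_piMl ?powR_ge0//.
    exact: powR_sub_le.
  apply: ler_wpDl; first exact: powR_ge0.
  have G0 := qE_ge0 E G (x +i* 0).
  have qg : q g (x +i* 0) <= 12 * q G (x +i* 0).
    have : q g (x +i* 0) <= q f (x +i* 0) + q G (x +i* 0).
      rewrite /qE /g mulrDl -mulrA mulN1r.
      by apply: le_trans (cabsB _ _) _.
    move=> /le_trans; apply.
    have -> : 12 * q G (x +i* 0) = 11 * q G (x +i* 0) + q G (x +i* 0) by ring.
    by rewrite lerD2r; exact: near_a.
  have := mono _ _ (qE_ge0 _ _ _) _ qg; rewrite mulr_ge0// => /(_ isT).
  rewrite powRM// => e1.
  have e2 := mono _ _ G0 (ltW (mulr_gt0 K0 t0)) (Gx x).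
  have e3 : 12 `^ p * q G (x +i* 0) `^ p <= 12 `^ p * (K * t) `^ p.
    by rewrite ler_wpM2l// powR_ge0.
  by rewrite /c mulrDl mul1r; apply: lerD => //; exact: le_trans e3.
have [dg _ _] := (HpEP p hbE E0 g).1 Hg; have [df _ _] := (HpEP p hbE E0 f).1 Hf.
have [dG _ _] := (HpEP p hbE E0 G).1 HG.
clearbody g G.
have aa : a - eta <= a + eta.
  by rewrite lerBlDr -addrA lerDl addr_ge0// ltW.
have mq k : (forall z, cdiff k z) -> measurable_fun [set: R] (fun x => q k (x +i* 0) `^ p).
  exact: (measurable_qEp p1 hbE E0 (lexx 0)).
have pos k x : 0 <= q k (x +i* 0) `^ p := powR_ge0 _ _.
have := int_dom2 aa c_0 (mq g dg) (mq G dG) (mq f df) (pos g) (pos G) (pos f) point.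
have fin_le (x y z : \bar R) (x' y' z' w : R) : x = x'%:E -> y = y'%:E -> z = z'%:E ->
    (x + y <= z + w%:E)%E -> x' + y' <= z' + w.
  by move=> -> -> ->; rewrite -!EFinD lee_fin.
move=> /(fin_le _ _ _ _ _ _ _ (jEE Hg) (jEE HG) (jEE Hf)); rewrite cE.
have -> : a + eta - (a - eta) = 2 * eta by ring.
have : c0 * jE G * (2 * eta) <= c0 * jE G * (2 * (1 / (4 * c0))).
  by rewrite ler_pM2l ?mulr_gt0// ler_pM2l.
have -> : c0 * jE G * (2 * (1 / (4 * c0))) = jE G / 2 by field; rewrite gt_eqF.
exact: absorb_lt.
Qed.

End Extremal.

Theorem theorem4 (R : realType) (E : CC R -> CC R) (p xi : R)
  (f : CC R -> CC R) :
  hermite_biehler E ->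
  (forall x : R, E (x%:C : R[i]) != 0) ->
  phase_deriv_Linf E ->
  1 <= p ->
  HpE p E f ->
  (exists z : CC R, f z != 0) ->
  ((cabs (f (xi%:C : R[i]) / E (xi%:C : R[i])))%:E
     = Cbest p E xi * normpE p E f)%E ->
  exists delta : R, 0 < delta /\
    forall l1 l2 : CC R, f l1 = 0 -> f l2 = 0 -> l1 != l2 ->
      delta < cabs ((l1 : R[i]) - l2).
Proof.
move=> hbE E0 phE p1 Hf f0 fE.
have [eta eta0 sep] := real_zeros_separated p1 hbE E0 phE Hf f0 fE.
exists (eta / 2); split; first by rewrite divr_gt0.
move=> l1 l2 z1 z2.
have r1 := real_Im0 (zeros_real p1 hbE E0 phE Hf f0 fE z1).
have r2 := real_Im0 (zeros_real p1 hbE E0 phE Hf f0 fE z2).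
rewrite r1 r2 in z1 z2 *; rewrite cabsRB distrC => l12.
by apply: sep => //; apply: contra l12 => /eqP ->.
Qed.
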